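(* Let $0<p<\infty$ and let $\psi$ be a nonconstant holomorphic map on $\mathbb{C}$ that induces a bounded operator $C_\psi$ on $\mathcal{F}_\varphi^p$. (i) If $p\ge 1$ and $C_\psi$ is not compact on $\mathcal{F}_\varphi^p$, then its essential norm is comparable with its operator norm and $$1\ge\|C_\psi\|_e\simeq\|C_\psi\|,$$ where the constants implied by $\simeq$ do not depend on $\psi$. In the Hilbert space case $\mathcal{F}_\varphi^2$ (that is, $p=2$ and $C_\psi$ bounded and not compact on $\mathcal{F}_\varphi^2$) we have equality and $$\|C_\psi\|_e=\|C_\psi\|=1.$$ (ii) If $C_\psi$ is compact on $\mathcal{F}_\varphi^2$ (the case $p=2$), then it belongs to the Schatten class $\mathcal{S}_s(\mathcal{F}_\varphi^2)$ for all $0<s<\infty$.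
   Context: Weight: $\varphi:[0,\infty)\to[0,\infty)$ is a twice continuously differentiable function, extended to $\mathbb{C}$ by $\varphi(z)=\varphi(|z|)$, with Laplacian $\Delta\varphi>0$. It is assumed that there is a positive radial differentiable function $\tau$ on $\mathbb{C}$ with $\tau(z)\simeq(\Delta\varphi(z))^{-1/2}$ for $|z|\ge 1$ and $\tau(z)\simeq 1$ for $0\le|z|<1$, satisfying $\lim_{r\to\infty}\tau(r)=0$ and $\lim_{r\to\infty}\tau'(r)=0$, and such that either there exists a constant $C>0$ for which $\tau(r)r^C$ increases for large $r$, or $\lim_{r\to\infty}\tau'(r)\log\frac{1}{\tau(r)}=0$. Here $U\simeq V$ means that $U\le cV$ and $V\le cU$ on the set in question for some constant $c>0$. Spaces: for $0<p<\infty$, $\mathcal{F}_\varphi^p$ is the space of entire functions $f$ with $\|f\|_p^p=\int_{\mathbb{C}}|f(z)|^pe^{-p\varphi(z)}\,dA(z)<\infty$, where $dA$ is Lebesgue area measure on $\mathbb{C}$. $\mathcal{F}_\varphi^2$ is a Hilbert space with inner product $\langle f,g\rangle=\int_{\mathbb{C}}f\overline{g}e^{-2\varphi}dA$. Operators: $C_\psi f=f\circ\psi$; $\|C_\psi\|$ is the operator norm on $\mathcal{F}_\varphi^p$. The essential norm of a bounded operator $T$ on a Banach space is $\|T\|_e=\inf\{\|T-K\|: K\text{ a compact operator}\}$. A compact operator $T$ on the Hilbert space $\mathcal{F}_\varphi^2$ has a Schmidt decomposition $Tf=\sum_{n\ge1}\lambda_n\langle f,e_n\rangle\sigma_n$ with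 $(e_n)$, $(\sigma_n)$ orthonormal and $\lambda_n\ge 0$, $\lambda_n\to0$; $T$ belongs to the Schatten class $\mathcal{S}_s(\mathcal{F}_\varphi^2)$ if $\sum_n\lambda_n^s<\infty$. *)

(* Defs.v *)
From HB Require Import structures.
From mathcomp Require Export all_boot all_order all_algebra.
From mathcomp Require Export complex.
From mathcomp Require Export all_classical all_reals all_analysis.
Export Order.TTheory GRing.Theory Num.Theory.
Export numFieldNormedType.Exports.

Set Implicit Arguments.
Unset Strict Implicit.
Unset Printing Implicit Defensive.

Local Open Scope classical_set_scope.
Local Open Scope ring_scope.
Local Open Scope complex_scope.

Definition comparable_on (R : realType) (T : Type) (D : set T)
    (U V : T -> \bar R) : Prop :=
  exists2 c : R, 0 < c &
    forall x, D x -> (U x <= c%:E * V x)%E /\ (V x <= c%:E * U x)%E.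

Section Plane.
Variable R : realType.
Implicit Types (u : R[i] -> R) (f : R[i] -> R[i]^o).

Definition cabs (z : R[i]) : R := Normc.normc z.

Definition plane (q : R * R) : R[i] := q.1 +i* q.2.

Definition area_integral (h : R[i] -> \bar R) : \bar R :=
  (\int[(@lebesgue_measure R) \x (@lebesgue_measure R)]_q h (plane q))%E.

Definition area_Rintegral (h : R[i] -> R) : R :=
  fine (area_integral (fun z => (h z)%:E)).

Definition entire f : Prop := forall z : R[i], derivable (f : R[i]^o -> R[i]^o) z 1.

Let ex : R * R := (1, 0).
Let ey : R * R := (0, 1).

(* Needed because 'D_v is total: it makes the laplacian below meaningful. *)
Definition twice_partially_derivable u : Prop :=
  let v := u \o plane in
  forall q : R * R,
    [/\ derivable v q ex, derivable v q ey,
        derivable ('D_ex v) q ex & derivable ('D_ey v) q ey].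

Definition laplacian u (z : R[i]) : R :=
  let v := u \o plane in
  let q := (complex.Re z, complex.Im z) in
  'D_ex ('D_ex v) q + 'D_ey ('D_ey v) q.

Definition real_differentiable u : Prop :=
  forall q : R * R, differentiable (u \o plane) q.

Definition radial u : Prop := forall z w, cabs z = cabs w -> u z = u w.

End Plane.

Section Weight.
Variable R : realType.

(* g is the derivative of f relative to [0, +oo[ (one-sided at 0). *)
Definition halfline_derivative (f g : R -> R) : Prop :=
  forall x, 0 <= x ->
    h^-1 * (f (x + h) - f x) @[h --> within [set h | 0 <= x + h] (0:R)^'] --> g x.

Definition halfline_C2 (phi : R -> R) : Prop :=
  exists phi1 phi2 : R -> R,
    [/\ halfline_derivative phi phi1, halfline_derivative phi1 phi2 &
        {within `[0, +oo[, continuous phi2}].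

Definition radial_extension (phi : R -> R) (z : R[i]) : R := phi (cabs z).

Definition admissible_tau (phi : R -> R) (tau : R[i] -> R) : Prop :=
  let t (r : R) := tau r%:C in
  [/\ (forall z, 0 < tau z) /\ radial tau, real_differentiable tau,
      comparable_on [set z | 1 <= cabs z] (fun z => (tau z)%:E)
        (fun z => (laplacian (radial_extension phi) z `^ (- 2^-1))%:E) /\
      comparable_on [set z | cabs z < 1] (fun z => (tau z)%:E) (fun=> 1%E),
      t r @[r --> +oo] --> (0:R) /\ derive1 t r @[r --> +oo] --> (0:R) &
      (exists2 C : R, 0 < C &
         exists M : R, forall r s, M <= r -> r <= s ->
           t r * r `^ C <= t s * s `^ C) \/
      derive1 t r * ln ((t r)^-1) @[r --> +oo] --> (0:R)].

(* phi only matters on [0, +oo[. *)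
Definition admissible_weight (phi : R -> R) : Prop :=
  [/\ forall r, 0 <= r -> 0 <= phi r,
      halfline_C2 phi,
      twice_partially_derivable (radial_extension phi),
      forall z, 0 < laplacian (radial_extension phi) z &
      exists tau, admissible_tau phi tau].

End Weight.

Section Fock.
Variables (R : realType) (phi : R -> R).
Notation fct := (R[i] -> R[i]^o).
Implicit Types (p s : R) (f g : fct) (T K : fct -> fct).

Definition Fnorm p f : \bar R :=
  (area_integral (fun z =>
     (cabs (f z) `^ p * expR (- (p * radial_extension phi z)))%:E) `^ p^-1)%E.

Definition Fock p : set fct := [set f | entire f /\ (Fnorm p f < +oo)%E].

(* Operators are functions on all of C -> C, of which only the restriction to
   the space Fock p is relevant. *)
Definition linear_op p T : Prop :=
  (forall f, Fock p f -> Fock p (T f)) /\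
  (forall (a : R[i]) f g, Fock p f -> Fock p g ->
     T (a *: f + g) = a *: T f + T g).

Definition opnorm p T : \bar R :=
  ereal_sup [set Fnorm p (T f) | f in [set f | Fock p f /\ (Fnorm p f <= 1)%E]].

Definition bounded_op p T : Prop := linear_op p T /\ (opnorm p T < +oo)%E.

Definition compact_op p T : Prop :=
  linear_op p T /\
  forall u : nat -> fct,
    (forall n, Fock p (u n)) ->
    (exists M : R, forall n, (Fnorm p (u n) <= M%:E)%E) ->
    exists (k : nat -> nat) (g : fct),
      [/\ {homo k : m n / (m < n)%N}, Fock p g &
          Fnorm p (T (u (k n)) - g) @[n --> \oo] --> 0%E].

(* K is not required to be bounded separately: compactness implies it. *)
Definition essnorm p T : \bar R :=
  ereal_inf [set opnorm p (fun f => T f - K f) | K in compact_op p].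

Definition inner f g : R[i] :=
  let h z := f z * (g z)^* * (expR (- (2 * radial_extension phi z)))%:C in
  area_Rintegral (fun z => complex.Re (h z)) +i*
  area_Rintegral (fun z => complex.Im (h z)).

Definition orthonormal_seq (e : nat -> fct) : Prop :=
  (forall n, Fock 2 (e n)) /\ (forall m n, inner (e m) (e n) = (m == n)%:R).

Definition schmidt_decomposition T (lambda : nat -> R) (e sigma : nat -> fct) :
    Prop :=
  [/\ orthonormal_seq e /\ orthonormal_seq sigma,
      forall n, 0 <= lambda n,
      lambda n @[n --> \oo] --> (0:R) &
      forall f, Fock 2 f ->
        Fnorm 2 (T f -
          (\sum_(0 <= n < N) ((lambda n)%:C * inner f (e n)) *: sigma n))
          @[N --> \oo] --> 0%E].

Definition schatten s T : Prop :=
  compact_op 2 T /\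
  exists lambda e sigma, schmidt_decomposition T lambda e sigma /\
    (\sum_(0 <= n <oo) (lambda n `^ s)%:E < +oo)%E.

Definition Cop (psi : R[i] -> R[i]) : fct -> fct := fun f => f \o psi.

Definition bounded_symbol p : set (R[i] -> R[i]) :=
  [set psi | [/\ entire psi, ~ (exists c, forall z, psi z = c) &
                 bounded_op p (Cop psi)]].

End Fock.

(* Main.v *)
From HB Require Import structures.
Require Import Defs.
From mathcomp Require Import measurable_realfun ring lra cyclic separable cyclotomic.

(* Everything is read off Taylor coefficients. As tau tends to 0, the Laplacian is
   eventually at least 1, so phi grows at least quadratically; averaging over
   rotations gives |c_k| ||z^k|| <= ||f|| for f = sum c_k z^k in the Fock space.
   Testing a bounded composition operator on the powers z^n yields psi(z) = a z + b
   with |a| <= 1, and b = 0 when |a| = 1. If |a| < 1, then for some mu < 1 the norm of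
   (a z + b)^k is O(mu^k ||z^k||), whence compactness. A noncompact operator is
   therefore a rotation, that is, an isometry; a compact operator nearly identifies
   two normalized monomials, so it stays at distance at least 1 from an isometry.
   For p = 2 the singular vectors maximize ||C_psi f|| on successive orthogonal
   complements. Some combination of the first n + 1 of them has its first n Taylor
   coefficients equal to 0, which bounds the n-th singular value by O(mu^n). *)

(** Two opposite facts about the norms [||z^k||] replace any finer analysis of the weight: they
    outgrow every geometric sequence, yet [||z^(2m)||] is at most [K * m! * D^m]. The first removes
    the powers of [z] beyond the first from [psi], and absorbs the disc on which [a z + b] fails to
    contract. The second forbids a translation when [|a| = 1], since that would force [||z^n||]
    itself to grow like [n!]. Testing on [z^n] gives information on [psi^n], whose coefficients are
    intractable. But [|psi^n| e^(-phi)] is the n-th power of [|psi| e^(-phi/n)], so the coefficient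
    bound is applied to [psi] itself, for the weight [phi/n] and the exponent [p n]; this is why
    that bound is proved for an arbitrary continuous weight and with extended norms. The averages
    over rotations are finite sums over roots of unity: Minkowski's inequality and the rotation
    invariance of the norm control them, and Fatou's lemma passes to the limit. In (ii), a geometric
    bound on the singular values is summable to every power [s > 0]. *)

Set Implicit Arguments.
Unset Strict Implicit.
Unset Printing Implicit Defensive.

Local Open Scope classical_set_scope.
Local Open Scope ring_scope.
Local Open Scope complex_scope.

(* The complex numbers carry their topology only through the alias [R[i]^o]. *)
Local Notation C R := (R[i])^o.

(** * Complex differentiability and Goursat's theorem *)

Section Modulus.
Variable R : realType.
Implicit Types (z w : R[i]) (x y : R).

Lemma normC_cabs z : `|z| = (cabs z)%:C.
Proof. by []. Qed.

Lemma cabsM z w : cabs (z * w) = cabs z * cabs w.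
Proof. exact: Normc.normcM. Qed.

Lemma cabsV z : cabs z^-1 = (cabs z)^-1.
Proof. exact: Normc.normcV. Qed.

Lemma cabsN z : cabs (- z) = cabs z.
Proof. exact: normcN. Qed.

Lemma cabsB z w : cabs (z - w) = cabs (w - z).
Proof. by rewrite -cabsN opprB. Qed.

Lemma cabsD z w : cabs (z + w) <= cabs z + cabs w.
Proof. exact: le_normcD. Qed.

Lemma cabs0 : cabs (0 : R[i]) = 0.
Proof. exact: Normc.normc0. Qed.

Lemma cabs1 : cabs (1 : R[i]) = 1.
Proof. exact: Normc.normc1. Qed.

Lemma cabs_ge0 z : 0 <= cabs z.
Proof. by case: z => a b; rewrite /cabs /= sqrtr_ge0. Qed.
#[local] Hint Resolve cabs_ge0 : core.

Lemma cabs_eq0 z : (cabs z == 0) = (z == 0).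
Proof.
apply/eqP/eqP => [/Normc.eq0_normc //|->]; exact: cabs0.
Qed.

Lemma cabs_gt0 z : (0 < cabs z) = (z != 0).
Proof. by rewrite lt_def cabs_eq0 cabs_ge0 andbT. Qed.

Lemma cabsX z n : cabs (z ^+ n) = cabs z ^+ n.
Proof. by elim: n => [|n IH]; rewrite ?expr0 ?cabs1// !exprS cabsM IH. Qed.

Lemma cabs_real x : cabs x%:C = `|x|.
Proof. by rewrite /cabs /= expr0n /= addr0 sqrtr_sqr. Qed.

Lemma cabs_nat n : cabs (n%:R : R[i]) = n%:R.
Proof. by rewrite -(rmorph_nat (real_complex R)) cabs_real ger0_norm. Qed.

Lemma cabs_i : cabs ('i : R[i]) = 1.
Proof. by rewrite /cabs /= expr0n expr1n add0r sqrtr1. Qed.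

Lemma ler_cabsB z w : cabs z - cabs w <= cabs (z - w).
Proof. by rewrite lerBlDr (le_trans _ (cabsD _ _))// subrK. Qed.

Lemma cabs_sum I (r : seq I) (P : pred I) (F : I -> R[i]) :
  cabs (\sum_(i <- r | P i) F i) <= \sum_(i <- r | P i) cabs (F i).
Proof.
elim/big_ind2 : _ => [|a b c d ab cd|//]; first by rewrite cabs0.
exact: le_trans (cabsD _ _) (lerD ab cd).
Qed.

Lemma normr_Re z : `|complex.Re z| <= cabs z.
Proof.
case: z => a b; rewrite /cabs /= -sqrtr_sqr ler_wsqrtr// lerDl; exact: sqr_ge0.
Qed.

Lemma normr_Im z : `|complex.Im z| <= cabs z.
Proof.
case: z => a b; rewrite /cabs /= -sqrtr_sqr ler_wsqrtr// lerDr; exact: sqr_ge0.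
Qed.

Lemma cabs_le_ReIm z : cabs z <= `|complex.Re z| + `|complex.Im z|.
Proof.
rewrite {1}(complexE z) (le_trans (cabsD _ _))// cabsM cabs_i mul1r.
by rewrite !cabs_real.
Qed.

End Modulus.
#[global] Hint Resolve cabs_ge0 : core.
#[global] Arguments cabs : simpl never.

(** * Primitives of continuous real functions *)

Section RealPrimitive.
Variable R : realType.
Implicit Types (g G : R -> R) (a b x y M : R).

Lemma derive0_cst G : (forall x, is_derive x 1 G 0) -> forall x y, G x = G y.
Proof. by move=> h x y; exact: is_derive_0_is_cst. Qed.

(* The primitive vanishing at [0], written without a signed integral. *)
Lemma continuous_has_primitive g : continuous g ->
  exists G : R -> R, forall x, is_derive x 1 G (g x).
Proof.
move=> cg.
have ig a b : (@lebesgue_measure R).-integrable `[a, b] (EFin \o g).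
  apply: continuous_compact_integrable; first exact: segment_compact.
  exact: continuous_subspaceT.
have prim a : exists G : R -> R, forall x, a < x -> is_derive x 1 G (g x).
  exists (fun x => \int[lebesgue_measure]_(t in `[a, x]) g t)%R => x ax.
  have x1 : x < x + 1 by rewrite ltrDl.
  have [d e] := continuous_FTC1_closed x1 (ig a (x + 1)) ax (cg x).
  by apply: (DeriveDef d); rewrite -derive1E; exact: e.
pose G (n : nat) := sval (cid (prim (- n%:R))).
have GP n : forall x, - n%:R < x -> is_derive x 1 (G n) (g x).
  by rewrite /G; case: cid.
(* The shift of index puts 0 strictly inside the domain [- n.+1 < x], so subtracting the value at 0
   makes these primitives agree wherever two of them are defined. *)
pose H n x := G n.+1 x - G n.+1 0.
have HP n x : - n.+1%:R < x -> is_derive x 1 (H n) (g x).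
  move=> nx; have := GP n.+1 x nx => ?.
  by rewrite -[g x]subr0; apply: is_deriveB.
have Heq m n x : (m <= n)%N -> - m.+1%:R < x -> H m x = H n x.
  move=> mn mx.
  have mn' : - n.+1%:R <= - m.+1%:R :> R by rewrite lerN2 ler_nat.
  have key (u v : R) : u <= v -> - m.+1%:R < u -> H m u - H n u = H m v - H n v.
    rewrite le_eqVlt => /predU1P[-> //|uv mu].
    have dd t : t \in `]u, v[ -> is_derive t 1 (H m \- H n) 0.
      rewrite in_itv /= => /andP[ut _].
      rewrite -(subrr (g t)); apply: is_deriveB; apply: HP.
        exact: lt_trans ut.
      exact: le_lt_trans mn' (lt_trans mu ut).
    have cc : {within `[u, v], continuous (H m \- H n)}.
      apply: derivable_within_continuous => t; rewrite in_itv /= => /andP[ut _].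
      apply: derivableB; apply: ex_derive; apply: HP.
        exact: lt_le_trans mu ut.
      exact: le_lt_trans mn' (lt_le_trans mu ut).
    have [t _] := MVT uv dd cc.
    by rewrite mul0r => /eqP; rewrite subr_eq0 => /eqP.
  have m0 : - m.+1%:R < 0 :> R by rewrite oppr_lt0.
  have : H m x - H n x = H m 0 - H n 0.
    by case: (leP x 0) => [x0|/ltW x0]; [apply: key|symmetry; apply: key].
  by rewrite /H !subrr => /eqP; rewrite subr_eq0 => /eqP.
have Heq2 m n x : - m.+1%:R < x -> - n.+1%:R < x -> H m x = H n x.
  by move=> mx nx; case/orP: (leq_total m n) => mn; [|symmetry]; apply: Heq.
have bd y n : `|y| < n%:R -> - n.+1%:R < y.
  rewrite ltr_norml => /andP[+ _]; apply: le_lt_trans.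
  by rewrite lerN2 ler_nat.
exists (fun x => H (Num.bound `|x|) x) => x.
pose n := Num.bound (`|x| + 1).
have nx : `|x| + 1 < n%:R by apply: archi_boundP; rewrite addr_ge0.
have xn : - n.+1%:R < x by apply: bd; rewrite (lt_trans _ nx)// ltrDl.
have := HP n x xn; apply: near_eq_is_derive; rewrite ?oner_eq0//.
near=> y; apply: Heq2; apply: bd; last exact: archi_boundP.
apply: lt_trans nx; rewrite -ltrBlDl (le_lt_trans (lerB_dist _ _))//.
Unshelve. all: by end_near. Qed.

End RealPrimitive.

(** * Limits and derivatives in the complex plane *)

Section ComplexLimits.
Variable R : realType.
Implicit Types (z w l : C R) (x y e : R).

Lemma near_cabs z e : 0 < e -> \forall w \near z, cabs (w - z) < e.
Proof.
move=> e0; apply/nbhs_normP; exists e%:C; rewrite /= ?ltcR// => w /=.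
by rewrite distrC normC_cabs ltcR.
Qed.

(** The norm of [C R] takes its values in [R[i]]; a positive tolerance there has imaginary part 0,
    so convergence can be tested with real moduli and real tolerances. *)
Lemma cvg_cabsP (T : Type) (F : set_system T) (FF : Filter F) (f : T -> C R) l :
  f @ F --> l <-> forall e, 0 < e -> \forall t \near F, cabs (f t - l) <= e.
Proof.
split=> [fl e e0|H].
  have := fl _ (near_cabs l e0); rewrite /fmap /= => h.
  by near=> t; apply: ltW; near: t.
apply/cvgrPdistC_le => -[e1 e2]; rewrite ltcE /= => /andP[/eqP-> e0].
by apply: filterS (H _ e0) => t; rewrite normC_cabs lecR.
Unshelve. all: by end_near. Qed.

Lemma continuous_ReC : continuous (@complex.Re R : C R -> R).
Proof.
move=> z; apply/(@cvgrPdist_le R R (C R) (nbhs z) (nbhs_filter z)) => e e0.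
apply: (@filterS _ _ (nbhs_filter z) _ _ _ (near_cabs z e0)) => w zw.
by rewrite -raddfB (le_trans (normr_Re _))// cabsB ltW.
Qed.

Lemma continuous_ImC : continuous (@complex.Im R : C R -> R).
Proof.
move=> z; apply/(@cvgrPdist_le R R (C R) (nbhs z) (nbhs_filter z)) => e e0.
apply: (@filterS _ _ (nbhs_filter z) _ _ _ (near_cabs z e0)) => w zw.
by rewrite -raddfB (le_trans (normr_Im _))// cabsB ltW.
Qed.

Definition hline y : R -> C R := fun x => x +i* y.
Definition vline x : R -> C R := fun y => x +i* y.

Lemma hlineB y x h : hline y (x + h) - hline y x = h%:C.
Proof. by apply/eqP; rewrite eq_complex /=; apply/andP; split; apply/eqP; ring. Qed.

Lemma vlineB x y h : vline x (y + h) - vline x y = 'i * h%:C.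
Proof. by apply/eqP; rewrite eq_complex /=; apply/andP; split; apply/eqP; ring. Qed.

Lemma continuous_hline y : continuous (hline y).
Proof.
move=> x; apply/cvg_cabsP => e e0; near=> t.
rewrite -[t](subrKC x) hlineB cabs_real; near: t; exact: cvgr_distC_le.
Unshelve. all: by end_near. Qed.

Lemma continuous_vline x : continuous (vline x).
Proof.
move=> y; apply/cvg_cabsP => e e0; near=> t.
rewrite -[t](subrKC y) vlineB cabsM cabs_i mul1r cabs_real.
near: t; exact: cvgr_distC_le.
Unshelve. all: by end_near. Qed.

(* Caratheodory's form of complex differentiability: product and quotient
   rules become statements about continuity. *)
Definition cderiv (f : C R -> C R) z l : Prop :=
  exists q : C R -> C R, [/\ {for z, continuous q}, q z = l &
    \forall w \near z, f w - f z = q w * (w - z)].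

Section Continuity.
Variables (T : topologicalType) (t : T).
Implicit Types f g : T -> C R.

Lemma continuous_atD f g : {for t, continuous f} -> {for t, continuous g} ->
  {for t, continuous (fun s => f s + g s)}.
Proof. exact: cvgD. Qed.

Lemma continuous_atB f g : {for t, continuous f} -> {for t, continuous g} ->
  {for t, continuous (fun s => f s - g s)}.
Proof. exact: cvgB. Qed.

Lemma continuous_atM f g : {for t, continuous f} -> {for t, continuous g} ->
  {for t, continuous (fun s => f s * g s)}.
Proof. exact: cvgM. Qed.

Lemma continuous_atV f : f t != 0 -> {for t, continuous f} ->
  {for t, continuous (fun s => (f s)^-1)}.
Proof. exact: cvgV. Qed.

Lemma continuous_atX f n : {for t, continuous f} ->
  {for t, continuous (fun s => f s ^+ n)}.
Proof.
move=> cf; elim: n => [|n IH]; first exact: cst_continuous.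
have := continuous_atM cf IH.
by congr continuous_at; apply/funext => s; rewrite exprS.
Qed.

Lemma continuous_at_near f g : (\forall s \near t, f s = g s) ->
  {for t, continuous f} -> {for t, continuous g}.
Proof.
move=> fg cf; have ft := nbhs_singleton fg; change (g @ t --> g t); rewrite -ft.
by apply: cvg_trans cf; exact: near_eq_cvg.
Qed.

End Continuity.

Lemma cderiv_continuous f z l : cderiv f z l -> {for z, continuous f}.
Proof.
case=> q [cq _ fq].
apply: (@continuous_at_near _ _ (fun w => q w * (w - z) + f z)).
  by apply: (@filterS _ _ (nbhs_filter z) _ _ _ fq) => w <-; rewrite subrK.
apply: continuous_atD; last exact: cst_continuous.
apply: (continuous_atM cq); apply: continuous_atB; [exact: cvg_id|exact: cst_continuous].
Qed.

Lemma cderiv_quotient f z l : cderiv f z l ->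
  {for z, continuous (fun w => if w == z then l else (f w - f z) / (w - z) : C R)}.
Proof.
case=> q [cq ql fq]; apply: continuous_at_near cq.
apply: (@filterS _ _ (nbhs_filter z) _ _ _ fq) => w fqw; case: eqVneq => [->//|wz].
by rewrite fqw mulfK// subr_eq0.
Qed.

Lemma cderiv_cst (a z : C R) : cderiv (fun=> a) z 0.
Proof.
exists (fun=> 0); split; [exact: cst_continuous|by []|].
by apply: (@nearW _ _ _ (nbhs_filter z)) => w; rewrite mul0r subrr.
Qed.

Lemma cderiv_id z : cderiv id z 1.
Proof.
exists (fun=> 1); split; [exact: cst_continuous|by []|].
by apply: (@nearW _ _ _ (nbhs_filter z)) => w; rewrite mul1r.
Qed.

Lemma cderivD f g z l m : cderiv f z l -> cderiv g z m ->
  cderiv (fun w => f w + g w) z (l + m).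
Proof.
move=> [q [cq <- fq]] [r [cr <- gr]]; exists (fun w => q w + r w); split; [exact (continuous_atD cq cr)|by []|].
by apply: (@filterS2 _ _ (nbhs_filter z) _ _ _ _ fq gr) => w; rewrite mulrDl => <- <-; ring.
Qed.

Lemma cderivM f g z l m : cderiv f z l -> cderiv g z m ->
  cderiv (fun w => f w * g w) z (f z * m + g z * l).
Proof.
move=> df dg; have cf := cderiv_continuous df.
case: df dg => [q [cq <- fq]] [r [cr <- gr]].
exists (fun w => f w * r w + g z * q w); split; [|by []|].
  by apply: continuous_atD; apply: continuous_atM; [exact: cf|exact: cr|exact: cst_continuous|exact: cq].
by apply: (@filterS2 _ _ (nbhs_filter z) _ _ _ _ fq gr) => w; rewrite mulrDl -!mulrA => <- <-; ring.
Qed.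

Lemma cderivV f z l : f z != 0 -> cderiv f z l ->
  cderiv (fun w => (f w)^-1) z (- l / f z ^+ 2).
Proof.
move=> fz df; have cf := cderiv_continuous df.
case: df => [q [cq <- fq]].
exists (fun w => - q w / (f w * f z)); split; [|by []|].
  apply: continuous_atM; first exact: (cvgN cq).
  apply: continuous_atV; first by rewrite mulf_neq0.
  apply: (continuous_atM cf); exact: cst_continuous.
have fn0 : \forall w \near z, f w != 0 by apply: (@cvgr_neq0 _ _ _ _ (nbhs_filter z) f (f z) cf).
apply: (@filterS2 _ _ (nbhs_filter z) _ _ _ _ fq fn0) => w fqw fw.
rewrite (mulrAC (- q w)) mulNr -fqw.
by field; apply/andP.
Qed.

Lemma cderivX n z : cderiv (fun w => w ^+ n) z (n%:R * z ^+ n.-1).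
Proof.
elim: n => [|n IH]; first by rewrite mul0r; exact: cderiv_cst.
have := cderivM (cderiv_id z) IH.
rewrite (_ : _ + _ = n.+1%:R * z ^+ n.+1.-1).
  by congr cderiv; apply/funext => w; rewrite exprS.
case: n {IH} => [|n]; first by rewrite mul0r mulr0 !expr0 add0r.
by rewrite /= !exprS -!(@natr1 _ n); ring.
Qed.

Lemma derivable_cderiv f z : derivable f z 1 -> exists l, cderiv f z l.
Proof.
move=> /cvg_ex[l fl]; exists l.
pose q w : C R := if w == z then l else (f w - f z) / (w - z).
have qz : q z = l by rewrite /q eqxx.
exists q; split; last 2 first.
- exact: qz.
- apply: (@nearW _ _ _ (nbhs_filter z)) => w; rewrite /q.
  case: eqVneq => [->|wz]; first by rewrite !subrr mulr0.
  by rewrite mulfVK// subr_eq0.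
- change (q @ z --> q z); rewrite qz; apply/(@cvg_cabsP _ _ (nbhs_filter z)) => e e0.
  have /cvg_cabsP/(_ _ e0) := fl.
  rewrite !near_simpl => /nbhs_normP[d /= d0 H].
  apply/nbhs_normP; exists d => // w /= wd; rewrite /q; case: eqVneq => [_|wz].
    by rewrite subrr cabs0 ltW.
  have /= := H (w - z); rewrite sub0r normrN distrC => /(_ wd).
  rewrite subr_eq0 => /(_ wz).
  by rewrite /GRing.scale /= mulr1 subrK mulrC.
Qed.

(* A quadratic remainder is all that power series need. *)
Lemma derivable_quadratic (f : C R -> C R) z l M :
  (forall h, cabs h <= 1 -> cabs (f (z + h) - f z - l * h) <= M * cabs h ^+ 2) ->
  derivable f z 1.
Proof.
move=> H; apply/cvg_ex; exists l.
apply/cvg_cabsP => e e0.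
have M0 : 0 <= M.
  by have := le_trans (cabs_ge0 _) (H 1 _); rewrite cabs1 expr1n mulr1; apply.
pose d := Num.min 1 (e / (M + 1)).
have M1 : 0 < M + 1 by rewrite ltr_wpDl.
have d0 : 0 < d by rewrite lt_min ltr01 divr_gt0.
have nd : \forall h \near (0 : C R), cabs (h - 0) < d by exact: near_cabs.
apply: (@filterS _ _ (nbhs_filter (0 : C R)) _ _ _ nd) => h + h0.
rewrite subr0 lt_min => /andP[h1 hM].
rewrite (_ : _ - _ = h^-1 * (f (z + h) - f z - l * h)); last first.
  by rewrite /GRing.scale /= mulr1 (addrC h); field.
rewrite cabsM cabsV ler_pdivrMl ?cabs_gt0//.
apply: (le_trans (H _ (ltW h1))); rewrite expr2 mulrCA; apply: ler_wpM2l; first exact: cabs_ge0.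
apply: (@le_trans _ _ ((M + 1) * cabs h)); first by apply: ler_wpM2r; [exact: cabs_ge0|rewrite lerDl].
by rewrite mulrC -ler_pdivlMr// ltW.
Qed.

End ComplexLimits.

(** * Real integrals as differences of primitives *)

Section RealIntegral.
Variable R : realType.
Implicit Types (g G q : R -> R) (a b x y M : R).

Lemma is_derive_caratheodory G q x : {for x, continuous q} ->
  (\forall t \near x, G t - G x = q t * (t - x)) -> is_derive x 1 G (q x).
Proof.
move=> cq Gq.
have H : h^-1 *: (G (h *: 1 + x) - G x) @[h --> 0^'] --> q x.
  have cq' : (fun h => q (h + x)) @ 0^' --> q x.
    apply: cvg_trans cq; rewrite -[in X in _ `=>` X](add0r x).
    have : (fun h => h + x) @ 0^' --> 0 + x.
      apply: cvg_within_filter; apply: cvgD; [exact: cvg_id|exact: cvg_cst].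
    exact: cvg_app.
  apply: cvg_trans cq'; apply: near_eq_cvg.
  have : \forall h \near (0 : R), G (h + x) - G x = q (h + x) * h.
    have : h + x @[h --> (0:R)] --> x.
      rewrite -[in X in _ --> X](add0r x).
      by apply: cvgD; [exact: cvg_id|exact: cvg_cst].
    move/(_ _ Gq); rewrite /= !near_simpl; apply: filterS => h.
    by rewrite /= addrK.
  move=> /nbhs_dnbhs; apply: filterS2 (nbhs_dnbhs_neq _) => h h0 Gh.
  by rewrite /GRing.scale /= mulr1 Gh mulrCA mulVf// mulr1.
apply: DeriveDef; first by apply/cvg_ex; exists (q x).
exact: cvg_lim H.
Qed.

(** An arbitrary primitive of [g]. Integrals are differences of its values, hence independent of the
    choice; the default is taken only when [g] has no primitive. *)
Definition prim g : R -> R :=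
  xget (fun=> 0) [set G | forall x, is_derive x 1 G (g x)].

Lemma primP g : continuous g -> forall x, is_derive x 1 (prim g) (g x).
Proof.
move=> /continuous_has_primitive exG x.
exact: (@xgetPex _ (fun=> 0) [set G | forall x, is_derive x 1 G (g x)] exG x).
Qed.

Lemma prim_unique g G : continuous g -> (forall x, is_derive x 1 G (g x)) ->
  forall a b, prim g b - prim g a = G b - G a.
Proof.
move=> cg GP a b; apply/eqP; rewrite -subr_eq0; apply/eqP.
have d x : is_derive x 1 (prim g \- G) 0.
  by rewrite -(subrr (g x)); exact (is_deriveB (primP cg x) (GP x)).
have /= := derive0_cst d b a; lra.
Qed.

Lemma prim_bound g a b M : continuous g -> a <= b ->
  (forall x, a <= x <= b -> `|g x| <= M) ->
  `|prim g b - prim g a| <= M * (b - a).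
Proof.
move=> cg ab gM.
have cp : {within `[a, b], continuous (prim g)}.
  apply: derivable_within_continuous => x _.
  exact: (@ex_derive _ _ _ _ _ _ _ (primP cg x)).
have [c cab ->] := MVT_segment ab (fun x _ => primP cg x) cp.
have ba : 0 <= b - a by rewrite subr_ge0.
by rewrite normrM (ger0_norm ba) ler_wpM2r// gM.
Qed.

End RealIntegral.

(** * Integrals of complex functions of a real variable *)

Section PathIntegral.
Variable R : realType.
Implicit Types (f g F G : R -> C R) (a b x y M : R).

Lemma continuous_Re_comp (T : topologicalType) (g : T -> C R) :
  continuous g -> continuous (fun t => complex.Re (g t)).
Proof. by move=> cg t; apply: (continuous_comp (cg t)); exact: continuous_ReC. Qed.

Lemma continuous_Im_comp (T : topologicalType) (g : T -> C R) :
  continuous g -> continuous (fun t => complex.Im (g t)).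
Proof. by move=> cg t; apply: (continuous_comp (cg t)); exact: continuous_ImC. Qed.

(** The oriented integral of [g] from [a] to [b]. As a difference of primitives it is meaningful for
    [b < a] too, and additive over intervals unconditionally. *)
Definition pint g a b : R[i] :=
  let u := prim (fun t => complex.Re (g t)) in
  let v := prim (fun t => complex.Im (g t)) in
  (u b - u a) +i* (v b - v a).

Lemma pint_chain g a b c : pint g a b + pint g b c = pint g a c.
Proof. by apply/eqP; rewrite eq_complex /=; apply/andP; split; apply/eqP; ring. Qed.

Definition pderiv G x (l : R[i]) : Prop :=
  is_derive x 1 (fun t => complex.Re (G t)) (complex.Re l) /\
  is_derive x 1 (fun t => complex.Im (G t)) (complex.Im l).

Lemma pint_FTC g G a b : continuous g -> (forall x, pderiv G x (g x)) ->
  pint g a b = G b - G a.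
Proof.
move=> cg dG; apply/eqP; rewrite eq_complex /=; apply/andP; split; apply/eqP.
  rewrite (prim_unique (continuous_Re_comp cg) (fun x => (dG x).1)).
  by rewrite raddfB.
rewrite (prim_unique (continuous_Im_comp cg) (fun x => (dG x).2)).
by rewrite raddfB.
Qed.

Lemma pint_pderiv g : continuous g -> forall a x, pderiv (pint g a) x (g x).
Proof.
move=> cg a x; split => /=.
  rewrite -[complex.Re (g x)]subr0; exact (is_deriveB (primP (continuous_Re_comp cg) x) (is_derive_cst _ _ _)).
rewrite -[complex.Im (g x)]subr0; exact (is_deriveB (primP (continuous_Im_comp cg) x) (is_derive_cst _ _ _)).
Qed.

Lemma pderiv_lin (k : R[i]) F G x l m : pderiv F x l -> pderiv G x m ->
  pderiv (fun t => k * F t + G t) x (k * l + m).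
Proof.
case: k => k1 k2 [Fr Fi] [Gr Gi]; split.
- have := is_deriveD (is_deriveB (is_deriveZ k1 Fr) (is_deriveZ k2 Fi)) Gr.
  rewrite (_ : _ + complex.Re m = complex.Re ((k1 +i* k2) * l + m)).
    apply: near_eq_is_derive; apply: (@nearW _ _ _ (nbhs_filter x)) => t.
    by rewrite !fctE /=; case: (F t) => l1 l2; case: (G t).
  by case: l {Fr Fi} => l1 l2; case: m {Gr Gi}.
- have := is_deriveD (is_deriveD (is_deriveZ k1 Fi) (is_deriveZ k2 Fr)) Gi.
  rewrite (_ : _ + complex.Im m = complex.Im ((k1 +i* k2) * l + m)).
    apply: near_eq_is_derive; apply: (@nearW _ _ _ (nbhs_filter x)) => t.
    by rewrite !fctE /=; case: (F t) => l1 l2; case: (G t).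
  by case: l {Fr Fi} => l1 l2; case: m {Gr Gi}.
Qed.

Lemma pint_lin (k : R[i]) f g a b : continuous f -> continuous g ->
  pint (fun t => k * f t + g t) a b = k * pint f a b + pint g a b.
Proof.
move=> cf cg.
have c : continuous (fun t => k * f t + g t : C R).
  move=> t; apply: (continuous_atD _ (cg t)).
  apply: (continuous_atM _ (cf t)); exact: cst_continuous.
rewrite (pint_FTC a b c (fun x => pderiv_lin k (pint_pderiv cf a x) (pint_pderiv cg a x))).
have p0 h : pint h a a = 0 by rewrite /pint !subrr.
by rewrite !p0 mulr0 addr0 subr0.
Qed.

(** The factor 2 comes from bounding the real and the imaginary part separately; the limiting
    arguments below tolerate any constant. *)
Lemma pint_bound g a b M : continuous g -> a <= b ->
  (forall x, a <= x <= b -> cabs (g x) <= M) ->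
  cabs (pint g a b) <= 2 * M * (b - a).
Proof.
move=> cg ab gM; apply: (le_trans (cabs_le_ReIm _)) => /=.
rewrite -mulrA mulr_natl mulr2n; apply: lerD.
  apply: (prim_bound (continuous_Re_comp cg) ab) => x xab.
  exact: le_trans (normr_Re _) (gM _ xab).
apply: (prim_bound (continuous_Im_comp cg) ab) => x xab.
exact: le_trans (normr_Im _) (gM _ xab).
Qed.

Lemma cderiv_hline (F : C R -> C R) y x l : cderiv F (hline y x) l ->
  pderiv (fun t => F (hline y t)) x l.
Proof.
case=> q [cq <- Fq].
have cq' : {for x, continuous (fun t => q (hline y t))}.
  exact: continuous_comp (@continuous_hline _ y x) cq.
have /(_ _ Fq) := @continuous_hline _ y x; rewrite /= !near_simpl => Fq'.
have E h : hline y h - hline y x = (h - x)%:C.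
  by rewrite -(hlineB y x) subrKC.
split.
- apply: (@is_derive_caratheodory _ _ (fun t => complex.Re (q (hline y t)))).
    exact: continuous_comp cq' (@continuous_ReC _ _).
  apply: filterS Fq' => t /(congr1 (@complex.Re R)).
  by rewrite E raddfB; case: (q _) => q1 q2 /= ->; ring.
- apply: (@is_derive_caratheodory _ _ (fun t => complex.Im (q (hline y t)))).
    exact: continuous_comp cq' (@continuous_ImC _ _).
  apply: filterS Fq' => t /(congr1 (@complex.Im R)).
  by rewrite E raddfB; case: (q _) => q1 q2 /= ->; ring.
Qed.

Lemma cderiv_vline (F : C R -> C R) x y l : cderiv F (vline x y) l ->
  pderiv (fun t => F (vline x t)) y ('i * l).
Proof.
case=> q [cq <- Fq].
have cq' : {for y, continuous (fun t => 'i * q (vline x t) : C R)}.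
  apply: continuous_atM; first exact: cst_continuous.
  exact: continuous_comp (@continuous_vline _ x y) cq.
have /(_ _ Fq) := @continuous_vline _ x y; rewrite /= !near_simpl => Fq'.
have E h : vline x h - vline x y = 'i * (h - y)%:C.
  by rewrite -(vlineB x y) subrKC.
split.
- apply: (@is_derive_caratheodory _ _ (fun t => complex.Re ('i * q (vline x t)))).
    exact: continuous_comp cq' (@continuous_ReC _ _).
  apply: filterS Fq' => t /(congr1 (@complex.Re R)).
  by rewrite E raddfB; case: (q _) => q1 q2 /= ->; ring.
- apply: (@is_derive_caratheodory _ _ (fun t => complex.Im ('i * q (vline x t)))).
    exact: continuous_comp cq' (@continuous_ImC _ _).
  apply: filterS Fq' => t /(congr1 (@complex.Im R)).
  by rewrite E raddfB; case: (q _) => q1 q2 /= ->; ring.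
Qed.

End PathIntegral.

(** * Boundary integrals of rectangles *)

Section Rectangle.
Variable R : realType.
Implicit Types (f g F : C R -> C R) (x y M : R).

(** The counterclockwise boundary integral; the factor ['i] is the speed of the vertical
    parametrization [vline]. *)
Definition rect f x0 x1 y0 y1 : R[i] :=
  pint (f \o hline y0) x0 x1 - pint (f \o hline y1) x0 x1 +
  'i * (pint (f \o vline x1) y0 y1 - pint (f \o vline x0) y0 y1).

(** Continuity is asked along the whole lines that carry the sides, because [prim] is controlled for
    integrands continuous on all of [R]. *)
Definition line_continuous f x0 x1 y0 y1 : Prop :=
  [/\ continuous (f \o hline y0), continuous (f \o hline y1),
      continuous (f \o vline x1) & continuous (f \o vline x0)].

Definition on_lines x0 x1 y0 y1 (z : R[i]) : Prop :=
  [\/ complex.Im z = y0, complex.Im z = y1,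
      complex.Re z = x1 | complex.Re z = x0].

Lemma continuous_hline_comp f y : continuous f -> continuous (f \o hline y).
Proof. by move=> cf x; apply: (continuous_comp (@continuous_hline _ y x)); exact: cf. Qed.

Lemma continuous_vline_comp f x : continuous f -> continuous (f \o vline x).
Proof. by move=> cf y; apply: (continuous_comp (@continuous_vline _ x y)); exact: cf. Qed.

Lemma continuous_line f x0 x1 y0 y1 : continuous f ->
  line_continuous f x0 x1 y0 y1.
Proof.
by move=> cf; split; [exact: continuous_hline_comp|exact: continuous_hline_comp|
  exact: continuous_vline_comp|exact: continuous_vline_comp].
Qed.

Lemma continuous_on_lines f x0 x1 y0 y1 :
  (forall z, on_lines x0 x1 y0 y1 z -> {for z, continuous f}) ->
  line_continuous f x0 x1 y0 y1.
Proof.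
move=> cf; split => t.
- apply: (continuous_comp (@continuous_hline _ y0 t)); apply: cf; exact: Or41.
- apply: (continuous_comp (@continuous_hline _ y1 t)); apply: cf; exact: Or42.
- apply: (continuous_comp (@continuous_vline _ x1 t)); apply: cf; exact: Or43.
- apply: (continuous_comp (@continuous_vline _ x0 t)); apply: cf; exact: Or44.
Qed.

Lemma rect_ext f g x0 x1 y0 y1 :
  (forall z, on_lines x0 x1 y0 y1 z -> f z = g z) ->
  rect f x0 x1 y0 y1 = rect g x0 x1 y0 y1.
Proof.
move=> fg; rewrite /rect.
have -> : f \o hline y0 = g \o hline y0 by apply/funext => t; apply: fg; exact: Or41.
have -> : f \o hline y1 = g \o hline y1 by apply/funext => t; apply: fg; exact: Or42.
have -> : f \o vline x1 = g \o vline x1 by apply/funext => t; apply: fg; exact: Or43.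
by have -> : f \o vline x0 = g \o vline x0 by apply/funext => t; apply: fg; exact: Or44.
Qed.

Lemma rect_lin (k : R[i]) f g x0 x1 y0 y1 :
  line_continuous f x0 x1 y0 y1 -> line_continuous g x0 x1 y0 y1 ->
  rect (fun z => k * f z + g z) x0 x1 y0 y1 =
  k * rect f x0 x1 y0 y1 + rect g x0 x1 y0 y1.
Proof.
move=> [f1 f2 f3 f4] [g1 g2 g3 g4]; rewrite /rect.
have /= -> := pint_lin k x0 x1 f1 g1.
have /= -> := pint_lin k x0 x1 f2 g2.
have /= -> := pint_lin k y0 y1 f3 g3.
have /= -> := pint_lin k y0 y1 f4 g4.
by rewrite /comp; ring.
Qed.

Lemma rect_splitx f x0 x1 x2 y0 y1 :
  rect f x0 x2 y0 y1 = rect f x0 x1 y0 y1 + rect f x1 x2 y0 y1.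
Proof. by rewrite /rect -(pint_chain _ x0 x1 x2) -(pint_chain _ x0 x1 x2); ring. Qed.

Lemma rect_splity f x0 x1 y0 y1 y2 :
  rect f x0 x1 y0 y2 = rect f x0 x1 y0 y1 + rect f x0 x1 y1 y2.
Proof. by rewrite /rect -(pint_chain _ y0 y1 y2) -(pint_chain _ y0 y1 y2); ring. Qed.

Lemma rect_primitive f F x0 x1 y0 y1 : line_continuous f x0 x1 y0 y1 ->
  (forall z, on_lines x0 x1 y0 y1 z -> cderiv F z (f z)) ->
  rect f x0 x1 y0 y1 = 0.
Proof.
move=> [f1 f2 f3 f4] dF; rewrite /rect.
have h y : continuous (f \o hline y) ->
    (forall x, cderiv F (hline y x) (f (hline y x))) ->
    pint (f \o hline y) x0 x1 = F (hline y x1) - F (hline y x0).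
  by move=> cf dFy; rewrite (pint_FTC x0 x1 cf (fun x => cderiv_hline (dFy x))).
have v x : continuous (f \o vline x) ->
    (forall y, cderiv F (vline x y) (f (vline x y))) ->
    'i * pint (f \o vline x) y0 y1 = F (vline x y1) - F (vline x y0).
  move=> cf dFx.
  have cif : continuous (fun t => 'i * (f \o vline x) t + 0 : C R).
    move=> t; apply: (continuous_atD _ (@cst_continuous _ _ _ t)).
    apply: (continuous_atM _ (cf t)); exact: cst_continuous.
  have := pint_lin 'i y0 y1 cf (@cst_continuous _ _ (0 : C R)).
  rewrite (_ : pint (fun=> 0) y0 y1 = 0) ?addr0.
    move=> <-; rewrite (pint_FTC (G := fun t => F (vline x t)) y0 y1 cif)//.
    by move=> y /=; rewrite addr0; exact: cderiv_vline.
  rewrite (pint_FTC (G := fun=> 0) y0 y1 (@cst_continuous _ _ (0 : C R))) ?subrr//.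
  by move=> y; split; exact: is_derive_cst.
rewrite mulrBr (h y0)// ?(h y1)// ?(v x1)// ?(v x0)//.
- by rewrite /hline /vline; ring.
- by move=> y; apply: dF; exact: Or44.
- by move=> y; apply: dF; exact: Or43.
- by move=> y; apply: dF; exact: Or42.
- by move=> y; apply: dF; exact: Or41.
Qed.

Lemma rect_bound f x0 x1 y0 y1 M : line_continuous f x0 x1 y0 y1 ->
  x0 <= x1 -> y0 <= y1 ->
  (forall x y, x0 <= x <= x1 -> y0 <= y <= y1 ->
     on_lines x0 x1 y0 y1 (x +i* y) -> cabs (f (x +i* y)) <= M) ->
  cabs (rect f x0 x1 y0 y1) <= 4 * M * ((x1 - x0) + (y1 - y0)).
Proof.
move=> [f1 f2 f3 f4] x01 y01 fM; rewrite /rect.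
have x00 : x0 <= x0 <= x1 by rewrite lexx.
have x11 : x0 <= x1 <= x1 by rewrite lexx x01.
have y00 : y0 <= y0 <= y1 by rewrite lexx.
have y11 : y0 <= y1 <= y1 by rewrite lexx y01.
have b1 : cabs (pint (f \o hline y0) x0 x1) <= 2 * M * (x1 - x0).
  by apply: pint_bound => // x xx; apply: fM => //; exact: Or41.
have b2 : cabs (pint (f \o hline y1) x0 x1) <= 2 * M * (x1 - x0).
  by apply: pint_bound => // x xx; apply: fM => //; exact: Or42.
have b3 : cabs (pint (f \o vline x1) y0 y1) <= 2 * M * (y1 - y0).
  by apply: pint_bound => // y yy; apply: fM => //; exact: Or43.
have b4 : cabs (pint (f \o vline x0) y0 y1) <= 2 * M * (y1 - y0).
  by apply: pint_bound => // y yy; apply: fM => //; exact: Or44.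
have dB (a b : R[i]) : cabs (a - b) <= cabs a + cabs b.
  by rewrite -(cabsN b) cabsD.
apply: (le_trans (cabsD _ _)); rewrite cabsM cabs_i mul1r.
have := dB (pint (f \o hline y0) x0 x1) (pint (f \o hline y1) x0 x1).
have := dB (pint (f \o vline x1) y0 y1) (pint (f \o vline x0) y0 y1).
lra.
Qed.

End Rectangle.
#[global] Arguments rect : simpl never.

(** * Goursat's theorem by bisection *)

Section Goursat.
Variable R : realType.
Implicit Types (f g F : C R -> C R) (x y M w h : R).

Lemma rect_affine (a b : R[i]) x0 x1 y0 y1 :
  rect (fun z => a + b * z : C R) x0 x1 y0 y1 = 0.
Proof.
apply: (@rect_primitive _ _ (fun z => a * z + b / 2 * (z * z))).
  apply: continuous_line => z.
  apply: continuous_atD; first exact: cst_continuous.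
  apply: continuous_atM; [exact: cst_continuous|exact: cvg_id].
move=> z _.
rewrite (_ : a + b * z = (a * 1 + z * 0) + (b / 2 * (z * 1 + z * 1) + z * z * 0)).
  apply: cderivD; apply: cderivM (cderiv_cst _ _) _; first exact: cderiv_id.
  by apply: cderivM; exact: cderiv_id.
by field.
Qed.

(** The four quarters add up to the whole, so if three of them carry less than a quarter of the
    modulus, the last one carries at least that share. *)
Lemma rect_quarter f x y w h : exists p : R * R,
  [/\ cabs (rect f x (x + w) y (y + h)) <=
      4 * cabs (rect f p.1 (p.1 + w / 2) p.2 (p.2 + h / 2)),
      p.1 = x \/ p.1 = x + w / 2 & p.2 = y \/ p.2 = y + h / 2].
Proof.
pose A := rect f x (x + w / 2) y (y + h / 2).
pose B := rect f x (x + w / 2) (y + h / 2) (y + h / 2 + h / 2).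
pose D := rect f (x + w / 2) (x + w / 2 + w / 2) y (y + h / 2).
pose E := rect f (x + w / 2) (x + w / 2 + w / 2) (y + h / 2) (y + h / 2 + h / 2).
pose S := rect f x (x + w) y (y + h).
have SE : S = (A + B) + (D + E).
  rewrite /S (_ : x + w = x + w / 2 + w / 2); last by field.
  rewrite (_ : y + h = y + h / 2 + h / 2); last by field.
  by rewrite (rect_splitx _ _ (x + w / 2)) !(rect_splity _ _ _ y (y + h / 2) (y + h / 2 + h / 2)).
have le4 : cabs S <= cabs A + cabs B + (cabs D + cabs E).
  rewrite SE; apply: (le_trans (cabsD _ _)); apply: lerD; exact: cabsD.
have [HA|HA] := leP (cabs S) (4 * cabs A).
  by exists (x, y); split => //=; left.
have [HB|HB] := leP (cabs S) (4 * cabs B).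
  by exists (x, y + h / 2); split => //=; [left|right].
have [HD|HD] := leP (cabs S) (4 * cabs D).
  by exists (x + w / 2, y); split => //=; [right|left].
exists (x + w / 2, y + h / 2); split => /=; [|by right|by right].
by rewrite -/S -/E; lra.
Qed.

(** The common point is the supremum of the left end points, each of which stays below every right
    end point. *)
Lemma nested_intervals (a : nat -> R) w : 0 <= w ->
  (forall n, a n.+1 = a n \/ a n.+1 = a n + w / 2 ^+ n.+1) ->
  exists c, forall n, a n <= c <= a n + w / 2 ^+ n.
Proof.
move=> w0 aS.
have p2 n : 0 < 2 ^+ n :> R by exact: exprn_gt0.
have half n : w / 2 ^+ n.+1 + w / 2 ^+ n.+1 = w / 2 ^+ n.
  by rewrite exprS; field; apply: lt0r_neq0.
have nn n : 0 <= w / 2 ^+ n by rewrite divr_ge0// ltW.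
have step n k : a n <= a (n + k)%N /\
    a (n + k)%N + w / 2 ^+ (n + k) <= a n + w / 2 ^+ n.
  elim: k => [|k [IH1 IH2]]; first by rewrite addn0.
  have := nn (n + k).+1; have := half (n + k)%N; have := aS (n + k)%N.
  rewrite addnS; move: IH1 IH2.
  set u := w / 2 ^+ (n + k).+1; set v := w / 2 ^+ (n + k); set t := w / 2 ^+ n.
  by move=> ? ? [->|->] ? ?; split; lra.
have up m n : a m <= a n + w / 2 ^+ n.
  case/orP: (leq_total m n) => [/subnKC <-|/subnKC <-].
    have [+ _] := step m (n - m)%N; have := nn (m + (n - m))%N.
    by set v := w / _; lra.
  have [_] := step n (m - n)%N; have := nn (n + (m - n))%N.
  by set v := w / 2 ^+ (n + (m - n)); set t := w / 2 ^+ n; lra.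
have ub : ubound (range a) (a 0%N + w / 2 ^+ 0) by move=> _ [n _ <-]; exact: up.
exists (sup (range a)) => n; apply/andP; split.
  by apply: ub_le_sup; [exists (a 0%N + w / 2 ^+ 0)|exists n].
apply: ge_sup; first by exists (a 0%N), 0%N.
by move=> _ [m _ <-].
Qed.

Lemma distr_ge_le x c t s : t <= x <= t + s -> t <= c <= t + s -> `|x - c| <= s.
Proof.
by move=> /andP[? ?] /andP[? ?]; rewrite ler_norml; apply/andP; split; lra.
Qed.

(** The n-th selected quarter keeps at least [4^-n] of the modulus of the integral. Near the common
    point, [f] minus its affine part is at most a small multiple of the distance; distance and
    perimeter are both of order [2^-n], and the affine part integrates to 0, so the small multiple
    bounds the whole integral. *)
Theorem goursat f x0 x1 y0 y1 : continuous f -> x0 <= x1 -> y0 <= y1 ->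
  (forall x y, x0 <= x <= x1 -> y0 <= y <= y1 -> exists l, cderiv f (x +i* y) l) ->
  rect f x0 x1 y0 y1 = 0.
Proof.
move=> cf x01 y01 df.
pose w := x1 - x0; pose h := y1 - y0.
have w0 : 0 <= w by rewrite subr_ge0.
have h0 : 0 <= h by rewrite subr_ge0.
pose next n (p : R * R) : R * R :=
  sval (cid (rect_quarter f p.1 p.2 (w / 2 ^+ n) (h / 2 ^+ n))).
pose s := fix s n := if n is m.+1 then next m (s m) else (x0, y0).
have half (v : R) n : v / 2 ^+ n / 2 = v / 2 ^+ n.+1.
  by rewrite exprSr; field; apply: lt0r_neq0; exact: exprn_gt0.
pose Q n := cabs (rect f (s n).1 ((s n).1 + w / 2 ^+ n) (s n).2 ((s n).2 + h / 2 ^+ n)).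
have sP n : [/\ Q n <= 4 * Q n.+1,
    (s n.+1).1 = (s n).1 \/ (s n.+1).1 = (s n).1 + w / 2 ^+ n.+1 &
    (s n.+1).2 = (s n).2 \/ (s n.+1).2 = (s n).2 + h / 2 ^+ n.+1].
  have := svalP (cid (rect_quarter f (s n).1 (s n).2 (w / 2 ^+ n) (h / 2 ^+ n))).
  by rewrite -/(next n (s n)) !half.
have [a aP] : exists c, forall n, (s n).1 <= c <= (s n).1 + w / 2 ^+ n.
  by apply: nested_intervals => // n; case: (sP n).
have [b bP] : exists c, forall n, (s n).2 <= c <= (s n).2 + h / 2 ^+ n.
  by apply: nested_intervals => // n; case: (sP n).
have Q0 n : Q 0%N <= 4 ^+ n * Q n.
  elim: n => [|n IH]; first by rewrite mul1r.
  apply: (le_trans IH); rewrite exprSr -mulrA ler_wpM2l ?exprn_ge0//.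
  by case: (sP n).
have Q0E : Q 0%N = cabs (rect f x0 x1 y0 y1).
  by rewrite /Q /= expr0 !divr1 /w /h !subrKC.
apply/eqP; rewrite -cabs_eq0 -Q0E -(subrr (0 : R)) eq_le; apply/andP; split; last first.
  by rewrite subrr cabs_ge0.
rewrite subrr; apply/ler_addgt0Pl => e e0; rewrite addr0.
have [l [q [cq ql fq]]] : exists l, cderiv f (a +i* b) l.
  have := aP 0%N; have := bP 0%N; rewrite /= expr0 !divr1 /w /h !subrKC => ? ?.
  exact: df.
pose z : C R := a +i* b.
(* The estimate ends with [4 * e' * (w + h) ^+ 2]; the added 1 keeps the denominator positive for a
   degenerate rectangle. *)
pose e' := e / (4 * (w + h + 1) ^+ 2).
have wh : 0 < w + h + 1 by rewrite ltr_wpDl// addr_ge0.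
have e'0 : 0 < e' by rewrite divr_gt0// mulr_gt0// exprn_gt0.
have near1 : \forall v \near z, cabs (f v - (f z - l * z + l * v)) <= e' * cabs (v - z).
  have /(@cvg_cabsP _ _ _ (nbhs_filter z)) /(_ _ e'0) := cq.
  rewrite ql => cq'.
  apply: (@filterS2 _ _ (nbhs_filter z) _ _ _ _ fq cq') => v fv qv.
  rewrite (_ : f v - _ = (q v - l) * (v - z)); first by rewrite cabsM; apply: ler_wpM2r; [exact: cabs_ge0|exact: qv].
  by rewrite mulrBl -fv /z; ring.
have [d /= d0 near2] : exists2 d : R, 0 < d &
    forall v, cabs (v - z) < d -> cabs (f v - (f z - l * z + l * v)) <= e' * cabs (v - z).
  move/nbhs_normP: near1 => [[d1 d2] /=]; rewrite ltcE /= => /andP[/eqP-> d0] H.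
  by exists d1 => // v vz; apply: H; rewrite /= distrC normC_cabs ltcR.
have [n nd] : exists n, (w + h + 1) / 2 ^+ n < d.
  exists (Num.bound ((w + h + 1) / d)).
  rewrite ltr_pdivrMr ?exprn_gt0// mulrC -ltr_pdivrMr//.
  apply: lt_trans (archi_boundP _) _; first by rewrite divr_ge0// ltW.
  by rewrite -natrX ltr_nat ltn_expl.
set X := (s n).1; set Y := (s n).2; set W := w / 2 ^+ n; set H := h / 2 ^+ n.
have p2 : 0 < 2 ^+ n :> R by exact: exprn_gt0.
have W0 : 0 <= W by rewrite divr_ge0// ltW.
have H0 : 0 <= H by rewrite divr_ge0// ltW.
have WH : W + H < d.
  apply: le_lt_trans nd; rewrite /W /H -mulrDl.
  by apply: ler_wpM2r; [rewrite invr_ge0 ltW|rewrite lerDl].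
pose r v : C R := f v - (f z - l * z + l * v).
have caff : continuous (fun v : C R => f z - l * z + l * v : C R).
  move=> v; apply: (@continuous_atD _ _ v (fun=> f z - l * z) (fun v => l * v)).
    exact: cst_continuous.
  apply: (@continuous_atM _ _ v (fun=> l) id); [exact: cst_continuous|exact: cvg_id].
have cr : continuous r by move=> v; exact (continuous_atB (cf v) (caff v)).
have fr : rect f X (X + W) Y (Y + H) = rect r X (X + W) Y (Y + H).
  have L1 := continuous_line X (X + W) Y (Y + H) cr.
  have L2 := continuous_line X (X + W) Y (Y + H) caff.
  have := rect_lin 1 L1 L2; rewrite rect_affine mul1r addr0 => <-.
  by apply: rect_ext => v _; rewrite mul1r /r subrK.
have rb : cabs (rect r X (X + W) Y (Y + H)) <=
    4 * (e' * (W + H)) * ((X + W - X) + (Y + H - Y)).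
  apply: (rect_bound (continuous_line _ _ _ _ cr)); [by rewrite lerDl|by rewrite lerDl|].
  move=> x y xX yY _.
  have vz : cabs (x +i* y - z) <= W + H.
    apply: (le_trans (cabs_le_ReIm _)); rewrite !raddfB /=.
    by apply: lerD; apply: distr_ge_le; [exact: xX|exact: aP|exact: yY|exact: bP].
  apply: (le_trans (near2 _ (le_lt_trans vz WH))).
  by apply: ler_wpM2l => //; exact: ltW.
apply: (le_trans (Q0 n)); rewrite /Q -/X -/Y -/W -/H fr.
apply: (@le_trans _ _ (4 ^+ n * (4 * (e' * (W + H)) * (X + W - X + (Y + H - Y))))).
  by rewrite ler_wpM2l ?exprn_ge0.
rewrite (_ : _ * _ = 4 * e' * (w + h) ^+ 2); last first.
  rewrite /W /H; have -> : (4 : R) ^+ n = 2 ^+ n * 2 ^+ n by rewrite -exprMn; congr (_ ^+ _); lra.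
  by field; exact: lt0r_neq0.
rewrite /e' (_ : _ * _ = e * ((w + h) / (w + h + 1)) ^+ 2); last first.
  by field; exact: lt0r_neq0.
have q0 : 0 <= (w + h) / (w + h + 1) by apply: divr_ge0; [exact: addr_ge0|exact: ltW].
have q1 : (w + h) / (w + h + 1) <= 1 by rewrite ler_pdivrMr// mul1r lerDl.
by apply: ler_piMr; [exact: ltW|exact: exprn_ile1].
Qed.

End Goursat.

(** * Taylor expansions of entire functions *)

Section CauchySquare.
Variable R : realType.
Implicit Types (f g F : C R -> C R) (x y M r : R) (z w : C R).

Lemma continuous_locally_bounded f (z : C R) : {for z, continuous f} ->
  exists d M : R, 0 < d /\ forall w : C R, cabs (w - z) < d -> cabs (f w) <= M.
Proof.
move=> /(@cvg_cabsP _ _ _ (nbhs_filter z)) /(_ _ ltr01).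
move=> /nbhs_normP[[d1 d2] /=]; rewrite ltcE /= => /andP[/eqP-> d0] H.
exists d1, (1 + cabs (f z)); split => // w wz.
rewrite -[f w](subrK (f z)) (le_trans (cabsD _ _))// lerD2r.
by apply: H; rewrite /= distrC normC_cabs ltcR.
Qed.

(** A small square of half side [t] is cut out around the exceptional point. The four remaining
    rectangles fall under [goursat], and since [f] is bounded near the point the integral around the
    square is O([t]). *)
Lemma goursat_punctured f x0 x1 y0 y1 a b : continuous f ->
  x0 < a < x1 -> y0 < b < y1 ->
  (forall z, z != a +i* b -> exists l, cderiv f z l) ->
  rect f x0 x1 y0 y1 = 0.
Proof.
move=> cf /andP[xa ax] /andP[yb By] df.
have [d [M [d0 fM]]] := continuous_locally_bounded (cf (a +i* b)).
have M0 : 0 <= M.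
  by apply: (le_trans (cabs_ge0 _)) (fM (a +i* b) _); rewrite subrr cabs0.
apply/eqP; rewrite -cabs_eq0 eq_le cabs_ge0 andbT.
apply/ler_addgt0Pl => e e0; rewrite addr0.
pose m := Num.min (Num.min (a - x0) (x1 - a)) (Num.min (b - y0) (y1 - b)).
(* [m] keeps the square inside the rectangle, [d / 3] keeps it where [f] is bounded by [M], and the
   boundary integral is then at most [16 * M * t]. *)
pose t := Num.min m (Num.min (d / 3) (e / (16 * (M + 1)))).
have M1 : 0 < 16 * (M + 1) by rewrite mulr_gt0// ltr_wpDl.
have t0 : 0 < t.
  by rewrite !lt_min !subr_gt0 xa ax yb By !divr_gt0.
have : t <= t by []; rewrite {2}/t /m !le_min.
move=> /andP[/andP[/andP[t1 t2] /andP[t3 t4]] /andP[t5 t6]].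
have off u v p q : u <= p -> v <= q ->
    (forall x y, u <= x <= p -> v <= y <= q -> x != a \/ y != b) ->
    rect f u p v q = 0.
  move=> up vq H; apply: (goursat cf up vq) => x y xx yy; apply: df.
  by rewrite eq_complex /= negb_and; apply/orP; exact: H.
rewrite (rect_splitx _ x0 (a - t) x1) (rect_splitx _ (a - t) (a + t) x1).
rewrite (off x0 y0 (a - t) y1); [|lra|lra|]; last first.
  by move=> x y xx _; left; apply/eqP; lra.
rewrite (off (a + t) y0 x1 y1); [|lra|lra|]; last first.
  by move=> x y xx _; left; apply/eqP; lra.
rewrite (rect_splity _ _ _ y0 (b - t) y1) (rect_splity _ _ _ (b - t) (b + t) y1).
rewrite (off (a - t) y0 (a + t) (b - t)); [|lra|lra|]; last first.
  by move=> x y _ yy; right; apply/eqP; lra.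
rewrite (off (a - t) (b + t) (a + t) y1); [|lra|lra|]; last first.
  by move=> x y _ yy; right; apply/eqP; lra.
rewrite !add0r !addr0.
have L := continuous_line (a - t) (a + t) (b - t) (b + t) cf.
have := @rect_bound _ f (a - t) (a + t) (b - t) (b + t) M L.
move=> H; apply: (le_trans (H _ _ _)); [lra|lra| |].
  move=> x y xx yy _; apply: fM; apply: (le_lt_trans (cabs_le_ReIm _)).
  rewrite !raddfB /=.
  have ? : `|x - a| <= t by rewrite ler_norml; apply/andP; split; lra.
  have ? : `|y - b| <= t by rewrite ler_norml; apply/andP; split; lra.
  lra.
move: t6; rewrite ler_pdivlMr// => t6.
have : 0 <= t * (M + 1) - M * t by rewrite mulrC -mulrBl addrAC subrr add0r mul1r ltW.
lra.
Qed.

Lemma cderiv_near f g z l : (\forall w \near z, f w = g w) -> cderiv f z l ->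
  cderiv g z l.
Proof.
move=> fg [q [cq ql fq]]; have fgz : f z = g z := nbhs_singleton fg.
exists q; split; [exact: cq|exact: ql|].
by apply: (@filterS2 _ _ (nbhs_filter z) _ _ _ _ fg fq) => w <-; rewrite -fgz.
Qed.

Definition holomorphic f := forall z, exists l, cderiv f z l.

Lemma holomorphic_continuous f : holomorphic f -> continuous f.
Proof. by move=> hf z; have [l /cderiv_continuous] := hf z. Qed.

Definition square f r : R[i] := rect f (- r) r (- r) r.

Definition on_square r (z : R[i]) := on_lines (- r) r (- r) r z.

Lemma on_square_neq r (z w : R[i]) : on_square r w ->
  `|complex.Re z| < r -> `|complex.Im z| < r -> w - z != 0.
Proof.
rewrite !ltr_norml => H /andP[z1 z2] /andP[z3 z4].
by rewrite subr_eq0; apply/eqP => wz; subst w; case: H => H; lra.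
Qed.

(** The difference quotient of [f] at [z], completed by the derivative, is continuous and
    differentiable off [z], so its integral vanishes. The kernel integral on the right is left
    unevaluated. *)
Lemma cauchy_square f r (z : R[i]) : holomorphic f ->
  `|complex.Re z| < r -> `|complex.Im z| < r ->
  square (fun w => f w / (w - z)) r = f z * square (fun w => 1 / (w - z)) r.
Proof.
move=> hf zr zi; have cf := holomorphic_continuous hf.
have [l fl] := hf z.
pose h w : C R := if w == z then l else (f w - f z) / (w - z).
have hE (w : C R) : w != z -> \forall v \near w, (f v - f z) / (v - z) = h v.
  move=> wz; have wz' : w - z != 0 by rewrite subr_eq0.
  have : \forall v \near w, v - z != 0.
    apply: (@cvgr_neq0 _ _ _ _ (nbhs_filter w) (fun v : C R => v - z : C R) (w - z)) => //.
    by apply: continuous_atB; [exact: cvg_id|exact: cst_continuous].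
  apply: (@filterS _ _ (nbhs_filter w)) => v; rewrite subr_eq0 /h.
  by case: eqVneq.
have cid w : {for w, continuous (fun v : C R => v - z : C R)}.
  by apply: continuous_atB; [exact: cvg_id|exact: cst_continuous].
have dinv (w : C R) : w != z -> cderiv (fun v => (v - z)^-1) w (- (1 + 0) / (w - z) ^+ 2).
  move=> wz; apply: (@cderivV _ (fun v => v - z)); first by rewrite subr_eq0.
  exact (cderivD (cderiv_id w) (cderiv_cst (- z) w)).
have dh (w : C R) : w != z -> exists k, cderiv h w k.
  move=> wz; have [k fk] := hf w.
  have := cderivM (cderivD fk (cderiv_cst (- f z) w)) (dinv w wz).
  by move/(cderiv_near (hE w wz)) => ?; eexists; eassumption.
have ch : continuous h.
  move=> w; have [wz|/dh[k]] := eqVneq w z; last by move/cderiv_continuous.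
  by rewrite wz; exact: cderiv_quotient fl.
have h0 : square h r = 0.
  have zE : complex.Re z +i* complex.Im z = z by apply/eqP; rewrite eq_complex /= !eqxx.
  apply: (@goursat_punctured _ _ _ _ _ (complex.Re z) (complex.Im z) ch).
  - by rewrite -ltr_norml.
  - by rewrite -ltr_norml.
  - by rewrite zE.
have L1 : line_continuous h (- r) r (- r) r by exact: continuous_line.
have L2 : line_continuous (fun w => 1 / (w - z) : C R) (- r) r (- r) r.
  apply: continuous_on_lines => w wr; have wz := on_square_neq wr zr zi.
  rewrite subr_eq0 in wz.
  exact (@continuous_atM _ _ (w : C R) (fun=> 1) (fun v => (v - z)^-1)
    (@cst_continuous _ _ (1 : C R) (w : C R)) (cderiv_continuous (dinv w wz))).
have := rect_lin (f z) L2 L1; rewrite -/(square _ r) -/(square h r) h0 addr0 => <-.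
apply: rect_ext => w wr; have wz := on_square_neq wr zr zi.
rewrite /h; rewrite subr_eq0 in wz; rewrite (negbTE wz).
by field; rewrite subr_eq0.
Qed.

End CauchySquare.

(** * Power series on a disc from integrals over a square *)

Section Taylor.
Variable R : realType.
Implicit Types (f F : C R -> C R) (x y M A B r q : R) (z w : C R).

Lemma path_bounded (g : R -> C R) a b : continuous g -> a <= b ->
  exists2 M : R, 0 <= M & forall x, a <= x <= b -> cabs (g x) <= M.
Proof.
move=> cg ab.
pose u x := `|complex.Re (g x)| + `|complex.Im (g x)|.
have cu : continuous u.
  by move=> x; apply: cvgD; apply: cvg_norm; [exact: continuous_Re_comp|exact: continuous_Im_comp].
have [c _ uc] := EVT_max ab (continuous_subspaceT cu).
exists (u c); first by rewrite addr_ge0.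
by move=> x xab; apply: (le_trans (cabs_le_ReIm _)); apply: uc; rewrite in_itv.
Qed.

Lemma prim_lower_bound (g : R -> R) a b M : continuous g -> a <= b ->
  (forall x, a <= x <= b -> M <= g x) -> M * (b - a) <= prim g b - prim g a.
Proof.
move=> cg ab gM.
have cp : {within `[a, b], continuous (prim g)}.
  apply: derivable_within_continuous => x _.
  exact: (@ex_derive _ _ _ _ _ _ _ (primP cg x)).
have [c cab ->] := MVT_segment ab (fun x _ => primP cg x) cp.
by apply: ler_wpM2r; [rewrite subr_ge0|exact: gM].
Qed.

Lemma prim_opp (g : R -> R) a b : continuous g ->
  prim (fun x => - g x) b - prim (fun x => - g x) a = - (prim g b - prim g a).
Proof.
move=> cg; have cn : continuous (fun x => - g x) by move=> x; exact: cvgN (cg x).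
have d x : is_derive x 1 (fun x => - prim g x) (- g x).
  exact (is_deriveN (primP cg x)).
by rewrite (prim_unique cn d) opprB opprK addrC.
Qed.

Lemma on_square_cabs r z : 0 < r -> on_square r z -> r <= cabs z.
Proof.
move=> r0; have ? := normr_Re z; have ? := normr_Im z.
by case=> h; [apply: le_trans (normr_Im z)|apply: le_trans (normr_Im z)
  |apply: le_trans (normr_Re z)|apply: le_trans (normr_Re z)];
  rewrite h ?normrN gtr0_norm.
Qed.

Lemma on_square_neq0 r z : 0 < r -> on_square r z -> z != 0.
Proof. by move=> r0 /(on_square_cabs r0) rz; rewrite -cabs_gt0 (lt_le_trans r0). Qed.

Lemma continuous_inv z : z != 0 -> {for z, continuous (fun w : C R => w^-1 : C R)}.
Proof. move=> z0; exact (continuous_atV z0 (@cvg_id _ (nbhs z))). Qed.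

(* Each of the four sides contributes the same integral of [r / (t^2 + r^2)]
   to the imaginary part. *)
Lemma square_inv_neq0 r : 0 < r -> square (fun w => w^-1 : C R) r != 0.
Proof.
move=> r0.
pose u (t : R) := r / (t ^+ 2 + r ^+ 2).
have den (t : R) : 0 < t ^+ 2 + r ^+ 2.
  by apply: ltr_wpDl; [exact: sqr_ge0|exact: exprn_gt0].
have den0 (t : R) : t ^+ 2 + r ^+ 2 != 0 by rewrite lt0r_neq0.
have den' (t : R) : (- r) ^+ 2 + t ^+ 2 != 0 by rewrite sqrrN addrC.
have [c1 c2 c3 c4] : line_continuous (fun w => w^-1 : C R) (- r) r (- r) r.
  by apply: continuous_on_lines => w /(on_square_neq0 r0); exact: continuous_inv.
have E1 : (fun t => complex.Im ((fun w => w^-1 : C R) (hline (- r) t))) = u.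
  by apply/funext => t; rewrite /hline /u /= sqrrN mulNr opprK.
have E2 : (fun t => complex.Im ((fun w => w^-1 : C R) (hline r t))) = (fun t => - u t).
  by apply/funext => t; rewrite /hline /u /=.
have E3 : (fun t => complex.Re ((fun w => w^-1 : C R) (vline r t))) = u.
  by apply/funext => t; rewrite /vline /u /= addrC.
have E4 : (fun t => complex.Re ((fun w => w^-1 : C R) (vline (- r) t))) = (fun t => - u t).
  by apply/funext => t; rewrite /vline /u /= sqrrN addrC mulNr.
have cu : continuous u by rewrite -E1; exact: continuous_Im_comp c1.
(* Being nonzero is all that a normalizing constant must satisfy, so [2 pi i] is never computed: on
   [[-r, r]] the integrand is at least [r / (2 r^2)], over a length [2 r]. *)
have ub : 1 <= prim u r - prim u (- r).
  apply: le_trans (prim_lower_bound (M := r / (r ^+ 2 + r ^+ 2)) cu _ _).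
  - by rewrite (_ : _ * _ = 1)//; field; rewrite lt0r_neq0.
  - lra.
  - move=> t tr; rewrite /u ler_pM2l// lef_pV2 ?posrE//.
    rewrite lerD2r -[t ^+ 2]real_normK ?num_real//.
    by apply: lerXn2r; [rewrite nnegrE|rewrite nnegrE ltW|rewrite ler_norml].
rewrite eq_complex negb_and; apply/orP; right.
rewrite /square /rect /pint /comp /= E1 E2 E3 E4 !(prim_opp _ _ cu).
rewrite mul0r add0r mul1r; apply/eqP => h; lra.
Qed.

(** The finite geometric expansion of [1 / (w - z)] in powers of [z / w], with its exact remainder,
    integrated against [F]. *)
Lemma square_geometric F r z n : holomorphic F -> 0 < r -> cabs z < r ->
  square (fun w => F w / (w - z)) r =
  \sum_(k < n) z ^+ k * square (fun w => F w / w ^+ k.+1) r +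
  z ^+ n * square (fun w => F w / (w ^+ n * (w - z))) r.
Proof.
move=> hF r0 zr; have cF := holomorphic_continuous hF.
have zr1 := le_lt_trans (normr_Re z) zr.
have zr2 := le_lt_trans (normr_Im z) zr.
elim: n => [|n IH].
  rewrite big_ord0 add0r mul1r; apply: rect_ext => w _; by rewrite mul1r.
rewrite big_ord_recr /= IH -addrA; congr (_ + _).
rewrite exprSr -mulrA -mulrDr; congr (_ * _).
have L1 : line_continuous (fun w => F w / (w ^+ n.+1 * (w - z)) : C R) (- r) r (- r) r.
  apply: continuous_on_lines => w wr.
  have w0 := on_square_neq0 r0 wr; have wz := on_square_neq wr zr1 zr2.
  apply: (continuous_atM (cF w)).
  apply: (@continuous_atV _ _ (w : C R) (fun w => w ^+ n.+1 * (w - z) : C R)).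
    by rewrite mulf_neq0// expf_neq0.
  apply: (@continuous_atM _ _ (w : C R) (fun w => w ^+ n.+1) (fun w => w - z)).
    exact (continuous_atX (n := n.+1) (@cvg_id _ (nbhs (w : C R)))).
  exact (continuous_atB (@cvg_id _ (nbhs (w : C R))) (@cst_continuous _ _ z (w : C R))).
have L2 : line_continuous (fun w => F w / w ^+ n.+1 : C R) (- r) r (- r) r.
  apply: continuous_on_lines => w wr; have w0 := on_square_neq0 r0 wr.
  apply: (continuous_atM (cF w)).
  apply: (@continuous_atV _ _ (w : C R) (fun w => w ^+ n.+1 : C R)).
    by rewrite expf_neq0.
  exact (continuous_atX (n := n.+1) (@cvg_id _ (nbhs (w : C R)))).
rewrite addrC -(rect_lin z L1 L2); apply: rect_ext => w wr.
have w0 := on_square_neq0 r0 wr; have wz := on_square_neq wr zr1 zr2.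
rewrite exprS; field; rewrite wz w0 expf_neq0//.
Qed.

Lemma holomorphic_square_bounded F r : holomorphic F -> 0 < r ->
  exists2 M, 0 <= M & forall x y, - r <= x <= r -> - r <= y <= r ->
    on_square r (x +i* y) -> cabs (F (x +i* y)) <= M.
Proof.
move=> hF r0; have cF := holomorphic_continuous hF.
have rr : - r <= r by lra.
have [M1 M10 H1] := path_bounded (continuous_hline_comp (y := - r) cF) rr.
have [M2 M20 H2] := path_bounded (continuous_hline_comp (y := r) cF) rr.
have [M3 M30 H3] := path_bounded (continuous_vline_comp (x := r) cF) rr.
have [M4 M40 H4] := path_bounded (continuous_vline_comp (x := - r) cF) rr.
exists (M1 + M2 + (M3 + M4)); first by rewrite !addr_ge0.
move=> x y xr yr [/= E|/= E|/= E|/= E]; rewrite E.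
- by apply: (le_trans (H1 x xr)); lra.
- by apply: (le_trans (H2 x xr)); lra.
- by apply: (le_trans (H3 y yr)); lra.
- by apply: (le_trans (H4 y yr)); lra.
Qed.

Lemma square_moment_bound F r : holomorphic F -> 0 < r ->
  exists2 B, 0 <= B & forall k,
    cabs (square (fun w => F w / w ^+ k.+1) r) * r ^+ k <= B.
Proof.
move=> hF r0; have cF := holomorphic_continuous hF.
have [M M0 FM] := holomorphic_square_bounded hF r0.
exists (16 * M); first by rewrite mulr_ge0.
move=> k; rewrite -ler_pdivlMr ?exprn_gt0//.
have L2 : line_continuous (fun w => F w / w ^+ k.+1 : C R) (- r) r (- r) r.
  apply: continuous_on_lines => w wr; have w0 := on_square_neq0 r0 wr.
  apply: (continuous_atM (cF w)).
  apply: (@continuous_atV _ _ (w : C R) (fun w => w ^+ k.+1 : C R)).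
    by rewrite expf_neq0.
  exact (continuous_atX (n := k.+1) (@cvg_id _ (nbhs (w : C R)))).
apply: (le_trans (rect_bound (M := M / r ^+ k.+1) L2 _ _ _)); [lra|lra| |].
  move=> x y xr yr xy; rewrite cabsM cabsV cabsX.
  apply: ler_pM; [exact: cabs_ge0|by rewrite invr_ge0 exprn_ge0 ?cabs_ge0|exact: FM|].
  rewrite lef_pV2 ?posrE ?exprn_gt0//; last exact: lt_le_trans (on_square_cabs r0 xy).
  by apply: lerXn2r; [rewrite nnegrE ltW|exact: cabs_ge0|exact: on_square_cabs].
rewrite exprS le_eqVlt; apply/orP; left; apply/eqP; field.
by rewrite expf_neq0 lt0r_neq0.
Qed.

Lemma square_remainder_bound F r z : holomorphic F -> 0 < r -> cabs z < r ->
  exists A, forall n,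
    cabs (z ^+ n * square (fun w => F w / (w ^+ n * (w - z))) r) <= A * (cabs z / r) ^+ n.
Proof.
move=> hF r0 zr; have cF := holomorphic_continuous hF.
have zr1 := le_lt_trans (normr_Re z) zr.
have zr2 := le_lt_trans (normr_Im z) zr.
have [M M0 FM] := holomorphic_square_bounded hF r0.
exists (16 * M * r / (r - cabs z)) => n.
have L1 : line_continuous (fun w => F w / (w ^+ n * (w - z)) : C R) (- r) r (- r) r.
  apply: continuous_on_lines => w wr.
  have w0 := on_square_neq0 r0 wr; have wz := on_square_neq wr zr1 zr2.
  apply: (continuous_atM (cF w)).
  apply: (@continuous_atV _ _ (w : C R) (fun w => w ^+ n * (w - z) : C R)).
    by rewrite mulf_neq0// expf_neq0.
  apply: (@continuous_atM _ _ (w : C R) (fun w => w ^+ n) (fun w => w - z)).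
    exact (continuous_atX (n := n) (@cvg_id _ (nbhs (w : C R)))).
  exact (continuous_atB (@cvg_id _ (nbhs (w : C R))) (@cst_continuous _ _ z (w : C R))).
have rz : 0 < r - cabs z by rewrite subr_gt0.
have B : cabs (square (fun w => F w / (w ^+ n * (w - z))) r) <=
    4 * (M / (r ^+ n * (r - cabs z))) * ((r - - r) + (r - - r)).
  apply: (rect_bound L1); [lra|lra|] => x y xr yr xy.
  rewrite cabsM cabsV cabsM cabsX.
  have xyr := on_square_cabs r0 xy.
  have xyz : r - cabs z <= cabs (x +i* y - z).
    by apply: le_trans (ler_cabsB _ _); rewrite lerD2r.
  apply: ler_pM; [exact: cabs_ge0| |exact: FM|].
    by rewrite invr_ge0 mulr_ge0 ?exprn_ge0 ?cabs_ge0.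
  rewrite lef_pV2 ?posrE; [|by rewrite mulr_gt0 ?exprn_gt0 ?(lt_le_trans _ xyr) ?(lt_le_trans _ xyz)|by rewrite mulr_gt0 ?exprn_gt0].
  apply: ler_pM; [by rewrite exprn_ge0 ?ltW|exact: ltW| |exact: xyz].
  by apply: lerXn2r; [rewrite nnegrE ltW|exact: cabs_ge0|].
rewrite cabsM cabsX.
apply: (le_trans (ler_wpM2l (exprn_ge0 n (cabs_ge0 z)) B)).
rewrite expr_div_n le_eqVlt; apply/orP; left; apply/eqP; field.
by rewrite (lt0r_neq0 rz) expf_neq0// lt0r_neq0.
Qed.

Lemma geometric_small_eq0 A q e : 0 <= q < 1 -> 0 <= e ->
  (forall n, e <= A * q ^+ n.+1) -> e = 0.
Proof.
move=> /andP[q0 q1] e0 H; apply/eqP; rewrite eq_le e0 andbT.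
have cq : (fun n => (A * q) * q ^+ n) @ \oo --> (A * q) * 0.
  by apply: cvgM; [exact: cvg_cst|apply: cvg_expr; rewrite ger0_norm].
rewrite mulr0 in cq.
rewrite -(cvg_lim (@Rhausdorff R) cq); apply: limr_ge; first by apply/cvg_ex; exists 0.
by apply: nearW => n; rewrite -mulrA -exprS; exact: H.
Qed.

(** In the geometric expansion for the constant 1, every term after the first has a primitive on the
    square and integrates to 0, while the remainder tends to 0. One constant thus normalizes
    Cauchy's formula at all points of the disc. *)
Lemma square_inv_shift r z : 0 < r -> cabs z < r ->
  square (fun w => 1 / (w - z)) r = square (fun w => w^-1) r.
Proof.
move=> r0 zr.
have h1 : holomorphic (fun=> 1 : C R) by move=> w; exists 0; exact: cderiv_cst.
have [A HA] := square_remainder_bound h1 r0 zr.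
have S0 k : square (fun w => 1 / w ^+ k.+2) r = 0.
  apply: (@rect_primitive _ _ (fun w => - (k.+1%:R)^-1 * (w ^+ k.+1)^-1)).
    apply: continuous_on_lines => w wr; have w0 := on_square_neq0 r0 wr.
    apply: (@continuous_atM _ _ (w : C R) (fun=> 1) (fun w => (w ^+ k.+2)^-1)).
      exact: cst_continuous.
    apply: (@continuous_atV _ _ (w : C R) (fun w => w ^+ k.+2 : C R)).
      by rewrite expf_neq0.
    exact (continuous_atX (n := k.+2) (@cvg_id _ (nbhs (w : C R)))).
  move=> w wr; have w0 := on_square_neq0 r0 wr.
  have w1 : w ^+ k.+1 != 0 by rewrite expf_neq0.
  have D1 := @cderivV _ (fun w : C R => w ^+ k.+1) (w : C R) _ w1 (cderivX k.+1 (w : C R)).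
  have D2 := cderivM (cderiv_cst (- (k.+1%:R)^-1) (w : C R)) D1.
  have k0 : (k.+1%:R : R[i]) != 0 by rewrite pnatr_eq0.
  rewrite (_ : 1 / w ^+ k.+2 = - k.+1%:R^-1 * (- (k.+1%:R * w ^+ k.+1.-1) / (w ^+ k.+1) ^+ 2) +
    (w ^+ k.+1)^-1 * 0); first exact D2.
  by rewrite /= !exprS; field; rewrite nat1r w0 k0 expf_neq0.
have G n : square (fun w => 1 / (w - z)) r = square (fun w => w^-1) r +
    z ^+ n.+1 * square (fun w => 1 / (w ^+ n.+1 * (w - z))) r.
  rewrite (square_geometric n.+1 h1 r0 zr) big_ord_recl big1 ?addr0.
    by rewrite mul1r; congr (_ + _); apply: rect_ext => w _; rewrite expr1 mul1r.
  by move=> i _; rewrite S0 mulr0.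
apply/eqP; rewrite -subr_eq0 -cabs_eq0; apply/eqP.
apply: (@geometric_small_eq0 A (cabs z / r)).
- apply/andP; split; first exact: divr_ge0 (cabs_ge0 z) (ltW r0).
  by rewrite ltr_pdivrMr// mul1r.
- exact: cabs_ge0.
- by move=> n; rewrite (G n) addrAC subrr add0r.
Qed.

Definition taylor_sum (c : nat -> R[i]) (z : R[i]) n := \sum_(k < n) c k * z ^+ k.

(** Cauchy's formula with the geometric expansion of the kernel; the integral of [w^-1] plays the
    role of [2 pi i]. *)
Theorem taylor_disc f r : holomorphic f -> 0 < r -> exists c : nat -> R[i],
  (exists B, forall k, cabs (c k) * r ^+ k <= B) /\
  forall z, cabs z < r ->
    exists A, forall n, cabs (f z - taylor_sum c z n) <= A * (cabs z / r) ^+ n.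
Proof.
move=> hf r0; have k0 := square_inv_neq0 r0.
set k := square _ r in k0.
exists (fun n => square (fun w => f w / w ^+ n.+1) r / k); split.
  have [B _ HB] := square_moment_bound hf r0.
  exists (B / cabs k) => n; rewrite cabsM cabsV mulrAC.
  by apply: ler_wpM2r; [rewrite invr_ge0 cabs_ge0|exact: HB].
move=> z zr.
have zr1 := le_lt_trans (normr_Re z) zr.
have zr2 := le_lt_trans (normr_Im z) zr.
have [A HA] := square_remainder_bound hf r0 zr.
exists (A / cabs k) => n.
have E := cauchy_square hf zr1 zr2.
rewrite (square_inv_shift r0 zr) -/k (square_geometric n hf r0 zr) in E.
rewrite (_ : _ - _ = (z ^+ n * square (fun w => f w / (w ^+ n * (w - z))) r) / k).
  rewrite cabsM cabsV (mulrAC A).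
  by apply: ler_wpM2r; [rewrite invr_ge0 cabs_ge0|exact: HA].
have -> : f z = f z * k / k by rewrite mulfK.
rewrite -E mulrDl addrAC -[RHS]add0r; congr (_ + _).
apply/eqP; rewrite subr_eq0 mulr_suml; apply/eqP; apply: eq_bigr => i _.
by rewrite mulrC mulrA mulrAC (mulrC (k^-1)).
Qed.

End Taylor.

(** * Complex series with a geometric majorant *)

Section ComplexSeries.
Variable R : realType.
Implicit Types (u : nat -> R[i]) (B q x y : R) (z l : C R).

Lemma geometric_sum_le B q m n : 0 <= B -> 0 <= q < 1 -> (m <= n)%N ->
  \sum_(m <= k < n) B * q ^+ k <= B * q ^+ m / (1 - q).
Proof.
move=> B0 /andP[q0 q1] mn; have q1' : 0 < 1 - q by rewrite subr_gt0.
suff -> : \sum_(m <= k < n) B * q ^+ k = B * (q ^+ m - q ^+ n) / (1 - q).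
  apply: ler_wpM2r; first by rewrite invr_ge0 ltW.
  by apply: ler_wpM2l => //; rewrite gerBl exprn_ge0.
elim: n mn => [|n IH].
  by rewrite leqn0 => /eqP ->; rewrite big_geq// subrr mulr0 mul0r.
rewrite leq_eqVlt => /predU1P[->|]; first by rewrite big_geq// subrr mulr0 mul0r.
rewrite ltnS => mn; rewrite big_nat_recr//= IH// exprS.
by field; rewrite lt0r_neq0.
Qed.

Lemma cvg_ReIm (T : Type) (F : set_system T) (FF : Filter F) (f : T -> C R) x y :
  (fun t => complex.Re (f t)) @ F --> x -> (fun t => complex.Im (f t)) @ F --> y ->
  f @ F --> (x +i* y : C R).
Proof.
move=> /cvgrPdistC_le fx /cvgrPdistC_le fy; apply/cvg_cabsP => e e0.
have e2 : 0 < e / 2 by rewrite divr_gt0.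
have Hx : \forall t \near F, `|complex.Re (f t) - x| <= e / 2 := fx _ e2.
have Hy : \forall t \near F, `|complex.Im (f t) - y| <= e / 2 := fy _ e2.
apply: filterS2 Hx Hy => t tx ty; apply: (le_trans (cabs_le_ReIm _)).
by rewrite !raddfB /= (splitr e) lerD.
Qed.

Lemma cvg_cabs_bound (T : Type) (F : set_system T) (FF : ProperFilter F)
    (f : T -> C R) l z B :
  f @ F --> l -> (\forall t \near F, cabs (f t - z) <= B) -> cabs (l - z) <= B.
Proof.
move=> /cvg_cabsP fl fB; apply/ler_addgt0Pl => e e0.
have [t [tl tz]] := filter_ex (filterI (fl _ e0) fB).
rewrite (_ : l - z = - (f t - l) + (f t - z)); last by ring.
by apply: (le_trans (cabsD _ _)); rewrite cabsN lerD.
Qed.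

Lemma cvg_complex_unique (u : nat -> C R) l l' :
  u @ \oo --> l -> u @ \oo --> l' -> l = l'.
Proof.
move=> ul /cvg_cabsP ul'; apply/eqP; rewrite -subr_eq0 -cabs_eq0 eq_le cabs_ge0 andbT.
apply/ler_addgt0Pl => e e0; rewrite addr0.
exact: cvg_cabs_bound ul (ul' e e0).
Qed.

Lemma geometric_series_cvg u B q : 0 <= q < 1 -> (forall k, cabs (u k) <= B * q ^+ k) ->
  exists l : C R, (fun n => \sum_(k < n) u k : C R) @ \oo --> l /\
    forall n, cabs (l - \sum_(k < n) u k) <= B * q ^+ n / (1 - q).
Proof.
move=> /andP[q0 q1] uB.
have B0 : 0 <= B by have := le_trans (cabs_ge0 _) (uB 0%N); rewrite mulr1.
have geo : cvgn (series (fun k => B * q ^+ k)).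
  by apply: is_cvg_geometric_series; rewrite ger0_norm.
have part (v : nat -> R) : (forall k, `|v k| <= B * q ^+ k) ->
    exists x, (fun n => \sum_(k < n) v k) @ \oo --> x.
  move=> vB; have : cvgn (series v).
    apply: normed_cvg; apply: (series_le_cvg _ _ _ geo) => n /=.
    - exact: normr_ge0.
    - by rewrite mulr_ge0 ?exprn_ge0.
    - exact: vB.
  move=> /cvg_ex[x vx]; exists x; move: vx; rewrite /series /=.
  by under eq_fun do rewrite big_mkord.
have [x ux] := part (fun k => complex.Re (u k)) (fun k => le_trans (normr_Re _) (uB k)).
have [y uy] := part (fun k => complex.Im (u k)) (fun k => le_trans (normr_Im _) (uB k)).
have lim : (fun n => \sum_(k < n) u k : C R) @ \oo --> (x +i* y : C R).
  apply: cvg_ReIm.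
    by move: ux; under eq_fun do rewrite -raddf_sum.
  by move: uy; under eq_fun do rewrite -raddf_sum.
exists (x +i* y); split; first exact: lim.
move=> n; have := @cvg_cabs_bound _ _ _ _ _ (\sum_(k < n) u k) (B * q ^+ n / (1 - q)) lim.
apply; exists n => // m /= nm.
rewrite -!(big_mkord xpredT u) (big_cat_nat _ nm)//= addrAC subrr add0r.
apply: (le_trans (cabs_sum _ _ _)).
have q01 : 0 <= q < 1 by rewrite q0.
apply: le_trans (geometric_sum_le B0 q01 nm).
by apply: ler_sum => k _; exact: uB.
Qed.

End ComplexSeries.

(** * Everywhere convergent power series *)

Section PowerSeries.
Variable R : realType.
Implicit Types (c d : nat -> R[i]) (f g : C R -> C R) (B r q : R) (z w : C R).

(** Infinite radius of convergence, expressed by Cauchy estimates at every radius. *)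
Definition entire_coef c := forall r, 0 < r -> exists B, forall k, cabs (c k) * r ^+ k <= B.

Definition has_taylor f c := entire_coef c /\
  forall z, (taylor_sum c z : nat -> C R) @ \oo --> f z.

(** The estimate at radius [2 * r] leaves the ratio 1/2 on the disc of radius [r]. *)
Lemma entire_coef_geometric c r : entire_coef c -> 0 < r -> exists B,
  0 <= B /\ forall z k, cabs z <= r -> cabs (c k) * cabs z ^+ k <= B * 2^-1 ^+ k.
Proof.
move=> /(_ (2 * r)) H r0; have [|B HB] := H; first by rewrite mulr_gt0.
exists B; split; first by have := HB 0%N; rewrite mulr1; apply: le_trans; exact: cabs_ge0.
move=> z k zr; apply: (@le_trans _ _ (cabs (c k) * r ^+ k)).
  apply: ler_wpM2l; first exact: cabs_ge0.
  by apply: lerXn2r; [exact: cabs_ge0|rewrite nnegrE ltW|].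
rewrite exprVn ler_pdivlMr ?exprn_gt0// -mulrA -exprMn mulrC (mulrC r).
by rewrite mulrC; exact: HB.
Qed.

Lemma entire_coef_has_taylor c : entire_coef c -> exists f : C R -> C R, has_taylor f c.
Proof.
move=> cc.
have H z : exists l : C R, (taylor_sum c z : nat -> C R) @ \oo --> l.
  have r0 : 0 < cabs z + 1 by rewrite ltr_wpDl ?cabs_ge0.
  have [B [B0 HB]] := entire_coef_geometric cc r0.
  have q01 : 0 <= (2^-1 : R) < 1 by apply/andP; split; lra.
  have [|l [ul _]] := @geometric_series_cvg _ (fun k => c k * z ^+ k) B 2^-1 q01.
    by move=> k; rewrite cabsM cabsX; apply: HB; rewrite lerDl.
  by exists l.
by exists (fun z => sval (cid (H z))); split => // z; case: cid.
Qed.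

Lemma expr_taylor2 (z h : C R) r k : 1 <= r -> cabs z <= r -> cabs (z + h) <= r ->
  cabs ((z + h) ^+ k - z ^+ k - (k%:R * z ^+ k.-1) * h) <= (2 * r) ^+ k * cabs h ^+ 2.
Proof.
move=> r1 zr zhr; elim: k => [|k IH].
  by rewrite !expr0 subrr mul0r mul0r subrr cabs0 mul1r exprn_ge0 ?cabs_ge0.
set E := _ - _ - _ in IH.
rewrite (_ : _ - _ - _ = (z + h) * E + k%:R * z ^+ k.-1 * h ^+ 2); last first.
  rewrite /E -natr1; case: k {IH E} => [|k]; first by rewrite /= !expr0 !expr1; ring.
  by rewrite /= !exprS; ring.
have r0 : 0 <= r by lra.
apply: (le_trans (cabsD _ _)).
rewrite (_ : (2 * r) ^+ k.+1 * _ = r * ((2 * r) ^+ k * cabs h ^+ 2) + r * (2 * r) ^+ k * cabs h ^+ 2); last first.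
  by rewrite exprS; ring.
apply: lerD; first by rewrite cabsM; apply: ler_pM; rewrite ?cabs_ge0.
rewrite cabsM cabsM !cabsX cabs_nat; apply: ler_wpM2r; first by rewrite exprn_ge0 ?cabs_ge0.
rewrite exprMn mulrCA; apply: ler_pM; rewrite ?exprn_ge0 ?cabs_ge0//.
  by rewrite -natrX ler_nat ltnW// ltn_expl.
rewrite -exprS; apply: (@le_trans _ _ (r ^+ k.-1)).
  by apply: lerXn2r; rewrite ?nnegrE ?cabs_ge0.
by apply: ler_weXn2l => //; case: (k) => // m; rewrite /= ltnW// ltnW.
Qed.

Lemma has_taylor_entire f c : has_taylor f c -> entire f.
Proof.
move=> fc z; have [cc fz] := fc.
pose r := cabs z + 1.
have r1 : 1 <= r by rewrite lerDr cabs_ge0.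
have r0 : 0 < r by lra.
(* One factor [2 * r] pays for the second order remainder of [expr_taylor2], the other factor 2 for
   geometric convergence. *)
have [B HB] := cc (4 * r) ltac:(by rewrite mulr_gt0).
have q01 : 0 <= (2^-1 : R) < 1 by apply/andP; split; lra.
have [|l [ul _]] := @geometric_series_cvg _ (fun k => c k * (k%:R * z ^+ k.-1)) B 2^-1 q01.
  move=> k; rewrite !cabsM cabsX cabs_nat exprVn ler_pdivlMr ?exprn_gt0//.
  apply: le_trans (HB k); rewrite -mulrA; apply: ler_wpM2l; first exact: cabs_ge0.
  rewrite (_ : 4 * r = 2 * r * 2) ?exprMn; last by ring.
  apply: ler_wpM2r; first by rewrite exprn_ge0.
  apply: ler_pM; rewrite ?exprn_ge0 ?cabs_ge0//.
    by rewrite -natrX ler_nat ltnW// ltn_expl.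
  apply: (@le_trans _ _ (r ^+ k.-1)).
    by apply: lerXn2r; rewrite ?nnegrE ?cabs_ge0 ?lerDl// ltW.
  by apply: ler_weXn2l => //; case: (k) => // m; rewrite /= ltnW.
have B0 : 0 <= B by have := HB 0%N; rewrite mulr1; apply: le_trans; exact: cabs_ge0.
apply: (@derivable_quadratic _ f z l (2 * B)) => h h1.
have zr : cabs z <= r by rewrite lerDl.
have zhr : cabs (z + h) <= r by rewrite (le_trans (cabsD _ _))// lerD2l.
pose S n := taylor_sum c (z + h) n - taylor_sum c z n - (\sum_(k < n) c k * (k%:R * z ^+ k.-1)) * h.
have Sl : (S : nat -> C R) @ \oo --> (f (z + h) - f z - l * h : C R).
  exact (cvgB (cvgB (fz (z + h)) (fz z)) (cvgM ul (cvg_cst (h : C R)))).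
have := @cvg_cabs_bound _ _ _ _ S _ 0 (2 * B * cabs h ^+ 2) Sl.
rewrite subr0; apply; apply: nearW => n.
rewrite subr0 /S /taylor_sum mulr_suml -!sumrB.
apply: (le_trans (cabs_sum _ _ _)).
apply: (@le_trans _ _ (\sum_(k < n) B * 2^-1 ^+ k * cabs h ^+ 2)).
  apply: ler_sum => k _.
  rewrite (_ : _ - _ - _ = c k * ((z + h) ^+ k - z ^+ k - (k%:R * z ^+ k.-1) * h)); last by ring.
  rewrite cabsM; apply: (le_trans (ler_wpM2l (cabs_ge0 _) (expr_taylor2 k r1 zr zhr))).
  rewrite mulrA; apply: ler_wpM2r; first by rewrite exprn_ge0 ?cabs_ge0.
  rewrite exprVn ler_pdivlMr ?exprn_gt0// -mulrA -exprMn.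
  by apply: le_trans (HB k); rewrite (_ : 2 * r * 2 = 4 * r)//; ring.
rewrite -mulr_suml; apply: ler_wpM2r; first by rewrite exprn_ge0 ?cabs_ge0.
rewrite -(big_mkord xpredT (fun k => B * 2^-1 ^+ k)).
apply: (le_trans (geometric_sum_le B0 q01 (leq0n n))).
by rewrite le_eqVlt; apply/orP; left; apply/eqP; rewrite expr0; field.
Qed.

End PowerSeries.

(** * Averages over roots of unity and uniqueness of coefficients *)

Section RootAverage.
Variable R : realType.
Implicit Types (c d : nat -> R[i]) (f g : C R -> C R) (B r q : R) (z w u : C R).

Lemma complex_prim_root_exists n : (0 < n)%N -> exists w : R[i], n.-primitive_root w.
Proof.
pose p : {poly R[i]} := 'X^n - 1; have [r Dp] := closed_field_poly_normal p.
move=> n_gt0; rewrite (monicP _) ?monicXnsubC // scale1r in Dp.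
have rn1: all n.-unity_root r by apply/allP=> z; rewrite -root_prod_XsubC -Dp.
have sz_r: (n < (size r).+1)%N.
  by rewrite -(size_prod_XsubC r id) -Dp size_XnsubC.
have [|z] := hasP (has_prim_root n_gt0 rn1 _ sz_r); last by exists z.
by rewrite -separable_prod_XsubC -Dp separable_Xn_sub_1 // pnatr_eq0 -lt0n.
Qed.

Lemma cabs_unity n w : (0 < n)%N -> w ^+ n = 1 -> cabs w = 1.
Proof.
move=> n0 wn; apply/eqP; rewrite -(@pexpr_eq1 _ _ n) ?cabs_ge0//.
by rewrite -cabsX wn cabs1.
Qed.

(* The component of [f] whose Taylor exponents are [k] modulo [N]. *)
Definition root_avg N w k f z : C R :=
  N%:R^-1 * \sum_(i < N) w ^- (i * k) * f (w ^+ i * z).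

Lemma root_avg_monomial N w k j z : (0 < N)%N -> N.-primitive_root w ->
  root_avg N w k (fun z => z ^+ j) z = (j == k %[mod N])%:R * z ^+ j.
Proof.
move=> N0 wN; have w0 : w != 0 by rewrite -cabs_eq0 (cabs_unity N0 (prim_expr_order wN)) oner_eq0.
have Nn0 : (N%:R : R[i]) != 0 by rewrite pnatr_eq0 -lt0n.
pose x := w ^+ j / w ^+ k.
have E : root_avg N w k (fun z => z ^+ j) z = N%:R^-1 * (\sum_(i < N) x ^+ i) * z ^+ j.
  rewrite /root_avg -mulrA mulr_suml; congr (_ * _); apply: eq_bigr => i _.
  by rewrite exprMn /x expr_div_n -!exprM (mulnC j i) (mulnC k i) mulrA (mulrC (w ^+ _)).
rewrite E -(eq_prim_root_expr wN); case: eqVneq => [jk|jk].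
  rewrite /x jk divff ?expf_neq0//; under eq_bigr do rewrite expr1n.
  by rewrite sumr_const card_ord mulVf// mul1r.
have x1 : x - 1 != 0.
  by rewrite subr_eq0; apply: contra jk => /eqP x1; rewrite -[X in X == _](mulfVK (expf_neq0 k w0)) -/x x1 mul1r.
have : x ^+ N - 1 = 0.
  by rewrite /x expr_div_n -!exprM !(mulnC _ N) !exprM (prim_expr_order wN) !expr1n divr1 subrr.
rewrite subrX1 => /eqP; rewrite mulf_eq0 (negbTE x1) /= => /eqP ->.
by rewrite mulr0 !mul0r.
Qed.

Lemma root_avgD N w k f g z :
  root_avg N w k (fun z => f z + g z) z = root_avg N w k f z + root_avg N w k g z.
Proof.
rewrite /root_avg -mulrDr -big_split /=; congr (_ * _).
by apply: eq_bigr => i _; rewrite mulrDr.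
Qed.

Lemma root_avgZ N w k (a : R[i]) f z :
  root_avg N w k (fun z => a * f z) z = a * root_avg N w k f z.
Proof.
rewrite /root_avg mulrCA; congr (_ * _); rewrite mulr_sumr.
by apply: eq_bigr => i _; rewrite mulrCA.
Qed.

Lemma root_avg_taylor_sum N w k c n z : (0 < N)%N -> N.-primitive_root w ->
  root_avg N w k (taylor_sum c ^~ n) z =
  \sum_(j < n) (j == k %[mod N])%:R * (c j * z ^+ j).
Proof.
move=> N0 wN; elim: n => [|n IH].
  rewrite big_ord0 /root_avg big1 ?mulr0// => i _.
  by rewrite /taylor_sum big_ord0 mulr0.
rewrite big_ord_recr /= -IH mulrCA -(root_avg_monomial _ _ _ N0 wN) -root_avgZ -root_avgD.
by congr (_ * _); apply: eq_bigr => i _; rewrite /taylor_sum big_ord_recr.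
Qed.

(** The average keeps the exponents [k], [k + N], [k + 2 N] and so on; all but the first are at
    least [N], so they are controlled by a geometric tail. *)
Lemma root_avg_coef f c z k N w B q : (k < N)%N -> N.-primitive_root w ->
  0 <= B -> 0 <= q < 1 -> (forall j, cabs (c j) * cabs z ^+ j <= B * q ^+ j) ->
  (forall u, cabs u = cabs z -> (taylor_sum c u : nat -> C R) @ \oo --> f u) ->
  cabs (root_avg N w k f z - c k * z ^+ k) <= B * q ^+ N / (1 - q).
Proof.
move=> kN wN B0 q01 cB fc; have N0 : (0 < N)%N by apply: leq_trans kN.
have w1 := cabs_unity N0 (prim_expr_order wN).
apply/ler_addgt0Pl => e e0.
(* Only the [N] points [w ^+ i * z] enter the average, so pointwise convergence yields a common
   [n]. *)
have near1 : \forall n \near \oo, forall i : 'I_N,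
    cabs (taylor_sum c (w ^+ i * z) n - f (w ^+ i * z)) <= e.
  apply: filter_forall => i.
  have wz : cabs (w ^+ i * z) = cabs z by rewrite cabsM cabsX w1 expr1n mul1r.
  by have /cvg_cabsP/(_ _ e0) := fc _ wz.
have near2 : \forall n \near \oo, (N <= n)%N by exists N.
have [n [Hn Nn]] := filter_ex (filterI near1 near2).
pose S u := taylor_sum c u n : C R.
have E : root_avg N w k f z = root_avg N w k (fun u => f u - S u) z + root_avg N w k S z.
  rewrite -root_avgD /root_avg; congr (_ * _); apply: eq_bigr => i _.
  by rewrite subrK.
rewrite E -addrA; apply: (le_trans (cabsD _ _)); apply: lerD.
  rewrite /root_avg cabsM cabsV cabs_nat ler_pdivrMl ?ltr0n//.
  apply: (le_trans (cabs_sum _ _ _)); rewrite -[X in X%:R](card_ord N) mulr_natl -sumr_const.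
  apply: ler_sum => i _; rewrite cabsM cabsV cabsX w1 expr1n invr1 mul1r.
  by rewrite cabsB; exact: Hn.
rewrite root_avg_taylor_sum//.
have kn : (k < n)%N by exact: leq_trans kN Nn.
rewrite (bigD1 (Ordinal kn)) //= eqxx mul1r addrAC subrr add0r.
apply: (le_trans (cabs_sum _ _ _)).
apply: (@le_trans _ _ (\sum_(N <= j < n) B * q ^+ j)); last exact: geometric_sum_le.
have /andP[q0 _] := q01.
rewrite big_mkcond /= (big_nat_widenl _ 0) // big_mkord [leRHS]big_mkcond /=.
apply: ler_sum => i _.
have Bq j : 0 <= B * q ^+ j by rewrite mulr_ge0// exprn_ge0.
case: eqP => /= [_|ik]; first by case: ifP.
case: eqP => /= [ikN|_]; last by rewrite mul0r cabs0; case: ifP.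
rewrite mul1r cabsM cabsX; case: leqP => Ni; first exact: cB.
exfalso; apply: ik; apply: val_inj => /=; move: ikN.
by rewrite !modn_small.
Qed.

(** Both [c k * z ^+ k] and [d k * z ^+ k] are approximated by the same root averages of [f], with
    an error that vanishes as the order of the root grows. *)
Lemma taylor_coef_unique f c d B q z : z != 0 -> 0 <= B -> 0 <= q < 1 ->
  (forall j, cabs (c j) * cabs z ^+ j <= B * q ^+ j) ->
  (forall j, cabs (d j) * cabs z ^+ j <= B * q ^+ j) ->
  (forall u, cabs u = cabs z -> (taylor_sum c u : nat -> C R) @ \oo --> f u) ->
  (forall u, cabs u = cabs z -> (taylor_sum d u : nat -> C R) @ \oo --> f u) ->
  c =1 d.
Proof.
move=> z0 B0 q01 cB dB fc fd k.
apply/eqP; rewrite -subr_eq0 -(mulIr_eq0 _ (mulIf (expf_neq0 k z0))) -cabs_eq0.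
apply/eqP; apply: (@geometric_small_eq0 _ (2 * B * q ^+ k / (1 - q)) q) => //.
move=> n; have [w wN] := complex_prim_root_exists (ltn0Sn (k + n)).
have kN : (k < (k + n).+1)%N by rewrite ltnS leq_addr.
have H1 := root_avg_coef kN wN B0 q01 cB fc.
have H2 := root_avg_coef kN wN B0 q01 dB fd.
rewrite (_ : (c k - d k) * z ^+ k = - (root_avg (k + n).+1 w k f z - c k * z ^+ k) +
  (root_avg (k + n).+1 w k f z - d k * z ^+ k)); last by ring.
apply: (le_trans (cabsD _ _)); rewrite cabsN.
apply: (le_trans (lerD H1 H2)); rewrite le_eqVlt; apply/orP; left; apply/eqP.
by rewrite -addnS exprD; ring.
Qed.

(** The expansions on the discs of radius [n + 1] have the same coefficients, by uniqueness on the
    circle of radius 1/2 that lies in all of them; so one sequence serves every radius. *)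
Lemma holomorphic_has_taylor f : holomorphic f -> exists c, has_taylor f c.
Proof.
move=> hf.
have disc n : exists c : nat -> R[i],
    (exists B, forall k, cabs (c k) * n.+1%:R ^+ k <= B) /\
    forall z, cabs z < n.+1%:R -> (taylor_sum c z : nat -> C R) @ \oo --> f z.
  have n0 : 0 < n.+1%:R :> R by [].
  have [c [cB cf]] := taylor_disc hf n0.
  exists c; split=> // z zn; have [A HA] := cf z zn.
  apply/cvg_cabsP => e e0.
  have q1 : `|cabs z / n.+1%:R| < 1.
    by rewrite ger0_norm ?divr_ge0 ?cabs_ge0// ltr_pdivrMr// mul1r.
  have : (fun k => A * (cabs z / n.+1%:R) ^+ k) @ \oo --> A * 0.
    by apply: cvgM; [exact: cvg_cst|exact: cvg_expr].
  rewrite mulr0 => /cvgrPdistC_le/(_ _ e0); apply: filterS => k.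
  rewrite subr0 => Ak; rewrite cabsB; apply: (le_trans (HA k)).
  exact: le_trans (ler_norm _) Ak.
pose c n := sval (cid (disc n)).
have cP n : (exists B, forall k, cabs (c n k) * n.+1%:R ^+ k <= B) /\
    forall z, cabs z < n.+1%:R -> (taylor_sum (c n) z : nat -> C R) @ \oo --> f z.
  by rewrite /c; case: cid.
have half2 n : exists B, 0 <= B /\ forall j, cabs (c n j) * cabs (2^-1 : R[i]) ^+ j <= B * 2^-1 ^+ j.
  have [[B HB] _] := cP n; exists B; split.
    by have := HB 0%N; rewrite mulr1; apply: le_trans; exact: cabs_ge0.
  move=> j; rewrite cabsV cabs_nat; apply: ler_wpM2r; first by rewrite exprn_ge0 ?invr_ge0.
  apply: le_trans (HB j); rewrite ler_peMr ?cabs_ge0// exprn_ege1// ler1n//.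
have cE n : c n =1 c 0%N.
  have [B1 [B10 H1]] := half2 n; have [B2 [B20 H2]] := half2 0%N.
  have le2 (m : nat) u : cabs u = cabs (2^-1 : R[i]) -> cabs u < m.+1%:R.
    move=> ->; rewrite cabsV cabs_nat; apply: (@lt_le_trans _ _ 1); last by rewrite ler1n.
    by rewrite invf_lt1 ?ltr1n.
  apply: (@taylor_coef_unique f _ _ (B1 + B2) 2^-1 (2^-1)).
  - by rewrite invr_eq0 pnatr_eq0.
  - exact: addr_ge0.
  - by apply/andP; split; lra.
  - move=> j; apply: (le_trans (H1 j)); apply: ler_wpM2r; last by rewrite lerDl.
    by rewrite exprn_ge0 ?invr_ge0.
  - move=> j; apply: (le_trans (H2 j)); apply: ler_wpM2r; last by rewrite lerDr.
    by rewrite exprn_ge0 ?invr_ge0.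
  - by move=> u uz; have [_] := cP n; apply; exact: le2.
  - by move=> u uz; have [_] := cP 0%N; apply; exact: le2.
exists (c 0%N); split => [r r0|z].
  pose n := Num.bound r; have rn : r <= n.+1%:R.
    apply: ltW; apply: lt_le_trans (archi_boundP (ltW r0)) _.
    by rewrite ler_nat.
  have [[B HB] _] := cP n; exists B => k; apply: le_trans (HB k).
  rewrite cE; apply: ler_wpM2l; first exact: cabs_ge0.
  by apply: lerXn2r; rewrite ?nnegrE// ltW.
pose n := Num.bound (cabs z).
have [_ /(_ z)] := cP n.
have -> : taylor_sum (c n) z = taylor_sum (c 0%N) z.
  by apply/funext => m; apply: eq_bigr => i _; rewrite cE.
apply; apply: lt_le_trans (archi_boundP (cabs_ge0 z)) _.
by rewrite ler_nat.
Qed.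

Lemma entire_has_taylor (f : R[i] -> C R) : entire f -> exists c, has_taylor f c.
Proof. by move=> ef; apply: holomorphic_has_taylor => z; exact: derivable_cderiv. Qed.

Lemma has_taylor_unique f c d : has_taylor f c -> has_taylor f d -> c = d.
Proof.
move=> [cc fc] [dd fd].
have [B [B0 HB]] := entire_coef_geometric cc ltr01.
have [D [D0 HD]] := entire_coef_geometric dd ltr01.
apply/funext; apply: (@taylor_coef_unique f _ _ (B + D) 2^-1 1).
- exact: oner_neq0.
- exact: addr_ge0.
- by apply/andP; split; lra.
- move=> j; apply: le_trans (HB 1 j _) _; first by rewrite cabs1.
  apply: ler_wpM2r; last by rewrite lerDl.
  by rewrite exprn_ge0 ?invr_ge0.
- move=> j; apply: le_trans (HD 1 j _) _; first by rewrite cabs1.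
  apply: ler_wpM2r; last by rewrite lerDr.
  by rewrite exprn_ge0 ?invr_ge0.
- by move=> u _; exact: fc.
- by move=> u _; exact: fd.
Qed.

Lemma has_taylor_lin (a : R[i]) f g c d : has_taylor f c -> has_taylor g d ->
  has_taylor (a *: f + g) (fun k => a * c k + d k).
Proof.
move=> [cc fc] [dd gd]; split => [r r0|z].
  have [B HB] := cc r r0; have [D HD] := dd r r0.
  exists (cabs a * B + D) => k.
  apply: (@le_trans _ _ ((cabs a * cabs (c k) + cabs (d k)) * r ^+ k)).
    apply: ler_wpM2r; first by rewrite exprn_ge0// ltW.
    by rewrite -cabsM cabsD.
  by rewrite mulrDl -mulrA lerD// ler_wpM2l ?cabs_ge0.
have E : (taylor_sum (fun k => a * c k + d k) z : nat -> C R) =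
    (fun n => a * taylor_sum c z n + taylor_sum d z n).
  apply/funext => n; rewrite /taylor_sum mulr_sumr -big_split /=.
  by apply: eq_bigr => i _; rewrite mulrDl mulrA.
rewrite E; exact (cvgD (cvgM (cvg_cst (a : C R)) (fc z)) (gd z)).
Qed.

Lemma has_taylor_monomial m : has_taylor (fun z => z ^+ m) (fun k => (k == m)%:R).
Proof.
split => [r r0|z].
  exists (r ^+ m) => k; case: eqP => [->|_]; first by rewrite cabs1 mul1r.
  by rewrite cabs0 mul0r exprn_ge0// ltW.
apply/cvg_cabsP => e e0; exists m.+1 => // n /= mn.
rewrite /taylor_sum (bigD1 (Ordinal mn)) //= eqxx mul1r big1 ?addr0 ?subrr ?cabs0 ?ltW//.
move=> i im; case: eqP => [E|_]; last by rewrite mul0r.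
by move: im; rewrite -val_eqE /= E eqxx.
Qed.

End RootAverage.

(** * Weighted norms *)

Section RotationInvariance.
Variable R : realType.
Notation mu := (@lebesgue_measure R).
Local Open Scope ereal_scope.

Lemma integral_translation (h : R -> \bar R) (t : R) :
  measurable_fun [set: R] h -> (forall x, 0 <= h x) ->
  \int[mu]_x h (x + t)%R = \int[mu]_x h x.
Proof.
move=> mh h0.
have mt : measurable_fun setT (fun x : R => (x + t)%R : measurableTypeR R).
  by apply: measurable_funD => //; exact: measurable_cst.
transitivity (\int[pushforward mu (fun x : R => (x + t)%R : measurableTypeR R)]_x h x).
  by rewrite ge0_integral_pushforward.
apply: eq_measure_integral => A mA _; apply/esym.
apply: (@lebesgue_measure_unique _ (pushforward mu (fun x : R => (x + t)%R : measurableTypeR R))) => //.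
move=> _ [[a b] _ <-] /=; rewrite /pushforward.
rewrite (_ : _ @^-1` _ = `](a - t)%R, (b - t)%R]%classic).
  rewrite !lebesgue_measure_itv /= !lte_fin ltrD2r.
  by case: ifP => // _; rewrite -!EFinB opprB addrA subrK.
by apply/seteqP; split => x /=; rewrite !in_itv /= ltrBlDr lerBrDr.
Qed.

Let shear1 (t : R) (q : R * R) : R * R := (q.1 + t * q.2, q.2)%R.
Let shear2 (t : R) (q : R * R) : R * R := (q.1, q.2 + t * q.1)%R.

Let measurable_shear1 t : measurable_fun setT (shear1 t).
Proof.
apply/measurable_fun_pairP; split; last exact: measurable_snd.
apply: measurable_funD; first exact: measurable_fst.
by apply: measurable_funM; [exact: measurable_cst|exact: measurable_snd].
Qed.

Let measurable_shear2 t : measurable_fun setT (shear2 t).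
Proof.
apply/measurable_fun_pairP; split; first exact: measurable_fst.
apply: measurable_funD; first exact: measurable_snd.
by apply: measurable_funM; [exact: measurable_cst|exact: measurable_fst].
Qed.

Implicit Type h : R * R -> \bar R.

(** By Tonelli's theorem: on each horizontal line the shear is a translation. *)
Let integral_shear1 h t : measurable_fun setT h -> (forall q, 0 <= h q) ->
  \int[mu \x mu]_q h (shear1 t q) = \int[mu \x mu]_q h q.
Proof.
move=> mh h0.
have mh' := measurableT_comp mh (measurable_shear1 t).
have -> : \int[mu \x mu]_q h (shear1 t q) = _ := fubini_tonelli2 (m1 := mu) (m2 := mu) _ mh' (fun=> h0 _).
have -> : \int[mu \x mu]_q h q = _ := fubini_tonelli2 (m1 := mu) (m2 := mu) _ mh h0.
apply: eq_integral => y _; rewrite /fubini_G /shear1 /=.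
apply: (@integral_translation (fun x => h (x, y))) => //.
exact: measurableT_comp mh (measurable_pair2 y).
Qed.

Let integral_shear2 h t : measurable_fun setT h -> (forall q, 0 <= h q) ->
  \int[mu \x mu]_q h (shear2 t q) = \int[mu \x mu]_q h q.
Proof.
move=> mh h0.
have mh' := measurableT_comp mh (measurable_shear2 t).
have -> : \int[mu \x mu]_q h (shear2 t q) = _ := fubini_tonelli1 (m1 := mu) (m2 := mu) _ mh' (fun=> h0 _).
have -> : \int[mu \x mu]_q h q = _ := fubini_tonelli1 (m1 := mu) (m2 := mu) _ mh h0.
apply: eq_integral => x _; rewrite /fubini_F /shear2 /=.
apply: (@integral_translation (fun y => h (x, y))) => //.
exact: measurableT_comp mh (measurable_pair1 x).
Qed.

Let rot (u : R[i]) (q : R * R) : R * R :=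
  (complex.Re (u * plane q)%R, complex.Im (u * plane q)%R).

(* A rotation with nonzero sine is a product of three shears. *)
Let integral_rot_neq0 h u : cabs u = 1%R -> complex.Im u != 0%R ->
  measurable_fun setT h -> (forall q, 0 <= h q) ->
  \int[mu \x mu]_q h (rot u q) = \int[mu \x mu]_q h q.
Proof.
case: u => a b; rewrite /cabs /= => ab b0 mh h0.
have ab1 : (a ^+ 2 + b ^+ 2 = 1)%R.
  have := congr1 (fun x : R => (x ^+ 2)%R) ab.
  by rewrite sqr_sqrtr ?expr1n// addr_ge0// sqr_ge0.
(* For [a + i b = exp(i theta)] this is [- tan(theta / 2)], the slope of the two outer shears. *)
pose t := ((a - 1) / b)%R.
have E q : rot (a +i* b) q = shear1 t (shear2 b (shear1 t q)).
  case: q => x y; rewrite /rot /shear1 /shear2 /plane /=; congr pair.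
    rewrite (_ : t * (y + b * (x + t * y)) = t * y + (a - 1) * (x + t * y))%R; last first.
      by rewrite /t; field.
    rewrite (_ : b * y = (1 - a ^+ 2) / b * y)%R; last by rewrite -ab1; field.
    by rewrite /t; field.
  by rewrite /t; field.
under eq_integral do rewrite E.
pose h1 q := h (shear1 t q); pose h2 q := h1 (shear2 b q).
have mh1 : measurable_fun setT h1 by exact: measurableT_comp mh (measurable_shear1 t).
have mh2 : measurable_fun setT h2 by exact: measurableT_comp mh1 (measurable_shear2 b).
apply: (etrans (@integral_shear1 h2 t mh2 (fun=> h0 _))).
apply: (etrans (@integral_shear2 h1 b mh1 (fun=> h0 _))).
exact: integral_shear1 mh h0.
Qed.

Let rotM u v q : rot u (rot v q) = rot (u * v)%R q.
Proof.
by case: u => a b; case: v => c d; case: q => x y; rewrite /rot /=; congr pair; ring.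
Qed.

Let measurable_rot u : measurable_fun setT (rot u).
Proof.
case: u => a b; apply/measurable_fun_pairP; split => /=.
  by rewrite /comp /=; apply: measurable_funB; apply: measurable_funM.
by rewrite /comp /=; apply: measurable_funD; apply: measurable_funM.
Qed.

Lemma area_integral_rotation (h : R[i] -> \bar R) (u : R[i]) : cabs u = 1%R ->
  measurable_fun setT (h \o @plane R) -> (forall z, 0 <= h z) ->
  area_integral (fun z => h (u * z)%R) = area_integral h.
Proof.
move=> u1 mh h0; rewrite /area_integral.
pose H q := h (plane q).
have HE v q : h (v * plane q)%R = H (rot v q).
  by rewrite /H /rot /plane /=; congr h; case: (_ * _)%R.
under eq_integral do rewrite HE.
have i1 : cabs ('i : R[i]) = 1%R := cabs_i R.
have i0 : complex.Im ('i : R[i]) != 0%R by rewrite oner_eq0.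
have [u0|] := eqVneq (complex.Im u) 0%R; last first.
  by move=> u0; exact: (@integral_rot_neq0 H u u1 u0 mh (fun=> h0 _)).
(* A real [u] has sine 0 and is not covered directly; it is written as ['i * (- 'i * u)], a product
   of two rotations with nonzero sine. *)
have iu1 : cabs (- 'i * u)%R = 1%R by rewrite cabsM cabsN i1 u1 mulr1.
have iu0 : complex.Im (- 'i * u)%R != 0%R.
  apply/eqP => E; have : u = 0%R.
    case: u u0 E {u1 iu1} => a b /= -> E; apply/eqP; rewrite eq_complex /= eqxx andbT.
    by move: E; rewrite mulr0 add0r mulN1r => /eqP; rewrite oppr_eq0.
  by move/eqP; rewrite -cabs_eq0 u1 oner_eq0.
have Eu q : rot u q = rot 'i (rot (- 'i * u)%R q).
  by rewrite rotM mulNr mulrN mulrA -expr2 sqr_i mulN1r opprK.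
under eq_integral do rewrite Eu.
pose H1 q := H (rot 'i q).
have mH1 : measurable_fun setT H1 by exact: measurableT_comp mh (measurable_rot _).
apply: (etrans (@integral_rot_neq0 H1 _ iu1 iu0 mH1 (fun=> h0 _))).
exact: (@integral_rot_neq0 H 'i i1 i0 mh (fun=> h0 _)).
Qed.

End RotationInvariance.

(** * Measurability of complex functions on the plane *)

Section Measurability.
Variable R : realType.
Implicit Types (f g : C R -> C R) (a z : R[i]).

Definition measurableC f :=
  measurable_fun [set: R * R] (fun q : R * R => complex.Re (f (plane q))) /\
  measurable_fun [set: R * R] (fun q : R * R => complex.Im (f (plane q))).

Lemma measurableC_cst a : measurableC (fun=> a).
Proof. by split; exact: measurable_cst. Qed.

Lemma measurableC_id : measurableC id.
Proof. by split; [exact: measurable_fst|exact: measurable_snd]. Qed.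

Lemma measurableC_ReIm f u v :
  measurable_fun [set: R * R] u -> measurable_fun [set: R * R] v ->
  (forall q, f (plane q) = u q +i* v q) -> measurableC f.
Proof.
move=> mu mv fE; split.
  by rewrite (_ : (fun q => _) = u)//; apply/funext => q; rewrite fE.
by rewrite (_ : (fun q => _) = v)//; apply/funext => q; rewrite fE.
Qed.

Lemma measurableCD f g : measurableC f -> measurableC g ->
  measurableC (fun z => f z + g z).
Proof.
move=> [f1 f2] [g1 g2].
apply: (measurableC_ReIm (measurable_funD f1 g1) (measurable_funD f2 g2)) => q.
by rewrite /=; case: (f _) => ? ?; case: (g _) => ? ?.
Qed.

Lemma measurableCM f g : measurableC f -> measurableC g ->
  measurableC (fun z => f z * g z).
Proof.
move=> [f1 f2] [g1 g2].
apply: (measurableC_ReIm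
  (measurable_funB (measurable_funM f1 g1) (measurable_funM f2 g2))
  (measurable_funD (measurable_funM f1 g2) (measurable_funM f2 g1))) => q.
by rewrite /=; case: (f _) => ? ?; case: (g _) => ? ?.
Qed.

Lemma measurableC_taylor f c : has_taylor f c -> measurableC f.
Proof.
move=> [_ fc].
have mp k : measurableC (fun z => z ^+ k).
  elim: k => [|k IH]; first exact: measurableC_cst.
  rewrite (_ : (fun z => _) = (fun z => z * z ^+ k)); first exact: measurableCM measurableC_id IH.
  by apply/funext => z; rewrite exprS.
have ms n : measurableC (taylor_sum c ^~ n).
  elim: n => [|n IH].
    rewrite (_ : (fun z => _) = (fun=> 0)); first exact: measurableC_cst.
    by apply/funext => z; rewrite /taylor_sum big_ord0.
  rewrite (_ : (fun z => _) = (fun z => taylor_sum c z n + c n * z ^+ n)).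
    exact: measurableCD IH (measurableCM (measurableC_cst _) (mp n)).
  by apply/funext => z; rewrite /taylor_sum big_ord_recr.
split.
  apply: (measurable_fun_cvg (h := fun n q => complex.Re (taylor_sum c (plane q) n))).
    by move=> n; exact: (ms n).1.
  by move=> q _; exact: (continuous_cvg _ (@continuous_ReC _ _) (fc (plane q))).
apply: (measurable_fun_cvg (h := fun n q => complex.Im (taylor_sum c (plane q) n))).
  by move=> n; exact: (ms n).2.
by move=> q _; exact: (continuous_cvg _ (@continuous_ImC _ _) (fc (plane q))).
Qed.

Lemma measurable_cabs f : measurableC f ->
  measurable_fun [set: R * R] (fun q : R * R => cabs (f (plane q))).
Proof.
move=> [f1 f2].
rewrite (_ : (fun q => _) = @Num.sqrt R \o
   (fun q => complex.Re (f (plane q)) ^+ 2 + complex.Im (f (plane q)) ^+ 2)); last first.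
  by apply/funext => q; rewrite /cabs /=; case: (f _).
have ms : measurable_fun [set: R] (@Num.sqrt R).
  by apply: continuous_measurable_fun; exact: sqrt_continuous.
apply: (measurableT_comp ms).
by apply: measurable_funD; exact: measurable_funX.
Qed.

(** Continuity on the half-line, written without subspaces: the truncation hides the values of [phi]
    at negative arguments, which a weight leaves free. *)
Definition continuous_weight (phi : R -> R) := continuous (fun x : R => phi (Num.max 0 x)).

Lemma measurable_weight phi : continuous_weight phi ->
  measurable_fun [set: R * R] (fun q : R * R => phi (cabs (plane q))).
Proof.
move=> cphi.
rewrite (_ : (fun q => _) = (fun x => phi (Num.max 0 x)) \o (fun q => cabs (id (plane q)))).
  have mw : measurable_fun [set: R] (fun x => phi (Num.max 0 x)).
    exact: continuous_measurable_fun.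
  exact (measurableT_comp mw (measurable_cabs measurableC_id)).
by apply/funext => q /=; rewrite max_r ?cabs_ge0.
Qed.

End Measurability.

Lemma le_poweR (R : realType) (r : R) (x y : \bar R) : (0 <= r)%R ->
  (0 <= x)%E -> (x <= y)%E -> (x `^ r <= y `^ r)%E.
Proof.
move=> r0 x0 xy; apply: gt0_ler_poweR => //.
  by rewrite in_itv /= x0 leey.
by rewrite in_itv /= leey andbT (le_trans x0).
Qed.

Lemma powR_cvg (R : realType) (p a : R) (w : nat -> R) : 0 < p -> 0 <= a ->
  (forall n, 0 <= w n) -> w @ \oo --> a -> (fun n => w n `^ p) @ \oo --> a `^ p.
Proof.
move=> p0; rewrite le_eqVlt => /predU1P[<-|a0] w0 wa.
  rewrite powR0 ?lt0r_neq0//; apply/cvgrPdistC_le => e e0.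
  have e'0 : 0 < e `^ p^-1 by rewrite powR_gt0.
  move/cvgrPdistC_le : wa => /(_ _ e'0); apply: filterS => n.
  rewrite !subr0 !ger0_norm ?powR_ge0// => wn.
  rewrite -[leRHS](@powRr1 _ e (ltW e0)) -(mulVf (lt0r_neq0 p0)) powRrM.
  by apply: ge0_ler_powR; [exact: ltW|exact: w0|rewrite nnegrE powR_ge0|exact: wn].
have c : (fun n => expR (p * ln (w n))) @ \oo --> expR (p * ln a).
  apply: (continuous_cvg _ (@continuous_expR _ _)); apply: cvgM; first exact: cvg_cst.
  exact: (continuous_cvg _ (continuous_ln a0) wa).
rewrite /powR (gt_eqF a0); apply: cvg_trans c; apply: near_eq_cvg.
have : \forall n \near \oo, 0 < w n by exact: cvgr_gt wa _ a0.
by apply: filterS => n wn; rewrite gt_eqF.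
Qed.

(** * The weighted norm: triangle inequality, rotations, limits *)

Section WeightedNorm.
Variables (R : realType) (phi : R -> R) (cphi : continuous_weight phi).
Notation mu := (@lebesgue_measure R).
Notation nu := (mu \x mu)%E.
Implicit Types (f g : C R -> C R) (a u z : R[i]) (p : R).

Definition wabs f (q : R * R) : R := cabs (f (plane q)) * expR (- phi (cabs (plane q))).

Lemma wabs_ge0 f q : 0 <= wabs f q.
Proof. by rewrite /wabs mulr_ge0 ?cabs_ge0// expR_ge0. Qed.

Lemma measurable_wabs f : measurableC f -> measurable_fun [set: R * R] (wabs f).
Proof.
move=> mf; apply: measurable_funM; first exact: measurable_cabs.
apply: measurableT_comp; first exact: measurable_expR.
apply: measurableT_comp; first exact: oppr_measurable.
exact: measurable_weight.
Qed.

Lemma wabs_powR p f q : cabs (f (plane q)) `^ p *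
  expR (- (p * radial_extension phi (plane q))) = wabs f q `^ p.
Proof.
rewrite /wabs powRM ?cabs_ge0 ?expR_ge0// /radial_extension.
by congr (_ * _); rewrite -expRM mulNr mulrC.
Qed.

Lemma FnormE p f : Fnorm phi p f = ((\int[nu]_q (wabs f q `^ p)%:E) `^ p^-1)%E.
Proof.
rewrite /Fnorm /area_integral; congr (_ `^ _)%E.
by apply: eq_integral => q _; rewrite wabs_powR.
Qed.

Lemma measurable_wabs_powR p f : measurableC f ->
  measurable_fun [set: R * R] (fun q => (wabs f q `^ p)%:E).
Proof.
move=> mf; apply/measurable_EFinP.
exact: (@measurableT_comp _ _ _ _ _ _ (@powR R ^~ p)) (measurable_powR _) (measurable_wabs mf).
Qed.

Lemma Fnorm_Lnorm p f : Fnorm phi p f = Lnorm nu p%:E (EFin \o wabs f).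
Proof.
rewrite FnormE unlock.
have E q : (wabs f q `^ p)%:E = (`|(EFin \o wabs f) q| `^ p)%E.
  by rewrite /= ger0_norm ?wabs_ge0.
apply: (congr1 (fun x => poweR x p^-1)); apply: eq_integral => q _; exact: E.
Qed.

Lemma Fnorm_ge0 p f : (0 <= Fnorm phi p f)%E.
Proof. exact: poweR_ge0. Qed.

Lemma Fnorm_integral p f : 0 < p ->
  (Fnorm phi p f `^ p = \int[nu]_q (wabs f q `^ p)%:E)%E.
Proof.
move=> p0; rewrite FnormE -poweRrM mulVf ?lt0r_neq0// poweRe1//.
by apply: integral_ge0 => q _; rewrite lee_fin powR_ge0.
Qed.

Lemma le_Fnorm p f g : 0 < p -> measurableC f -> measurableC g ->
  (forall z, cabs (f z) <= cabs (g z)) -> (Fnorm phi p f <= Fnorm phi p g)%E.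
Proof.
move=> p0 mf mg fg; rewrite !FnormE; apply: le_poweR.
- by rewrite invr_ge0 ltW.
- by apply: integral_ge0 => q _; rewrite lee_fin powR_ge0.
apply: ge0_le_integral => //.
- by move=> q _; rewrite lee_fin powR_ge0.
- exact: measurable_wabs_powR.
- exact: measurable_wabs_powR.
move=> q _; rewrite lee_fin; apply: ge0_ler_powR; [exact: ltW|exact: wabs_ge0|exact: wabs_ge0|].
by apply: ler_wpM2r; [exact: expR_ge0|exact: fg].
Qed.

Lemma FnormD p f g : 1 <= p -> measurableC f -> measurableC g ->
  (Fnorm phi p (fun z => f z + g z)%R <= Fnorm phi p f + Fnorm phi p g)%E.
Proof.
move=> p1 mf mg; have p0 : 0 < p by exact: lt_le_trans p1.
rewrite (Fnorm_Lnorm p f) (Fnorm_Lnorm p g).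
have := minkowski_EFin nu (measurable_wabs mf) (measurable_wabs mg) p1.
apply: le_trans; rewrite unlock FnormE; apply: le_poweR.
- by rewrite invr_ge0 ltW.
- by apply: integral_ge0 => q _; rewrite lee_fin powR_ge0.
apply: ge0_le_integral => //.
- by move=> q _; rewrite lee_fin powR_ge0.
- exact: measurable_wabs_powR (measurableCD mf mg).
- apply/measurable_EFinP.
  apply: (@measurableT_comp _ _ _ _ _ _ (@powR R ^~ p)); first exact: measurable_powR.
  apply: measurableT_comp; first exact: normr_measurable.
  exact: measurable_funD (measurable_wabs mf) (measurable_wabs mg).
move=> q _; rewrite /= lee_fin; apply: ge0_ler_powR; [exact: ltW|exact: wabs_ge0|by rewrite nnegrE|].
rewrite ger0_norm ?addr_ge0 ?wabs_ge0// /wabs -mulrDl.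
by apply: ler_wpM2r; [exact: expR_ge0|exact: cabsD].
Qed.

Lemma FnormZ p a f : 0 < p -> measurableC f ->
  Fnorm phi p (fun z => a * f z) = ((cabs a)%:E * Fnorm phi p f)%E.
Proof.
move=> p0 mf; rewrite !FnormE.
under eq_integral => q _.
  rewrite (_ : wabs _ q `^ p = cabs a `^ p * wabs f q `^ p); last first.
    by rewrite /wabs cabsM -mulrA powRM ?cabs_ge0 ?wabs_ge0.
  rewrite EFinM; over.
rewrite ge0_integralZl_EFin ?powR_ge0//; last 2 first.
- by move=> q _; rewrite lee_fin powR_ge0.
- exact: measurable_wabs_powR.
rewrite poweRM ?lee_fin ?powR_ge0//; last first.
  by apply: integral_ge0 => q _; rewrite lee_fin powR_ge0.
by rewrite poweR_EFin -powRrM mulfV ?lt0r_neq0// powRr1 ?cabs_ge0.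
Qed.

Lemma Fnorm_rotation p f u : cabs u = 1 -> measurableC f ->
  Fnorm phi p (fun z => f (u * z)) = Fnorm phi p f.
Proof.
move=> u1 mf; apply: (congr1 (fun x => poweR x p^-1)).
pose h (z : R[i]) := (cabs (f z) `^ p * expR (- (p * radial_extension phi z)))%:E.
rewrite -(@area_integral_rotation _ h u u1).
- rewrite /area_integral; apply: eq_integral => q _.
  by rewrite /h /radial_extension cabsM u1 mul1r.
- rewrite (_ : h \o _ = (fun q => (wabs f q `^ p)%:E)).
    exact: measurable_wabs_powR.
  by apply/funext => q; rewrite /h /= wabs_powR.
- by move=> z; rewrite lee_fin mulr_ge0 ?powR_ge0 ?expR_ge0.
Qed.

(** Fatou's lemma for [|F n|^p]: pointwise convergence and an eventual bound on the norms suffice,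
    with no dominating function. *)
Lemma Fnorm_le_lim p (F : nat -> C R -> C R) f (M : R) : 0 < p -> 0 <= M ->
  (forall n, measurableC (F n)) -> (forall z, (F ^~ z : nat -> C R) @ \oo --> f z) ->
  (\forall n \near \oo, (Fnorm phi p (F n) <= M%:E)%E) -> (Fnorm phi p f <= M%:E)%E.
Proof.
move=> p0 M0 mF Ff [n0 _ FM].
pose G n q := (wabs (F (n + n0)%N) q `^ p)%:E.
have mG n : measurable_fun [set: R * R] (G n) by exact: measurable_wabs_powR.
have G0 n q : [set: R * R] q -> (0 <= G n q)%E by move=> _; rewrite lee_fin powR_ge0.
have GM n : (\int[nu]_q G n q <= (M `^ p)%:E)%E.
  rewrite -(Fnorm_integral _ p0) -poweR_EFin; apply: le_poweR.
  - exact: ltW.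
  - exact: Fnorm_ge0.
  - by apply: FM => /=; exact: leq_addl.
have lim q : limn_einf (G ^~ q) = (wabs f q `^ p)%:E.
  have cv : G ^~ q @ \oo --> (wabs f q `^ p)%:E.
    apply: cvg_EFin; first by apply: nearW.
    rewrite /comp /=.
    have cw : (fun n => wabs (F (n + n0)%N) q) @ \oo --> wabs f q.
      apply: cvgM; last exact: cvg_cst.
      have := Ff (plane q); rewrite -(cvg_shiftn n0) => /cvg_cabsP H.
      apply/cvgrPdistC_le => e e0; apply: filterS (H _ e0) => n Hn.
      rewrite ler_distl; apply/andP; split.
        by rewrite lerBlDr -lerBlDl (le_trans (ler_cabsB _ _))// cabsB.
      by rewrite -lerBlDl (le_trans (ler_cabsB _ _)).
    by apply: powR_cvg cw => // [|n]; exact: wabs_ge0.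
  by rewrite (cvg_limn_einf_sup cv).1.
have fat := fatou nu measurableT mG G0.
rewrite FnormE -(@powRr1 _ M)// -(mulfV (lt0r_neq0 p0)) powRrM -poweR_EFin.
apply: le_poweR.
- by rewrite invr_ge0 ltW.
- by apply: integral_ge0 => q _; rewrite lee_fin powR_ge0.
under eq_integral do rewrite -lim.
apply: (le_trans fat); rewrite limn_einf_lim.
apply: lime_le; first exact: is_cvg_einfs.
apply: nearW => n; apply: (le_trans _ (GM n)); apply: ereal_inf_lbound.
by exists n => //=.
Qed.

End WeightedNorm.

Definition monomial (R : realType) (k : nat) (z : C R) : C R := z ^+ k.
Arguments monomial R k z : clear implicits.

(** * Coefficient bounds and lower bounds for monomials *)

Section CoefficientBound.
Variables (R : realType) (phi : R -> R) (cphi : continuous_weight phi).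
Implicit Types (f g : C R -> C R) (a u z w : R[i]) (p : R) (c : nat -> R[i]).

Lemma has_taylor_rotation f c u : cabs u = 1 -> has_taylor f c ->
  has_taylor (fun z => f (u * z)) (fun k => c k * u ^+ k).
Proof.
move=> u1 [cc fc]; split => [r r0|z].
  have [B HB] := cc r r0; exists B => k.
  by rewrite cabsM cabsX u1 expr1n mulr1.
rewrite (_ : taylor_sum _ z = taylor_sum c (u * z)); first exact: fc.
by apply/funext => n; apply: eq_bigr => i _; rewrite exprMn mulrA.
Qed.

Lemma Fnorm_sum p n (F : nat -> C R -> C R) : 1 <= p ->
  (forall i, measurableC (F i)) ->
  measurableC (fun z => \sum_(i < n) F i z) /\
  (Fnorm phi p (fun z => \sum_(i < n) F i z)%R <= \sum_(i < n) Fnorm phi p (F i))%E.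
Proof.
move=> p1 mF; have p0 : 0 < p by exact: lt_le_trans p1.
elim: n => [|n [IH1 IH2]].
  have E : (fun z => \sum_(i < 0) F i z) = (fun z => (0 : R[i]) * (0 : R[i])) :> (C R -> C R).
    by apply/funext => z; rewrite big_ord0 mulr0.
  have m0 : measurableC (fun z : C R => (0 : C R)) by exact: measurableC_cst.
  rewrite E; split; first by rewrite mulr0.
  by rewrite (FnormZ cphi _ p0 m0) big_ord0 cabs0 mul0e.
have E : (fun z => \sum_(i < n.+1) F i z) = (fun z => \sum_(i < n) F i z + F n z) :> (C R -> C R).
  by apply/funext => z; rewrite big_ord_recr.
rewrite E big_ord_recr /=; split; first exact: measurableCD.
by apply: (le_trans (FnormD cphi p1 IH1 (mF n))); rewrite leeD2r.
Qed.

Lemma measurableC_root_avg N w k f c : (0 < N)%N -> w ^+ N = 1 -> has_taylor f c ->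
  forall i, measurableC (fun z => w ^- (i * k) * f (w ^+ i * z)).
Proof.
move=> N0 wN fc i; have wi : cabs (w ^+ i) = 1.
  by rewrite cabsX (cabs_unity N0 wN) expr1n.
apply: measurableCM; first exact: measurableC_cst.
exact: measurableC_taylor (has_taylor_rotation wi fc).
Qed.

(** The average is [1 / N] times the sum of [N] rotated copies of [f], with unimodular factors, all
    of the same norm as [f]. *)
Lemma Fnorm_root_avg p N w k f c : 1 <= p -> (0 < N)%N -> w ^+ N = 1 ->
  has_taylor f c ->
  measurableC (root_avg N w k f) /\
  (Fnorm phi p (root_avg N w k f) <= Fnorm phi p f)%E.
Proof.
move=> p1 N0 wN fc; have p0 : 0 < p by exact: lt_le_trans p1.
have w1 := cabs_unity N0 wN.
have mf := measurableC_taylor fc.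
have mF := measurableC_root_avg k N0 wN fc.
have [mS FS] := @Fnorm_sum p N (fun i z => w ^- (i * k) * f (w ^+ i * z)) p1 mF.
split; first exact: measurableCM (measurableC_cst _) mS.
have -> : Fnorm phi p (root_avg N w k f) = _ := FnormZ cphi N%:R^-1 p0 mS.
have [->|foo] := eqVneq (Fnorm phi p f) +oo%E; first by rewrite leey.
have ffin : Fnorm phi p f \is a fin_num by rewrite ge0_fin_numE ?Fnorm_ge0// ltey.
have E i : Fnorm phi p (fun z => w ^- (i * k) * f (w ^+ i * z)) = Fnorm phi p f.
  have wi : cabs (w ^+ i) = 1 by rewrite cabsX w1 expr1n.
  rewrite (FnormZ cphi _ p0 (measurableC_taylor (has_taylor_rotation wi fc))).
  by rewrite (Fnorm_rotation cphi p wi mf) cabsV cabsX w1 expr1n invr1 mul1e.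
apply: le_trans (lee_wpmul2l _ FS) _; first by rewrite lee_fin cabs_ge0.
under eq_bigr do rewrite E.
rewrite -(fineK ffin) sumEFin -EFinM lee_fin sumr_const card_ord cabsV cabs_nat.
by rewrite -[X in _ * X]mulr_natl mulKf// pnatr_eq0 -lt0n.
Qed.

(** Root averages of growing order converge pointwise to [c k * z ^+ k], and none has a larger norm
    than [f]; Fatou concludes. *)
Lemma Fnorm_coef p f c k : 1 <= p -> has_taylor f c ->
  ((cabs (c k))%:E * Fnorm phi p (monomial R k) <= Fnorm phi p f)%E.
Proof.
move=> p1 fc; have p0 : 0 < p by exact: lt_le_trans p1.
have [->|foo] := eqVneq (Fnorm phi p f) +oo%E; first by rewrite leey.
have ffin : Fnorm phi p f \is a fin_num by rewrite ge0_fin_numE ?Fnorm_ge0// ltey.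
have mk : measurableC (monomial R k).
  exact (measurableC_taylor (@has_taylor_monomial R k)).
rewrite -(FnormZ cphi _ p0 mk) -(fineK ffin).
have rt n := @complex_prim_root_exists R _ (ltn0Sn (k + n)).
pose w n := sval (cid (rt n)).
have wP n : (k + n).+1.-primitive_root (w n) by rewrite /w; case: cid.
pose F n := root_avg (k + n).+1 (w n) k f.
have FP n := Fnorm_root_avg k p1 (ltn0Sn (k + n)) (prim_expr_order (wP n)) fc.
apply: (@Fnorm_le_lim _ _ cphi p F) => //.
- by rewrite fine_ge0// Fnorm_ge0.
- by move=> n; have [] := FP n.
- move=> z; apply/cvg_cabsP => e e0.
  have r0 : 0 < cabs z + 1 by rewrite ltr_wpDl ?cabs_ge0.
  have [cc fz] := fc.
  have [B [B0 HB]] := entire_coef_geometric cc r0.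
  have q01 : 0 <= (2^-1 : R) < 1 by apply/andP; split; lra.
  have zr : cabs z <= cabs z + 1 by rewrite lerDl.
  have H n : cabs (F n z - c k * z ^+ k) <= B * 2^-1 ^+ (k + n).+1 / (1 - 2^-1).
    apply: (root_avg_coef _ (wP n) B0 q01) => //; first by rewrite ltnS leq_addr.
    by move=> j; exact: HB.
  have : (fun n => (B * 2^-1 ^+ k) * 2^-1 ^+ n) @ \oo --> (B * 2^-1 ^+ k) * 0.
    apply: cvgM; first exact: cvg_cst.
    by apply: cvg_expr; rewrite ger0_norm; lra.
  rewrite mulr0 => /cvgrPdistC_le/(_ _ e0); apply: filterS => n.
  rewrite subr0 => Bn; apply: le_trans (H n) _; apply: le_trans (le_trans (ler_norm _) Bn).
  rewrite le_eqVlt; apply/orP; left; apply/eqP.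
  by rewrite exprS exprD; field.
- by apply: nearW => n; rewrite (fineK ffin); exact (FP n).2.
Qed.

(** Pointwise, [|f^n| e^(-phi)] is the n-th power of [|f| e^(-phi/n)]. A bound on a power of [f]
    thereby becomes a bound on [f] for a modified weight and exponent. *)
Lemma Fnorm_expr p n f : (0 < n)%N -> 0 < p ->
  Fnorm phi p (fun z => f z ^+ n) =
  (Fnorm (fun x => phi x / n%:R)%R (p * n%:R)%R f `^ n%:R)%E.
Proof.
move=> n0 p0; have nn : (n%:R : R) != 0 by rewrite pnatr_eq0 -lt0n.
have e : (p * n%:R)^-1 * n%:R = p^-1 by field; rewrite nn lt0r_neq0.
rewrite !FnormE -poweRrM e.
have E q : wabs phi (fun z => f z ^+ n) q `^ p =
    wabs (fun x => phi x / n%:R) f q `^ (p * n%:R).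
  rewrite (mulrC p) powRrM powR_mulrn ?wabs_ge0//; congr (_ `^ p).
  by rewrite /wabs exprMn cabsX -expRM_natr mulNr divfK.
apply: (congr1 (fun x => poweR x p^-1)); apply: eq_integral => q _.
by rewrite E.
Qed.

Lemma continuous_weight_bound (r : R) : exists M, forall x, 0 <= x <= r -> phi x <= M.
Proof.
have [r0|r0] := leP 0 r; last by exists 0 => x /andP[x0 xr]; lra.
have cs : {within `[0, r], continuous (fun x : R => phi (Num.max 0 x))}.
  exact: continuous_subspaceT.
have [m _ mP] := EVT_max r0 cs.
exists (phi (Num.max 0 m)) => x x0r; have := mP x; rewrite in_itv/= => /(_ x0r).
by move/andP: x0r => [x0 _]; rewrite max_r.
Qed.

(** Integration over the unit square [[r, r + 1] x [0, 1]] alone: there [|z|] lies between [r] and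
    [r + 2], so [phi] is bounded, and the square has measure 1. *)
Lemma Fnorm_monomial_ge p r : 0 < p -> 0 < r -> exists2 d, 0 < d &
  forall n, ((d * r ^+ n)%:E <= Fnorm phi p (monomial R n))%E.
Proof.
move=> p0 r0; have [M HM] := continuous_weight_bound (r + 2).
exists (expR (- M)); first exact: expR_gt0.
move=> n; set d := expR (- M) * r ^+ n.
have d0 : 0 <= d by rewrite mulr_ge0 ?expR_ge0// exprn_ge0// ltW.
pose B : set (R * R) := `[r, r + 1]%classic `*` `[0%R, 1%R]%classic.
have mB : measurable B by apply: measurableX; exact: measurable_itv.
have mk : measurableC (monomial R n).
  exact (measurableC_taylor (@has_taylor_monomial R n)).
have Bd q : B q -> d `^ p <= wabs phi (monomial R n) q `^ p.
  case: q => x y [/=]; rewrite !in_itv /= => /andP[x1 x2] /andP[y1 y2].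
  apply: ge0_ler_powR; [exact: ltW|by rewrite nnegrE|exact: wabs_ge0|].
  have zr : r <= cabs (plane (x, y)).
    by apply: le_trans (normr_Re _); rewrite /= (le_trans x1)// ler_norm.
  have zr2 : cabs (plane (x, y)) <= r + 2.
    apply: (le_trans (cabs_le_ReIm _)) => /=.
    by rewrite !ger0_norm//; lra.
  rewrite /wabs /d mulrC cabsX; apply: ler_pM.
  - by rewrite exprn_ge0// ltW.
  - exact: expR_ge0.
  - by apply: lerXn2r; [rewrite nnegrE ltW|exact: cabs_ge0|].
  - by rewrite ler_expR lerN2; apply: HM; rewrite cabs_ge0.
have nuB : (lebesgue_measure \x lebesgue_measure)%E B = 1%:E.
  have l1 : lebesgue_measure (`[r, r + 1]%classic : set R) = 1%:E.
    by rewrite lebesgue_measure_itv /= lte_fin ltrDl ltr01 -EFinB addrAC subrr add0r.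
  have l2 : lebesgue_measure (`[0, 1]%classic : set R) = 1%:E.
    by rewrite lebesgue_measure_itv /= lte_fin ltr01 -EFinB subr0.
  have H := product_measure1E (@lebesgue_measure R) (@lebesgue_measure R)
    (A1 := `[r, r + 1]%classic) (A2 := `[0, 1]%classic)
    (measurable_itv _) (measurable_itv _).
  apply: (etrans H).
  by apply: (etrans (congr2 mule l1 l2)); rewrite mule1.
rewrite FnormE -[leLHS](_ : ((d `^ p)%:E `^ p^-1)%E = _); last first.
  by rewrite poweR_EFin -powRrM mulfV ?lt0r_neq0// powRr1.
apply: le_poweR; [by rewrite invr_ge0 ltW|by rewrite lee_fin powR_ge0|].
have mw := measurable_wabs_powR cphi p mk.
have w0 q : (0 <= (wabs phi (monomial R n) q `^ p)%:E)%E by rewrite lee_fin powR_ge0.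
apply: (@le_trans _ _ (\int[(lebesgue_measure \x lebesgue_measure)%E]_(q in B)
   (wabs phi (monomial R n) q `^ p)%:E)%E); last first.
  by apply: ge0_subset_integral.
rewrite -[leLHS]mule1 -nuB -integral_cst//.
apply: ge0_le_integral => //.
- by move=> q _; rewrite lee_fin powR_ge0.
- exact: measurable_funS mw.
Qed.

End CoefficientBound.

(** * Gaussian integrals and upper bounds for monomials *)

Section Gaussian.
Variable R : realType.
Notation mu := (@lebesgue_measure R).
Notation nu := (mu \x mu)%E.

Lemma gaussian_integral_finite (b : R) : 0 < b ->
  exists I : R, 0 <= I /\ (\int[mu]_x (expR (- (b * x ^+ 2)))%:E = I%:E)%E.
Proof.
(* With this deviation the integrand is a multiple of the centred normal density, whose integral is
   1. *)
move=> b0; pose s := Num.sqrt ((2 * b)^-1).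
have s2 : s ^+ 2 *+ 2 = b^-1.
  rewrite sqr_sqrtr; last by rewrite invr_ge0 mulr_ge0// ltW.
  by rewrite -mulr_natl; field; rewrite lt0r_neq0.
have s0 : s != 0 by rewrite sqrtr_eq0 -ltNge invr_gt0 mulr_gt0.
exists (normal_peak s)^-1; split; first by rewrite invr_ge0 normal_peak_ge0.
have E x : (expR (- (b * x ^+ 2)))%:E = ((normal_peak s)^-1%:E * (normal_pdf 0 s x)%:E)%E.
  rewrite -EFinM normal_pdfE// mulKf ?lt0r_neq0 ?normal_peak_gt0//.
  by rewrite /normal_fun s2 invrK subr0 mulNr mulrC.
transitivity (\int[mu]_x ((normal_peak s)^-1%:E * (normal_pdf 0 s x)%:E))%E.
  by apply: eq_integral => x _; exact: E.
rewrite ge0_integralZl_EFin.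
- by rewrite integral_normal_pdf mule1.
- exact: measurableT.
- by move=> x _; rewrite lee_fin normal_pdf_ge0.
- by apply/measurable_EFinP; exact: measurable_normal_pdf.
- by rewrite invr_ge0 normal_peak_ge0.
Qed.

Lemma gaussian_plane_finite (b : R) : 0 < b -> exists I : R, 0 <= I /\
  (\int[nu]_q (expR (- (b * (q.1 ^+ 2 + q.2 ^+ 2))))%:E = I%:E)%E.
Proof.
move=> b0; have [I [I0 HI]] := gaussian_integral_finite b0.
exists (I * I); split; first exact: mulr_ge0.
pose G (q : R * R) := (expR (- (b * (q.1 ^+ 2 + q.2 ^+ 2))))%:E.
have mG : measurable_fun [set: R * R] G.
  apply/measurable_EFinP; apply: (measurableT_comp (@measurable_expR R)).
  apply: (measurableT_comp (@oppr_measurable R setT)).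
  apply: measurable_funM; first exact: measurable_cst.
  by apply: measurable_funD; apply: measurable_funX; [exact: measurable_fst|exact: measurable_snd].
have G0 q : (0 <= G q)%E by rewrite lee_fin expR_ge0.
have mu1 : measurable_fun [set: R] (fun y : R => (expR (- (b * y ^+ 2)))%:E).
  apply/measurable_EFinP; apply: (measurableT_comp (@measurable_expR R)).
  apply: (measurableT_comp (@oppr_measurable R setT)).
  apply: measurable_funM; first exact: measurable_cst.
  exact: measurable_funX.
have -> : (\int[nu]_q G q = _)%E := fubini_tonelli1 (m1 := mu) (m2 := mu) G mG G0.
transitivity (\int[mu]_x (I%:E * (expR (- (b * x ^+ 2)))%:E))%E.
  apply: eq_integral => x _; rewrite /fubini_F /G /=.
  transitivity (\int[mu]_y ((expR (- (b * x ^+ 2)))%:E * (expR (- (b * y ^+ 2)))%:E))%E.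
    by apply: eq_integral => y _; rewrite -EFinM -expRD mulrDr opprD.
  rewrite ge0_integralZl_EFin; [by rewrite HI muleC|exact: measurableT| |exact: mu1|exact: expR_ge0].
  by move=> y _; rewrite lee_fin expR_ge0.
rewrite ge0_integralZl_EFin; [by rewrite HI|exact: measurableT| |exact: mu1|exact: I0].
by move=> y _; rewrite lee_fin expR_ge0.
Qed.

Definition quadratic_growth (phi : R -> R) :=
  exists A B : R, 0 < A /\ forall x, 0 <= x -> A * x ^+ 2 - B <= phi x.

Lemma factorial_expR_bound (x : R) m : 0 <= x -> x ^+ m <= m`!%:R * expR x.
Proof.
move=> x0; have f0 : 0 < m`!%:R :> R by rewrite ltr0n fact_gt0.
rewrite mulrC -ler_pdivrMr//; case: m f0 => [|m] f0.
  by rewrite expr0 fact0 divr1 -expR0 ler_expR.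
by apply: le_trans (expR_ge1Dxn m x0); rewrite lerDr.
Qed.

(** With [a = A / 2], half of the growth of [phi] absorbs the power through
    [(r^2)^m <= m! a^-m e^(a r^2)], and the other half leaves an integrable Gaussian. Even exponents
    make the power one of [r^2]. *)
Lemma Fnorm_even_monomial (phi : R -> R) p : continuous_weight phi ->
  quadratic_growth phi -> 0 < p ->
  exists K D : R, [/\ 0 <= K, 0 < D & forall m,
    (Fnorm phi p (monomial R (2 * m)) <= (K * m`!%:R * D ^+ m)%:E)%E].
Proof.
move=> cphi [A [B [A0 AB]]] p0.
pose a := A / 2; have a0 : 0 < a by rewrite divr_gt0.
have [I [I0 HI]] := gaussian_plane_finite (mulr_gt0 p0 a0).
exists (expR B * I `^ p^-1), a^-1; split.
- by rewrite mulr_ge0 ?expR_ge0 ?powR_ge0.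
- by rewrite invr_gt0.
move=> m; set k := expR B * m`!%:R * a^-1 ^+ m.
have k0 : 0 <= k by rewrite !mulr_ge0 ?expR_ge0 ?exprn_ge0 ?invr_ge0 ?ltW.
pose G (q : R * R) := (expR (- (p * a * (q.1 ^+ 2 + q.2 ^+ 2))))%:E.
have wb q : (wabs phi (monomial R (2 * m)) q `^ p)%:E%E = (wabs phi (monomial R (2 * m)) q `^ p)%:E by [].
have mk : measurableC (monomial R (2 * m)).
  exact (measurableC_taylor (@has_taylor_monomial R (2 * m))).
have bound q : ((wabs phi (monomial R (2 * m)) q `^ p)%:E <= (k `^ p)%:E * G q)%E.
  rewrite /G -EFinM lee_fin.
  rewrite (_ : - (p * a * _) = (- (a * (q.1 ^+ 2 + q.2 ^+ 2))) * p); last by ring.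
  rewrite expRM -(powRM p k0 (expR_ge0 _)); apply: ge0_ler_powR.
  - exact: ltW.
  - exact: wabs_ge0.
  - by rewrite nnegrE mulr_ge0 ?expR_ge0.
  have r2 : cabs (plane q) ^+ 2 = q.1 ^+ 2 + q.2 ^+ 2.
    by rewrite /cabs /= sqr_sqrtr// addr_ge0 ?sqr_ge0.
  rewrite -r2 /wabs cabsX exprM; set r := cabs (plane q).
  have r0 : 0 <= r := cabs_ge0 _.
  have H1 : (r ^+ 2) ^+ m <= m`!%:R * a^-1 ^+ m * expR (a * r ^+ 2).
    have ar : 0 <= a * r ^+ 2 by apply: mulr_ge0; [exact: ltW|exact: sqr_ge0].
    have := factorial_expR_bound m ar.
    rewrite exprMn => H.
    rewrite exprVn (mulrAC (m`!%:R)) ler_pdivlMr ?exprn_gt0//.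
    by rewrite (mulrC _ (a ^+ m)).
  have H2 : expR (- phi r) <= expR (B - A * r ^+ 2).
    by rewrite ler_expR; have := AB r r0; lra.
  apply: (le_trans (ler_pM _ _ H1 H2)); rewrite ?exprn_ge0 ?sqr_ge0 ?expR_ge0//.
  rewrite le_eqVlt; apply/orP; left; apply/eqP.
  rewrite /k (_ : B - A * r ^+ 2 = B + - (a * r ^+ 2) - a * r ^+ 2); last by rewrite /a; field.
  rewrite !expRD (_ : expR (- (a * r ^+ 2)) = (expR (a * r ^+ 2))^-1); last by rewrite expRN.
  by field; rewrite ?(lt0r_neq0 a0) ?(lt0r_neq0 (expR_gt0 _)).
have mG : measurable_fun [set: R * R] G.
  apply/measurable_EFinP; apply: (measurableT_comp (@measurable_expR R)).
  apply: (measurableT_comp (@oppr_measurable R setT)).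
  apply: measurable_funM; first exact: measurable_cst.
  by apply: measurable_funD; apply: measurable_funX; [exact: measurable_fst|exact: measurable_snd].
have Ib : (\int[nu]_q (wabs phi (monomial R (2 * m)) q `^ p)%:E <= (k `^ p * I)%:E)%E.
  apply: (@le_trans _ _ (\int[nu]_q ((k `^ p)%:E * G q))%E).
    apply: ge0_le_integral => //.
    - by move=> q _; rewrite lee_fin powR_ge0.
    - exact: measurable_wabs_powR.
    - by apply: emeasurable_funM => //; exact: measurable_cst.
  rewrite ge0_integralZl_EFin; [by rewrite HI EFinM|exact: measurableT| |exact: mG|exact: powR_ge0].
  by move=> q _; rewrite lee_fin expR_ge0.
rewrite FnormE; apply: (le_trans (le_poweR _ _ Ib)).
- by rewrite invr_ge0 ltW.
- by apply: integral_ge0 => q _; rewrite lee_fin powR_ge0.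
rewrite poweR_EFin lee_fin powRM ?powR_ge0// -powRrM mulfV ?lt0r_neq0// powRr1//.
by rewrite /k le_eqVlt; apply/orP; left; apply/eqP; ring.
Qed.

(** Any exponent reduces to an even one by [|z|^n <= 1 + |z|^(2n)]; the majorant is not holomorphic,
    but the norm only asks for measurability. *)
Lemma Fnorm_monomial_finite (phi : R -> R) p n : continuous_weight phi ->
  quadratic_growth phi -> 1 <= p -> (Fnorm phi p (monomial R n) < +oo)%E.
Proof.
move=> cphi gphi p1; have p0 : 0 < p by exact: lt_le_trans p1.
have [K [D [K0 D0 KD]]] := Fnorm_even_monomial cphi gphi p0.
have fin m : (Fnorm phi p (monomial R (2 * m)) < +oo)%E.
  by apply: le_lt_trans (KD m) _; rewrite ltry.
have mm k : measurableC (monomial R k) by exact (measurableC_taylor (@has_taylor_monomial R k)).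
pose g (z : C R) : C R := (cabs z ^+ (2 * n))%:C.
have mg : measurableC g.
  have mc := measurable_cabs (@measurableC_id R).
  by apply: (measurableC_ReIm (measurable_funX (2 * n)%N mc) (@measurable_cst _ _ _ _ _ (0 : R))).
have gE z : cabs (g z) = cabs (monomial R (2 * n) z).
  by rewrite /g /monomial cabs_real cabsX ger0_norm// exprn_ge0 ?cabs_ge0.
have mh : measurableC (fun z => monomial R 0 z + g z) by exact: measurableCD (mm 0%N) mg.
apply: le_lt_trans (le_Fnorm cphi p0 (mm n) mh _) _.
  move=> z; rewrite /monomial expr0 /g.
  rewrite -(rmorph1 (real_complex R)) -rmorphD cabs_real ger0_norm; last first.
    by rewrite addr_ge0// exprn_ge0 ?cabs_ge0.
  rewrite cabsX mulnC exprM; set x := cabs z ^+ n.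
  have := sqr_ge0 (1 - x); have := sqr_ge0 x.
  have : 0 <= x by rewrite exprn_ge0 ?cabs_ge0.
  nra.
apply: le_lt_trans (FnormD cphi p1 (mm 0%N) mg) _.
apply: lte_add_pinfty; first by have := fin 0%N; rewrite muln0.
apply: le_lt_trans (le_Fnorm cphi p0 mg (mm (2 * n)%N) _) (fin n).
by move=> z; rewrite gE.
Qed.

End Gaussian.

(** * Quadratic growth of admissible weights *)

Section Weights.
Variable R : realType.
Implicit Types (f g F phi : R -> R) (x y r : R).

Lemma halfline_derivative_lipschitz f g x : halfline_derivative f g -> 0 <= x ->
  exists d L, [/\ 0 < d, 0 <= L &
    forall h, `|h| < d -> 0 <= x + h -> `|f (x + h) - f x| <= L * `|h|].
Proof.
move=> fg x0; have := fg x x0 => /cvgrPdistC_le/(_ 1 ltr01).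
move=> /nbhs_normP[d /= d0 H].
exists d, (`|g x| + 1); split => //.
move=> h hd xh; have [->|h0] := eqVneq h 0.
  by rewrite addr0 subrr !normr0 mulr0.
have := H h; rewrite /= sub0r normrN => /(_ hd h0 xh) Hh.
have -> : f (x + h) - f x = (h^-1 * (f (x + h) - f x)) * h by field.
rewrite normrM; apply: ler_wpM2r => //.
by rewrite -lerBlDl (le_trans (lerB_dist _ _)).
Qed.

Lemma halfline_derivative_is_derive f g x : halfline_derivative f g -> 0 < x ->
  is_derive x 1 f (g x).
Proof.
move=> fg x0; have fx := fg x (ltW x0).
have H : h^-1 *: (f (h *: 1 + x) - f x) @[h --> 0^'] --> g x.
  apply/cvgrPdistC_le => e e0; move/cvgrPdistC_le : fx => /(_ e e0).
  move=> /nbhs_normP[d /= d0 H].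
  apply/nbhs_normP; exists (Num.min d x); first by rewrite /= lt_min d0.
  move=> h /=; rewrite sub0r normrN lt_min => /andP[hd hx] h0.
  have := H h; rewrite /= sub0r normrN => /(_ hd h0).
  rewrite /GRing.scale /= mulr1 (addrC h); apply.
  by move: hx; rewrite ltr_norml => /andP[hx _]; lra.
apply: DeriveDef; first by apply/cvg_ex; exists (g x).
exact: cvg_lim H.
Qed.

Lemma C2_continuous_weight phi : halfline_C2 phi -> continuous_weight phi.
Proof.
case=> phi1 [phi2 [d1 _ _]] x.
have [x0|x0] := ltP x 0.
  have : {for x, continuous (fun=> phi 0)} by exact: cst_continuous.
  rewrite /continuous_at (max_l (ltW x0)); apply: cvg_trans; apply: near_eq_cvg.
  by near=> y; rewrite max_l// ltW//; near: y; exact: lt_nbhsl.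
have [d [L [d0 L0 H]]] := halfline_derivative_lipschitz d1 x0.
rewrite /continuous_at (max_r x0); apply/cvgrPdistC_le => e e0.
have L1 : 0 < L + 1 by rewrite ltr_wpDl.
have m0 : 0 < Num.min d (e / (L + 1)) by rewrite lt_min d0 divr_gt0.
have nx : \forall y \near x, `|x - y| < Num.min d (e / (L + 1)) := nbhsx_ballx x _ m0.
near=> y.
have yd : `|y - x| < Num.min d (e / (L + 1)) by rewrite distrC; near: y.
have yx : `|Num.max 0 y - x| <= `|y - x|.
  by case: (leP 0 y) => // y0; rewrite sub0r normrN (ger0_norm x0) distrC ger0_norm; lra.
move: yd; rewrite lt_min => /andP[yd ye].
have := H (Num.max 0 y - x) (le_lt_trans yx yd); rewrite subrKC le_max lexx => /(_ isT).
move=> /le_trans; apply; apply: (@le_trans _ _ ((L + 1) * `|y - x|)).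
  by apply: ler_pM => //; rewrite lerDl.
by rewrite mulrC -ler_pdivlMr// ltW.
Unshelve. all: by end_near. Qed.

Let ex : R * R := (1, 0).
Let ey : R * R := (0, 1).

Lemma derive_ex (v : R * R -> R) x y : 'D_ex v (x, y) = 'D_1 (fun t => v (t, y)) x.
Proof.
have E : (fun h : R => h^-1 *: ((v \o shift (x, y)) (h *: ex) - v (x, y))) =
    (fun h : R => h^-1 *: (((fun t => v (t, y)) \o shift x) (h *: 1) - v (x, y))).
  apply/funext => h; rewrite /=; congr (_ *: (v _ - _)); congr pair.
  by rewrite /= scaler0 add0r.
by rewrite /derive E.
Qed.

Lemma derive_ey (v : R * R -> R) x y : 'D_ey v (x, y) = 'D_1 (fun t => v (x, t)) y.
Proof.
have E : (fun h : R => h^-1 *: ((v \o shift (x, y)) (h *: ey) - v (x, y))) =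
    (fun h : R => h^-1 *: (((fun t => v (x, t)) \o shift y) (h *: 1) - v (x, y))).
  apply/funext => h; rewrite /=; congr (_ *: (v _ - _)); congr pair.
  by rewrite /= scaler0 add0r.
by rewrite /derive E.
Qed.

(** The polar form of the Laplacian, on the positive real axis. Horizontally the extension is [phi]
    itself; vertically it is [phi] composed with [Num.sqrt (r ^+ 2 + t ^+ 2)], which contributes
    [phi1 r / r] at [t = 0]. *)
Lemma laplacian_radial phi phi1 phi2 r :
  halfline_derivative phi phi1 -> halfline_derivative phi1 phi2 -> 0 < r ->
  laplacian (radial_extension phi) r%:C = phi2 r + phi1 r / r.
Proof.
move=> d1 d2 r0; rewrite /laplacian /= -/ex -/ey.
set v := _ \o _.
have vx0 x : 0 < x -> v (x, 0) = phi x.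
  by move=> x0; change (phi (cabs x%:C) = phi x); rewrite cabs_real gtr0_norm.
congr (_ + _).
  rewrite derive_ex.
  have Dx x : 0 < x -> 'D_ex v (x, 0) = phi1 x.
    move=> x0; rewrite derive_ex.
    have nx : \forall t \near x, phi t = v (t, 0).
      by near=> t; rewrite vx0//; near: t; exact: lt_nbhsr.
    have := near_eq_is_derive nx (halfline_derivative_is_derive d1 x0).
    by move=> ?; exact: derive_val.
  have nr : \forall t \near r, phi1 t = 'D_ex v (t, 0).
    by near=> t; rewrite Dx//; near: t; exact: lt_nbhsr.
  have := near_eq_is_derive nr (halfline_derivative_is_derive d2 r0).
  by move=> ?; exact: derive_val.
rewrite derive_ey.
pose s (t : R) : R := Num.sqrt (r ^+ 2 + t ^+ 2).
have s2 t : 0 < r ^+ 2 + t ^+ 2 by rewrite ltr_wpDr ?sqr_ge0// exprn_gt0.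
have s0 t : 0 < s t by rewrite sqrtr_gt0.
have ds (t : R) : is_derive t 1 s (t / s t).
  have dsq : is_derive (r ^+ 2 + t ^+ 2) 1 Num.sqrt ((2 * s t)^-1).
    by apply: is_derive1_sqrt.
  have dp : is_derive t 1 (fun t : R => r ^+ 2 + t ^+ 2) (0 + 2%:R * t).
    apply: is_deriveD.
    have := @is_deriveX _ _ id 2 t 1 1 (is_derive_id _ _).
    by rewrite expr1 /GRing.scale /= mulr1.
  have := @is_derive1_comp _ Num.sqrt (fun t : R => r ^+ 2 + t ^+ 2) t _ _ dsq dp.
  rewrite add0r (_ : (2 * s t)^-1 * (2 * t) = t / s t)//.
  by field; rewrite lt0r_neq0.
have Dy t : 'D_ey v (r, t) = phi1 (s t) * (t / s t).
  rewrite derive_ey.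
  have dphi := halfline_derivative_is_derive d1 (s0 t).
  have := is_derive1_comp dphi (ds t).
  by move=> ?; exact: derive_val.
have -> : (fun t => 'D_ey v (r, t)) = (fun t => phi1 (s t) * (t / s t)).
  by apply/funext.
have sr : s 0 = r by rewrite /s expr0n /= addr0 sqrtr_sqr gtr0_norm.
have cs : {for 0, continuous s}.
  by apply: differentiable_continuous; apply/derivable1_diffP; exact: (@ex_derive _ _ _ _ _ _ _ (ds 0)).
have cphi1 : {for r, continuous phi1}.
  apply: differentiable_continuous; apply/derivable1_diffP.
  exact: (@ex_derive _ _ _ _ _ _ _ (halfline_derivative_is_derive d2 r0)).
have : is_derive (0 : R) 1 (fun t => phi1 (s t) * (t / s t)) (phi1 (s 0) / s 0).
  (* The function is [t] times a factor continuous at 0, so its derivative at 0 is the value of that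
     factor. *)
  apply: (@is_derive_caratheodory _ _ (fun t => phi1 (s t) / s t)).
    apply: cvgM; first by apply: continuous_comp => //; rewrite sr.
    by apply: cvgV => //; rewrite lt0r_neq0.
  apply: (@nearW _ _ _ (nbhs_filter (0 : R))) => t.
  by rewrite mul0r mulr0 !subr0 mulrA mulrAC.
by rewrite sr => ?; exact: derive_val.
Unshelve. all: by end_near. Qed.

Lemma nondecreasing_is_derive F g M : (forall x, M < x -> is_derive x 1 F (g x)) ->
  (forall x, M < x -> 0 <= g x) -> forall u v, M < u -> u <= v -> F u <= F v.
Proof.
move=> dF g0 u v Mu; rewrite le_eqVlt => /predU1P[-> //|uv].
have dd t : t \in `]u, v[ -> is_derive t 1 F (g t).
  by rewrite in_itv /= => /andP[ut _]; apply: dF; exact: lt_trans ut.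
have cc : {within `[u, v], continuous F}.
  apply: derivable_within_continuous => t; rewrite in_itv /= => /andP[ut _].
  exact: (@ex_derive _ _ _ _ _ _ _ (dF t (lt_le_trans Mu ut))).
have [t] := MVT uv dd cc; rewrite in_itv /= => /andP[ut _] E.
rewrite -subr_ge0 E mulr_ge0 ?subr_ge0 ?(ltW uv)// g0//.
exact: lt_trans ut.
Qed.

(* [(t phi')' = t * Laplacian >= t] far out, and two integrations follow. *)
Lemma admissible_quadratic_growth phi : admissible_weight phi -> quadratic_growth phi.
Proof.
move=> [phi0 [phi1 [phi2 [d1 d2 _]]] _ lap0 [tau [[tau0 _] _ [[c c0 tauc] _] [tau_0 _] _]]].
(* Where [tau <= c^-1], comparability gives [Laplacian^(-1/2) <= c * tau <= 1]. *)
have [M [M1 lap1]] : exists M : R, 1 <= M /\ forall r, M <= r ->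
    1 <= laplacian (radial_extension phi) r%:C.
  have c'0 : 0 < c^-1 by rewrite invr_gt0.
  move/cvgrPdistC_le : tau_0 => /(_ _ c'0) [M [_ HM]].
  exists (Num.max 1 (M + 1)); split; first by rewrite le_max lexx.
  move=> r; rewrite ge_max => /andP[r1 rM].
  have := HM r; rewrite subr0 (gtr0_norm (tau0 _)) => /(_ ltac:(lra)) tr.
  have [] := tauc r%:C; first by rewrite /= cabs_real ger0_norm; lra.
  rewrite -EFinM !lee_fin => _ H.
  set l := laplacian _ _ in H *; have l0 : 0 < l by exact: lap0.
  have : l `^ (- 2^-1) <= 1.
    by apply: (le_trans H); rewrite mulrC -ler_pdivlMr// div1r.
  rewrite /powR (gt_eqF l0) -[X in _ <= X]expR0 ler_expR => H2.
  have l1 : 0 <= ln l by lra.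
  by rewrite -[l]lnK ?posrE// -expR0 ler_expR.
pose F t := t * phi1 t - 2^-1 * t ^+ 2.
have dF x : M < x -> is_derive x 1 F (phi1 x + x * phi2 x - x).
  move=> Mx; have x0 : 0 < x by lra.
  have D := is_deriveB (is_deriveM (is_derive_id x 1) (halfline_derivative_is_derive d2 x0))
    (is_deriveZ 2^-1 (@is_deriveX _ _ id 2 x 1 1 (is_derive_id x 1))).
  apply: (near_eq_is_derive _ (is_derive_eq D _)).
    by apply: (@nearW _ _ _ (nbhs_filter x)) => t.
  by rewrite /GRing.scale /= expr1; field.
have F0 x : M < x -> 0 <= phi1 x + x * phi2 x - x.
  move=> Mx; have x0 : 0 < x by lra.
  have := lap1 x (ltW Mx); rewrite (laplacian_radial d1 d2 x0) => H.
  rewrite (_ : _ - x = x * (phi2 x + phi1 x / x - 1)); last by field; rewrite lt0r_neq0.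
  by apply: mulr_ge0; [exact: ltW|rewrite subr_ge0].
have Fmono := nondecreasing_is_derive dF F0.
(* Monotonicity gives [t * phi1 t >= t^2 / 2 + F u]; beyond [w] the constant costs at most
   [t^2 / 4], whence [phi1 t >= t / 4]. *)
pose u := M + 1; pose w := u + 4 * `|F u| + 1.
have fu : 0 <= `|F u| by [].
have phi1_ge t : w < t -> 0 <= phi1 t - t / 4.
  rewrite /w => wt; have t0 : 0 < t by rewrite /u in wt; lra.
  have ut : u <= t by lra.
  have Mu : M < u by rewrite /u; lra.
  have := Fmono u t Mu ut; rewrite {2}/F => H.
  have := ler_norm (- F u); rewrite normrN => H2.
  have t4 : t * `|F u| * 4 <= t ^+ 2.
    by rewrite expr2 -mulrA; apply: ler_wpM2l; [exact: ltW|rewrite /u in wt; lra].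
  have t1 : `|F u| <= t * `|F u|.
    by rewrite -[leLHS]mul1r; apply: ler_wpM2r => //; rewrite /u in wt; lra.
  have : 0 <= t * (phi1 t - t / 4).
    by rewrite mulrBr mulrA -expr2; lra.
  by rewrite pmulr_rge0.
pose G t := phi t - 8^-1 * t ^+ 2.
have dG x : w < x -> is_derive x 1 G (phi1 x - x / 4).
  move=> Mx; have x0 : 0 < x by rewrite /w /u in Mx; lra.
  have D := is_deriveB (halfline_derivative_is_derive d1 x0)
    (is_deriveZ 8^-1 (@is_deriveX _ _ id 2 x 1 1 (is_derive_id x 1))).
  apply: (near_eq_is_derive _ (is_derive_eq D _)).
    by apply: (@nearW _ _ _ (nbhs_filter x)) => t.
  by rewrite /GRing.scale /= expr1; field.
have Gmono := nondecreasing_is_derive dG phi1_ge.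
(* The subtracted constant makes the bound nonpositive up to [w + 1], where only [phi >= 0] is
   known, and offsets the starting value of [G] beyond. *)
exists 8^-1, (8^-1 * (w + 1) ^+ 2); split; first by lra.
move=> x x0; have w0 : 0 < w by rewrite /w /u; lra.
have [xw|xw] := leP (w + 1) x.
  have ww : w < w + 1 by lra.
  have := Gmono _ _ ww xw; rewrite /G => H.
  have : 0 <= phi (w + 1) by apply: phi0; lra.
  lra.
have : x ^+ 2 <= (w + 1) ^+ 2 by apply: lerXn2r; rewrite ?nnegrE; lra.
have := phi0 x x0; lra.
Qed.

End Weights.

(** * Bounded composition operators *)

(** [fine] sends an infinite norm to 0, so this real norm is meaningful on members of the Fock
    space. *)
HB.lock Definition nrm (R : realType) (phi : R -> R) (p : R) (f : R[i] -> C R) : R :=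
  fine (Fnorm phi p f).
Canonical nrm_unlockable := Unlockable nrm.unlock.

Section FockSpace.
Variables (R : realType) (phi : R -> R) (p : R).
Hypotheses (cphi : continuous_weight phi) (gphi : quadratic_growth phi) (p1 : 1 <= p).
Implicit Types (f g : R[i] -> C R) (a u z w : R[i]) (c : nat -> R[i]).

Let p0 : 0 < p. Proof. exact: lt_le_trans p1. Qed.

Local Notation nrm := (nrm phi p).

Lemma nrm_fine f : nrm f = fine (Fnorm phi p f).
Proof. by rewrite unlock. Qed.

Lemma Fock_taylor f : Fock phi p f -> exists c, has_taylor f c.
Proof. by case=> /entire_has_taylor. Qed.

Lemma Fock_measurable f : Fock phi p f -> measurableC f.
Proof. by move=> /Fock_taylor[c] /measurableC_taylor. Qed.

Lemma nrmE f : Fock phi p f -> Fnorm phi p f = (nrm f)%:E.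
Proof. by case=> _ fo; rewrite !nrm_fine fineK// ge0_fin_numE// Fnorm_ge0. Qed.

Lemma nrm_ge0 f : 0 <= nrm f.
Proof. by rewrite nrm_fine fine_ge0// Fnorm_ge0. Qed.

Lemma FockZD a f g : Fock phi p f -> Fock phi p g -> Fock phi p (a *: f + g).
Proof.
move=> Ff Fg; have [c fc] := Fock_taylor Ff; have [d gd] := Fock_taylor Fg.
have mf := Fock_measurable Ff; have mg := Fock_measurable Fg.
split; first exact: has_taylor_entire (has_taylor_lin a fc gd).
have maf : measurableC (fun z => a * f z) := measurableCM (measurableC_cst a) mf.
apply: le_lt_trans (FnormD cphi p1 maf mg) _.
by rewrite (FnormZ cphi a p0 mf) (nrmE Ff) (nrmE Fg) -EFinM -EFinD ltry.
Qed.

Lemma nrmZD a f g : Fock phi p f -> Fock phi p g ->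
  nrm (a *: f + g) <= cabs a * nrm f + nrm g.
Proof.
move=> Ff Fg; have mf := Fock_measurable Ff; have mg := Fock_measurable Fg.
have maf : measurableC (fun z => a * f z) := measurableCM (measurableC_cst a) mf.
have := FnormD cphi p1 maf mg.
rewrite (FnormZ cphi a p0 mf) (nrmE Ff) (nrmE Fg) -EFinM -EFinD => H.
by rewrite -lee_fin -(nrmE (FockZD a Ff Fg)); exact H.
Qed.

Lemma has_taylor0 : has_taylor (0 : C R -> C R) (fun=> 0).
Proof.
split=> [r r0|z]; first by exists 0 => k; rewrite cabs0 mul0r.
rewrite (_ : taylor_sum _ z = (fun=> 0)); first exact: cvg_cst.
by apply/funext => n; rewrite /taylor_sum big1// => i _; rewrite mul0r.
Qed.

Lemma Fock0 : Fock phi p 0.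
Proof.
split; first exact: has_taylor_entire has_taylor0.
have := FnormZ cphi 0 p0 (measurableC_taylor has_taylor0); rewrite cabs0 mul0e => E.
have F0 : (fun z => 0 * (0 : C R -> C R) z) = 0 :> (R[i] -> C R).
  by apply/funext => z; rewrite mul0r.
by rewrite -F0 E.
Qed.

Lemma nrm0 : nrm 0 = 0.
Proof.
have := FnormZ cphi 0 p0 (Fock_measurable Fock0); rewrite cabs0 mul0e => E.
have F0 : (fun z => 0 * (0 : C R -> C R) z) = 0 :> (R[i] -> C R).
  by apply/funext => z; rewrite mul0r.
by rewrite nrm_fine -[in LHS]F0 E.
Qed.

Lemma FockZ a f : Fock phi p f -> Fock phi p (a *: f).
Proof. by move=> Ff; rewrite -[_ *: _]addr0; exact: FockZD Fock0. Qed.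

Lemma nrmZ a f : Fock phi p f -> nrm (a *: f) = cabs a * nrm f.
Proof.
move=> Ff.
have E : Fnorm phi p (a *: f) = ((cabs a)%:E * Fnorm phi p f)%E.
  exact (FnormZ cphi a p0 (Fock_measurable Ff)).
by rewrite !nrm_fine E (nrmE Ff) -EFinM.
Qed.

Lemma FockB f g : Fock phi p f -> Fock phi p g -> Fock phi p (f - g).
Proof. by move=> Ff Fg; rewrite addrC -scaleN1r; exact: FockZD. Qed.

Lemma nrmD f g : Fock phi p f -> Fock phi p g -> nrm (f + g) <= nrm f + nrm g.
Proof. by move=> Ff Fg; have := nrmZD 1 Ff Fg; rewrite scale1r cabs1 mul1r. Qed.

Lemma nrmB f g : Fock phi p f -> Fock phi p g -> nrm (f - g) <= nrm f + nrm g.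
Proof.
move=> Ff Fg; have -> : f - g = (-1) *: g + f by rewrite scaleN1r addrC.
rewrite [leRHS]addrC -[nrm g in leRHS]mul1r.
by have := nrmZD (-1) Fg Ff; rewrite cabsN cabs1.
Qed.

Lemma Fock_monomial n : Fock phi p (monomial R n).
Proof.
split; last exact: Fnorm_monomial_finite.
exact: has_taylor_entire (@has_taylor_monomial R n).
Qed.

Definition mnrm n : R := nrm (monomial R n).

(** Monomial norms outgrow every geometric sequence; bounds on [cabs (c k) * mnrm k] therefore make
    a Taylor series converge everywhere. *)
Lemma mnrm_ge r : 0 < r -> exists2 d, 0 < d & forall n, d * r ^+ n <= mnrm n.
Proof.
move=> r0; have [d d0 H] := Fnorm_monomial_ge cphi p0 r0.
by exists d => // n; rewrite -lee_fin -nrmE ?H//; exact: Fock_monomial.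
Qed.

Lemma mnrm_gt0 n : 0 < mnrm n.
Proof.
have [d d0 H] := mnrm_ge ltr01; apply: lt_le_trans (H n).
by rewrite expr1n mulr1.
Qed.

Lemma nrm_coef f c k : Fock phi p f -> has_taylor f c -> cabs (c k) * mnrm k <= nrm f.
Proof.
move=> Ff fc; have := Fnorm_coef cphi k p1 fc.
by rewrite (nrmE Ff) (nrmE (Fock_monomial k)) -EFinM lee_fin.
Qed.

Lemma nrm_eq0 f : Fock phi p f -> nrm f = 0 -> f = 0.
Proof.
move=> Ff f0; have [c fc] := Fock_taylor Ff.
have c0 k : c k = 0.
  apply/eqP; rewrite -cabs_eq0 eq_le cabs_ge0 andbT -(pmulr_lle0 _ (mnrm_gt0 k)).
  by rewrite -f0; exact: nrm_coef.
apply/funext => z; have [_ /(_ z) fz] := fc.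
apply: cvg_complex_unique fz _; rewrite (_ : taylor_sum _ z = (fun=> 0)).
  exact: cvg_cst.
by apply/funext => n; rewrite /taylor_sum big1// => i _; rewrite c0 mul0r.
Qed.

Lemma opnorm_bound (S : (R[i] -> C R) -> (R[i] -> C R)) f :
  (forall a g, Fock phi p g -> S (a *: g) = a *: S g) ->
  Fock phi p f -> Fock phi p (S f) -> 0 < nrm f ->
  ((nrm (S f) / nrm f)%:E <= opnorm phi p S)%E.
Proof.
move=> SZ Ff FSf f0; apply: ereal_sup_ubound.
pose t : R[i] := ((nrm f)^-1)%:C.
have ct : cabs t = (nrm f)^-1 by rewrite cabs_real ger0_norm// invr_ge0 nrm_ge0.
exists (t *: f).
  split; first exact: FockZ.
  by rewrite (nrmE (FockZ t Ff)) nrmZ// ct mulVf ?lt0r_neq0.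
by rewrite SZ// (nrmE (FockZ t FSf)) nrmZ// ct mulrC.
Qed.

Lemma linear_op0 T : linear_op phi p T -> T 0 = 0.
Proof.
case=> _ TL; have := TL 1 0 0 Fock0 Fock0; rewrite scale1r addr0 scale1r => /eqP.
by rewrite -subr_eq0 opprD addrA subrr add0r oppr_eq0 => /eqP.
Qed.

Lemma linear_opZ T a f : linear_op phi p T -> Fock phi p f -> T (a *: f) = a *: T f.
Proof. move=> lT Ff; have := lT.2 a f 0 Ff Fock0; rewrite (linear_op0 lT).
by rewrite (addr0 (a *: f)) (addr0 (a *: T f)). Qed.

Lemma linear_opB T f g : linear_op phi p T -> Fock phi p f -> Fock phi p g ->
  T (f - g) = T f - T g.
Proof.
move=> lT Ff Fg; have := lT.2 (-1) g f Fg Ff.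
by rewrite (scaleN1r g) (scaleN1r (T g)) (addrC _ f) (addrC _ (T f)).
Qed.

Lemma bounded_op_bound T : bounded_op phi p T ->
  exists2 B, 0 < B & forall f, Fock phi p f -> nrm (T f) <= B * nrm f.
Proof.
case=> [lT Too]; have [TF _] := lT.
have TZ b g : Fock phi p g -> T (b *: g) = b *: T g := linear_opZ b lT.
have op0 : (0 <= opnorm phi p T)%E.
  apply: (@le_trans _ _ (Fnorm phi p (T 0))); first exact: Fnorm_ge0.
  by apply: ereal_sup_ubound; exists 0 => //; split; [exact: Fock0|rewrite (nrmE Fock0) nrm0 lee_fin].
have opfin : opnorm phi p T \is a fin_num by rewrite ge0_fin_numE.
exists (fine (opnorm phi p T) + 1); first by rewrite ltr_wpDl// fine_ge0.
move=> f Ff; have [f0|f0] := eqVneq (nrm f) 0.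
  by have -> := nrm_eq0 Ff f0; rewrite (linear_op0 lT) nrm0 mulr0.
have f0' : 0 < nrm f by rewrite lt_def f0 nrm_ge0.
have := opnorm_bound TZ Ff (TF _ Ff) f0'.
rewrite -(fineK opfin) lee_fin ler_pdivrMr// => /le_trans; apply.
by apply: ler_wpM2r; [exact: nrm_ge0|rewrite lerDl].
Qed.

Lemma pow_bounded_le1 (q B : R) n0 : 0 < q ->
  (forall n, (n0 <= n)%N -> q ^+ n <= B) -> q <= 1.
Proof.
move=> q0 H; rewrite leNgt; apply/negP => q1.
have : (1 : R) = 0.
  apply: (@geometric_small_eq0 _ (B * q^-1 ^+ n0) q^-1) => //.
    by rewrite invr_ge0 ltW//= invf_lt1.
  move=> n; rewrite -mulrA -exprD exprVn -ler_pdivrMr ?invr_gt0 ?exprn_gt0//.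
  by rewrite invrK mul1r H// leq_addr.
by move/eqP; rewrite oner_eq0.
Qed.

Lemma le_twice (x y m : R) : m <= x + y -> 2 * y <= m -> m <= 2 * x.
Proof. by move=> ? ?; lra. Qed.

(** Serves to combine a bound inside a disc with one outside it. The radial function [cabs z ^+ j]
    has the norm of [z ^+ j]. *)
Lemma Fnorm_le_two_monomials f A B j k : measurableC f -> 0 <= A -> 0 <= B ->
  (forall z, cabs (f z) <= A * cabs z ^+ j + B * cabs z ^+ k) ->
  (Fnorm phi p f <= (A * mnrm j + B * mnrm k)%:E)%E.
Proof.
move=> mf A0 B0 fAB.
pose h m (z : C R) : C R := (cabs z ^+ m)%:C.
have mh m : measurableC (h m).
  have mc := measurable_cabs (@measurableC_id R).
  by apply: (measurableC_ReIm (measurable_funX m mc) (@measurable_cst _ _ _ _ _ (0 : R))).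
have mm m : measurableC (monomial R m) := Fock_measurable (Fock_monomial m).
have hE m z : cabs (h m z) = cabs (monomial R m z).
  by rewrite /h /monomial cabs_real cabsX ger0_norm// exprn_ge0 ?cabs_ge0.
have hN m : (Fnorm phi p (h m) <= (mnrm m)%:E)%E.
  rewrite -(nrmE (Fock_monomial m)).
  by apply: (le_Fnorm cphi p0 (mh m) (mm m)) => z; rewrite hE.
have m1 : measurableC (fun z => A%:C * h j z) := measurableCM (measurableC_cst A%:C) (mh _).
have m2 : measurableC (fun z => B%:C * h k z) := measurableCM (measurableC_cst B%:C) (mh _).
apply: le_trans (le_Fnorm cphi p0 mf (measurableCD m1 m2) _) _.
  move=> z; rewrite /h -!rmorphM -rmorphD cabs_real.
  by apply: le_trans (ler_norm _).
apply: (le_trans (FnormD cphi p1 m1 m2)).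
have split x y : ((A * x + B * y)%:E = A%:E * x%:E + B%:E * y%:E)%E by rewrite EFinD !EFinM.
rewrite (split (mnrm j) (mnrm k)).
have -> := FnormZ cphi A%:C p0 (mh j); have -> := FnormZ cphi B%:C p0 (mh k).
rewrite !cabs_real !ger0_norm//.
by apply: leeD; apply: lee_wpmul2l => //; rewrite lee_fin.
Qed.

(** Splitting at [|z| = r] gives [|z|^n <= r^(-(k-1)n) |z|^(kn) + r^n]. As [mnrm n] grows at least
    like [(2 r)^n], the norm of the second term is eventually at most half of it. *)
Lemma mnrm_dilate k r : (0 < k)%N -> 0 < r -> exists n0, forall n, (n0 <= n)%N ->
  r ^+ (k.-1 * n) * mnrm n <= 2 * mnrm (k * n).
Proof.
move=> k0 r0; have r20 : 0 < 2 * r by rewrite mulr_gt0.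
have [d d0 Hd] := mnrm_ge r20.
have key n : mnrm n <= r ^- (k.-1 * n) * mnrm (k * n) + r ^+ n * mnrm 0.
  rewrite -lee_fin -(nrmE (Fock_monomial n)).
  have a0 : 0 <= r ^- (k.-1 * n) by rewrite invr_ge0 exprn_ge0// ltW.
  have b0 : 0 <= r ^+ n by rewrite exprn_ge0// ltW.
  apply: (Fnorm_le_two_monomials (Fock_measurable (Fock_monomial n)) a0 b0) => z.
  rewrite /monomial cabsX expr0 mulr1.
  have [rz|zr] := leP r (cabs z); last first.
    rewrite ler_wpDl ?mulr_ge0 ?exprn_ge0 ?cabs_ge0//.
    by apply: lerXn2r; [exact: cabs_ge0|rewrite nnegrE ltW|exact: ltW].
  apply: ler_wpDr => //.
  rewrite mulrC ler_pdivlMr ?exprn_gt0// -[in leRHS](prednK k0) mulSn exprD.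
  apply: ler_wpM2l; first by rewrite exprn_ge0 ?cabs_ge0.
  by apply: lerXn2r; [rewrite nnegrE ltW|exact: cabs_ge0|].
pose x := 2 * mnrm 0 / d; exists (Num.bound x) => n nx.
have x0 : 0 <= x by rewrite divr_ge0 ?mulr_ge0 ?nrm_ge0// ltW.
have xn : 2 * mnrm 0 <= d * 2 ^+ n.
  rewrite (mulrC d) -ler_pdivrMr// -/x; apply: ltW; apply: lt_le_trans (archi_boundP x0) _.
  rewrite -natrX ler_nat (leq_trans nx)// ltnW// ltn_expl//.
have rn0 : 0 < r ^+ n by exact: exprn_gt0.
have half : 2 * (r ^+ n * mnrm 0) <= mnrm n.
  apply: le_trans (Hd n); rewrite exprMn (mulrA d) (mulrC (r ^+ n)) (mulrA 2).
  by apply: ler_wpM2r; [exact: ltW|].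
have rk0 : 0 < r ^+ (k.-1 * n) by exact: exprn_gt0.
have := le_twice (key n) half.
by rewrite mulrCA ler_pdivlMl.
Qed.

End FockSpace.

(** * Symbols of bounded composition operators *)

Section Symbol.
Variables (R : realType) (phi : R -> R) (p : R).
Hypotheses (cphi : continuous_weight phi) (gphi : quadratic_growth phi) (p1 : 1 <= p).
Implicit Types (f g psi : R[i] -> C R) (a b u z w : R[i]) (c d : nat -> R[i]).

Let p0 : 0 < p. Proof. exact: lt_le_trans p1. Qed.
Local Notation nrm := (nrm phi p).
Local Notation mnrm := (mnrm phi p).

Lemma factorial_growth (q K : R) : 0 < q -> exists m : nat, K * q ^+ m < m`!%:R.
Proof.
move=> q0; apply: contrapT => H.
have {}H m : m`!%:R <= K * q ^+ m.
  by rewrite leNgt; apply/negP => h; apply: H; exists m.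
have : (2 : R) <= 1.
  apply: (@pow_bounded_le1 _ _ (K * expR (2 * q)) 0) => // m _.
  have q20 : 0 <= 2 * q by rewrite mulr_ge0// ltW.
  have := factorial_expR_bound m q20; rewrite exprMn => H1.
  have qm : 0 < q ^+ m by exact: exprn_gt0.
  rewrite -(ler_pM2r qm); apply: (le_trans H1).
  rewrite mulrAC; apply: ler_wpM2r; [exact: expR_ge0|exact: H].
by lra.
Qed.

Lemma has_taylor_polynomial n d :
  has_taylor (fun z => \sum_(i < n) d i * z ^+ i) (fun k => if (k < n)%N then d k else 0).
Proof.
split => [r r0|z].
  exists (\sum_(i < n) cabs (d i) * r ^+ i) => k; case: ifPn => kn.
    rewrite (bigD1 (Ordinal kn))//= lerDl sumr_ge0// => i _.
    by rewrite mulr_ge0 ?cabs_ge0 ?exprn_ge0// ltW.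
  by rewrite cabs0 mul0r sumr_ge0// => i _; rewrite mulr_ge0 ?cabs_ge0 ?exprn_ge0// ltW.
apply/cvg_cabsP => e e0; exists n => // m /= nm.
rewrite /taylor_sum -(subnKC nm) big_split_ord /= [X in _ + X - _]big1 ?addr0 => [|i _].
  rewrite (_ : \sum_(i < n) _ = \sum_(i < n) d i * z ^+ i) ?subrr ?cabs0 ?ltW//.
  by apply: eq_bigr => i _; rewrite ltn_ord.
by rewrite ltnNge leq_addr /= mul0r.
Qed.

Lemma has_taylor_affine_pow a b n :
  has_taylor (fun z => (a * z + b) ^+ n)
    (fun k => if (k < n.+1)%N then ('C(n, k))%:R * a ^+ k * b ^+ (n - k) else 0).
Proof.
have E : (fun z : R[i] => (a * z + b) ^+ n : C R) =
    (fun z => \sum_(i < n.+1) (('C(n, i))%:R * a ^+ i * b ^+ (n - i)) * z ^+ i).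
  apply/funext => z; rewrite addrC exprDn; apply: eq_bigr => i _.
  by rewrite exprMn -mulr_natl; ring.
rewrite E; exact (has_taylor_polynomial n.+1 (fun k => ('C(n, k))%:R * a ^+ k * b ^+ (n - k))).
Qed.

Variable psi : R[i] -> C R.
Hypothesis bpsi : bounded_symbol phi p psi.

Let epsi : entire psi. Proof. by case: bpsi. Qed.

Lemma symbol_pow_bound : exists2 B, 0 < B &
  forall n, Fock phi p (fun z => psi z ^+ n) /\ nrm (fun z => psi z ^+ n) <= B * mnrm n.
Proof.
have [_ _ bT] := bpsi; have [B B0 HB] := bounded_op_bound cphi gphi p1 bT.
exists B; first exact: B0.
move=> n; have Fm := Fock_monomial cphi gphi p1 n; split.
  have [[TF _] _] := bT; exact (TF _ Fm).
exact (HB _ Fm).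
Qed.

(* The norm of [psi ^+ n] is the [n]-th power of the norm of [psi] for the exponent
   [p * n] and the weight [phi / n], where the coefficient estimate applies to [psi]. *)
Lemma symbol_coef_bound B c k n : (0 < n)%N -> has_taylor psi c ->
  Fock phi p (fun z => psi z ^+ n) ->
  nrm (fun z => psi z ^+ n) <= B * mnrm n -> cabs (c k) ^+ n * mnrm (k * n) <= B * mnrm n.
Proof.
move=> n0 pc Fn; apply: le_trans.
have nn : (n%:R : R) != 0 by rewrite pnatr_eq0 -lt0n.
pose phin x := phi x / n%:R.
have cn : continuous_weight phin by move=> x; exact (cvgM (@cphi x) (cvg_cst _)).
have pn1 : 1 <= p * n%:R by rewrite -[leLHS]mulr1; apply: ler_pM => //; rewrite ler1n.
have H := Fnorm_coef cn k pn1 pc.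
have E : Fnorm phi p (monomial R (k * n)) = (Fnorm phin (p * n%:R) (monomial R k) `^ n%:R)%E.
  have Ef : monomial R (k * n) = (fun z => monomial R k z ^+ n).
    by apply/funext => z; rewrite /monomial exprM.
  rewrite Ef; exact (Fnorm_expr phi (monomial R k) n0 p0).
have main : ((cabs (c k) ^+ n)%:E * Fnorm phi p (monomial R (k * n)) <=
    Fnorm phi p (fun z => psi z ^+ n)%R)%E.
  rewrite E (Fnorm_expr phi psi n0 p0) -(powR_mulrn n (cabs_ge0 _)) -poweR_EFin.
  rewrite -poweRM; [|by rewrite lee_fin cabs_ge0|exact: Fnorm_ge0].
  apply: le_poweR; [exact: ler0n| |exact: H].
  by apply: mule_ge0; [rewrite lee_fin cabs_ge0|exact: Fnorm_ge0].
move: main; rewrite (nrmE Fn) (nrmE (Fock_monomial cphi gphi p1 (k * n))).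
by rewrite -EFinM lee_fin.
Qed.

(** The bound [|c_k|^n ||z^(kn)|| <= B ||z^n||] contradicts [mnrm_dilate] when [k > 1] and [c_k] is
    nonzero; for [k = 1] it says that the powers of [|c_1|] are bounded. *)
Lemma symbol_affine : exists a b, [/\ a != 0, cabs a <= 1 & forall z, psi z = a * z + b].
Proof.
have [c pc] := entire_has_taylor epsi.
have [B B0 HB] := symbol_pow_bound.
have cb k n : (0 < n)%N -> cabs (c k) ^+ n * mnrm (k * n) <= B * mnrm n.
  by move=> n0; have [Fn Hn] := HB n; exact: symbol_coef_bound n0 pc Fn Hn.
have m0 n : 0 < mnrm n by exact: mnrm_gt0.
have ck k : (1 < k)%N -> c k = 0.
  move=> k1; apply/eqP; rewrite -cabs_eq0 eq_le cabs_ge0 andbT leNgt; apply/negP => x0.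
  set x := cabs (c k) in x0 cb *.
  (* Then [x * r = x + 2], so [x * r ^+ k.-1] is at least 2, although its powers must stay
     bounded. *)
  pose r := 1 + 2 / x.
  have r1 : 1 <= r by rewrite lerDl divr_ge0// ltW.
  have r0 : 0 < r by lra.
  have [n0 Hn0] := mnrm_dilate cphi gphi p1 (ltnW k1) r0.
  have xr : 2 <= x * r ^+ k.-1.
    apply: (@le_trans _ _ (x * r)).
      by rewrite mulrDr mulrCA divff ?lt0r_neq0// mulr1 mulr1 lerDr ltW.
    apply: ler_wpM2l; first exact: ltW.
    by rewrite -[leLHS]expr1 ler_weXn2l// -ltnS prednK// ltnW.
  have : x * r ^+ k.-1 <= 1.
    apply: (@pow_bounded_le1 _ _ (2 * B) n0.+1); first by lra.
    move=> n nn0; have n1 : (0 < n)%N by exact: leq_trans nn0.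
    rewrite exprMn -exprM -(ler_pM2r (m0 n)) -mulrA.
    have H1 : x ^+ n * (r ^+ (k.-1 * n) * mnrm n) <= x ^+ n * (2 * mnrm (k * n)).
      by apply: ler_wpM2l; [rewrite exprn_ge0// ltW|apply: Hn0; exact: ltnW].
    apply: (le_trans H1); rewrite mulrCA -mulrA.
    by apply: ler_wpM2l; [|exact: (cb k n n1)].
  lra.
have psiE z : psi z = c 1%N * z + c 0%N.
  have [_ /(_ z) pz] := pc.
  apply: (cvg_complex_unique pz); apply/cvg_cabsP => e e0; exists 2%N => // n /= n2.
  rewrite /taylor_sum -(subnKC n2) big_split_ord /= [X in _ + X - _]big1 ?addr0.
    by rewrite !big_ord_recl big_ord0 /= expr0 expr1 mulr1 addr0 addrC subrr cabs0 ltW.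
  by move=> i _; rewrite ck ?mul0r// leq_addr.
exists (c 1%N), (c 0%N); split => //.
  apply/eqP => c1; have [_ nc _] := bpsi; apply: nc; exists (c 0%N) => z.
  by rewrite psiE c1 mul0r add0r.
have [->|x0] := eqVneq (cabs (c 1%N)) 0; first by [].
apply: (@pow_bounded_le1 _ _ B 1); first by rewrite lt_def x0 cabs_ge0.
move=> n n1; rewrite -(ler_pM2r (m0 n)).
by have := cb 1%N n n1; rewrite mul1n.
Qed.

(* Otherwise the coefficient of [z ^+ n] in [(a z + b) ^+ n.+1] forces the norm of [z ^+ n]
   to grow like [n`!], whereas that of [z ^+ (2 m)] is only [O(D ^+ m * m`!)]. *)
Lemma symbol_rotation a b : (forall z, psi z = a * z + b) -> cabs a = 1 -> b = 0.
Proof.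
move=> psiE a1; apply: contrapT => /eqP b0.
have [B B0 HB] := symbol_pow_bound.
have m0 n : 0 < mnrm n by exact: mnrm_gt0.
pose e := cabs b / B.
have e0 : 0 < e by rewrite divr_gt0// cabs_gt0.
have step n : e * n.+1%:R * mnrm n <= mnrm n.+1.
  have [Fn Hn] := HB n.+1.
  have E : (fun z => psi z ^+ n.+1) = (fun z => (a * z + b) ^+ n.+1).
    by apply/funext => z; rewrite psiE.
  have pc := has_taylor_affine_pow a b n.+1; rewrite -E in pc.
  have := le_trans (nrm_coef cphi gphi p1 n Fn pc) Hn; set x := cabs _.
  have -> : x = n.+1%:R * cabs b.
    rewrite /x ltnW ?ltnSn// subSn ?leqnn// subnn expr1 binSn.
    by rewrite !cabsM cabs_nat cabsX a1 expr1n mulr1.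
  rewrite -ler_pdivrMl// => H; apply: le_trans H.
  rewrite /e le_eqVlt; apply/orP; left; apply/eqP.
  by move: (mnrm n) => t; field; rewrite lt0r_neq0.
have low n : e ^+ n * n`!%:R * mnrm 0 <= mnrm n.
  elim: n => [|n IH]; first by rewrite expr0 fact0 !mul1r.
  apply: le_trans (step n); apply: le_trans (_ : e * n.+1%:R * (e ^+ n * n`!%:R * mnrm 0) <= _).
    by rewrite exprS factS natrM le_eqVlt; apply/orP; left; apply/eqP; ring.
  by apply: ler_wpM2l => //; rewrite mulr_ge0// ltW.
have [K [D [K0 D0 KD]]] := Fnorm_even_monomial cphi gphi p0.
have q0 : 0 < D / e ^+ 2 by rewrite divr_gt0// exprn_gt0.
have [m] := factorial_growth (K / mnrm 0) q0; apply/negP; rewrite -leNgt.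
have f0 : 0 < m`!%:R :> R by rewrite ltr0n fact_gt0.
(* This makes the lower bound for [mnrm (2 * m)] contain [m!] twice and the upper bound only once;
   what remains is [m! <= (K / mnrm 0) * (D / e^2)^m], false for the chosen [m]. *)
have ff : (m`! * m`! <= (2 * m)`!)%N.
  have mm : (m <= 2 * m)%N by rewrite mul2n -addnn leq_addr.
  have := bin_fact mm; rewrite {2}mul2n -addnn addnK => <-.
  by rewrite leq_pmull// bin_gt0.
have up : mnrm (2 * m) <= K * m`!%:R * D ^+ m.
  by have := KD m; rewrite (nrmE (Fock_monomial cphi gphi p1 (2 * m))) lee_fin.
have lo := low (2 * m)%N.
have e2 : 0 < (e ^+ 2) ^+ m by rewrite !exprn_gt0.
have H : (e ^+ 2) ^+ m * (m`!%:R * m`!%:R) * mnrm 0 <= K * m`!%:R * D ^+ m.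
  apply: le_trans up; apply: le_trans lo; rewrite -exprM.
  apply: ler_wpM2r; first exact: ltW.
  by apply: ler_wpM2l; [rewrite exprn_ge0// ltW|rewrite -natrM ler_nat].
rewrite expr_div_n mulrA -(ler_pM2r f0) -(ler_pM2r e2) -(ler_pM2r (m0 0%N)).
apply: le_trans (_ : K * m`!%:R * D ^+ m <= _).
  by apply: le_trans H; rewrite le_eqVlt; apply/orP; left; apply/eqP; ring.
rewrite le_eqVlt; apply/orP; left; apply/eqP; field.
by rewrite (lt0r_neq0 (m0 0%N)) (lt0r_neq0 e2).
Qed.

End Symbol.

(** * Compactness and essential norms *)

Section Sequences.
Variable R : realType.
Implicit Types (x : nat -> R[i]) (e M : R).

(** By compactness of segments. One ultrafilter gives limits to all bounded sequences at once, in
    place of iterated extractions. *)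
Lemma ultrafilter_limit (U : set_system nat) x M : UltraFilter U ->
  (forall n, cabs (x n) <= M) ->
  exists l : R[i], forall e, 0 < e -> U [set n | cabs (x n - l) <= e].
Proof.
move=> UU xM.
have FU : ProperFilter U by exact: ultra_proper.
have real (v : nat -> R) : (forall n, `|v n| <= M) ->
    exists t, forall e, 0 < e -> U [set n | `|v n - t| <= e].
  move=> vM; have vMU : (v @ U) `[- M, M]%classic.
    have vM' : v @^-1` `[- M, M]%classic = setT.
      by apply/seteqP; split => // n _ /=; rewrite in_itv /= -ler_norml.
    by rewrite /fmap/= /nbhs/= vM'; exact: filterT.
  have [t [_ ct]] := @segment_compact R (- M) M _ (fmap_proper_filter v FU) vMU.
  exists t => e e0; set A := [set n | _].
  have [//|nA] := in_ultra_setVsetC A UU; exfalso.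
  have nt : nbhs t [set y | `|t - y| <= e].
    exists e => //= y; rewrite /ball /=; exact: ltW.
  by have [y [/= ny]] := ct [set y | ~ `|y - t| <= e] _ nA nt; rewrite distrC.
have [s sP] := real (fun n => complex.Re (x n)) (fun n => le_trans (normr_Re _) (xM n)).
have [t tP] := real (fun n => complex.Im (x n)) (fun n => le_trans (normr_Im _) (xM n)).
exists (s +i* t) => e e0.
have e2 : 0 < e / 2 by rewrite divr_gt0.
apply: filterS2 (sP _ e2) (tP _ e2) => n /= sn tn.
apply: (le_trans (cabs_le_ReIm _)); rewrite !raddfB /=.
by rewrite (splitr e) lerD.
Qed.

(** For positive [j], the index [kappa j] is chosen after the previous one so that the first [j]
    coordinates are within [1 / (j + 1)] of their limits along a single ultrafilter. *)
Lemma diagonal_subsequence (x : nat -> nat -> R[i]) (M : nat -> R) :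
  (forall n k, cabs (x n k) <= M k) ->
  exists kappa : nat -> nat, {homo kappa : m n / (m < n)%N} /\
    forall k e, 0 < e -> exists n0, forall m n, (n0 <= m)%N -> (n0 <= n)%N ->
      cabs (x (kappa m) k - x (kappa n) k) <= e.
Proof.
move=> xM.
have [U [UU inU]] := @ultraFilterLemma nat \oo _.
have FU : ProperFilter U by exact: ultra_proper.
pose l k := sval (cid (ultrafilter_limit UU (fun n => xM n k))).
have lP k e : 0 < e -> U [set n | cabs (x n k - l k) <= e].
  by rewrite /l; case: cid => t /= H; exact: H.
have ex j m : exists n, (m < n)%N /\ forall k, (k < j)%N -> cabs (x n k - l k) <= j.+1%:R^-1.
  have U1 : U [set n | (m < n)%N] by apply: inU; exists m.+1.
  have U2 : U [set n | forall k : 'I_j, cabs (x n k - l k) <= j.+1%:R^-1].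
    by apply: filter_forall => k; apply: lP; rewrite invr_gt0.
  have [n [n1 n2]] := filter_ex (filterI U1 U2).
  by exists n; split => // k kj; exact: (n2 (Ordinal kj)).
pose kappa := fix kappa j := if j is i.+1 then sval (cid (ex j (kappa i))) else 0%N.
have kP j : (kappa j < kappa j.+1)%N /\
    forall k, (k < j.+1)%N -> cabs (x (kappa j.+1) k - l k) <= j.+2%:R^-1.
  exact: (svalP (cid (ex j.+1 (kappa j)))).
exists kappa; split.
  by apply: homo_ltn => [b a c|j]; [exact: ltn_trans|exact: (kP j).1].
move=> k e e0; have e2 : 0 < e / 2 by rewrite divr_gt0.
have near n : (maxn k (Num.bound (e / 2)^-1) < n)%N -> cabs (x (kappa n) k - l k) <= e / 2.
  case: n => // n; rewrite ltnS geq_max => /andP[kn en].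
  apply: (le_trans ((kP n).2 k _)); first by rewrite ltnS.
  rewrite -[leRHS]invrK lef_pV2 ?posrE ?invr_gt0//.
  apply: ltW; apply: lt_le_trans (archi_boundP _) _; first by rewrite invr_ge0 ltW.
  by rewrite ler_nat (leq_trans en)// -addn2 leq_addr.
exists (maxn k (Num.bound (e / 2)^-1)).+1 => m n mm nn.
rewrite (_ : _ - _ = (x (kappa m) k - l k) - (x (kappa n) k - l k)); last by ring.
rewrite (le_trans (cabsD _ _))// cabsN (splitr e) lerD// near//.
Qed.

Lemma cauchy_complex (x : nat -> R[i]) :
  (forall e, 0 < e -> exists n0, forall m n, (n0 <= m)%N -> (n0 <= n)%N ->
     cabs (x m - x n) <= e) ->
  exists l : R[i], forall e, 0 < e -> exists n0, forall n, (n0 <= n)%N ->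
    cabs (x n - l) <= e.
Proof.
move=> xC.
have [n0 Hn0] := xC 1 ltr01.
pose y n := x (n0 + n)%N.
have yM n : cabs (y n) <= cabs (x n0) + 1.
  rewrite (_ : y n = x n0 + (x (n0 + n)%N - x n0)); last by rewrite /y; ring.
  by rewrite (le_trans (cabsD _ _))// lerD2l Hn0// leq_addr.
have [U [UU inU]] := @ultraFilterLemma nat \oo _.
have FU : ProperFilter U by exact: ultra_proper.
have [l lP] := ultrafilter_limit UU yM.
exists l => e e0; have e2 : 0 < e / 2 by rewrite divr_gt0.
have [n1 Hn1] := xC _ e2.
exists n1 => n nn.
have U1 : U [set m | (n1 <= m)%N] by apply: inU; exists n1.
have [m [m1 m2]] := filter_ex (filterI U1 (lP _ e2)).
rewrite (_ : x n - l = (x n - y m) + (y m - l)); last by ring.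
apply: (le_trans (cabsD _ _)); rewrite (splitr e) lerD//.
by apply: Hn1 => //; rewrite (leq_trans m1)// leq_addl.
Qed.

End Sequences.

(** * Composition with affine maps; completeness *)

Section Composition.
Variables (R : realType) (phi : R -> R) (p : R).
Hypotheses (cphi : continuous_weight phi) (gphi : quadratic_growth phi) (p1 : 1 <= p).
Implicit Types (f g psi : R[i] -> C R) (a b u z w : R[i]) (c d : nat -> R[i]) (mu : R).

Let p0 : 0 < p. Proof. exact: lt_le_trans p1. Qed.
Local Notation nrm := (nrm phi p).
Local Notation mnrm := (mnrm phi p).

(* Beyond the radius [rho] the affine map contracts moduli by [mu], and the
   norms of monomials outgrow [rho ^+ k]. *)
Lemma affine_pow_norm a b mu : cabs a < mu -> exists2 M, 0 < M &
  forall k, (Fnorm phi p (fun z => (a * z + b) ^+ k)%R <= (M * mu ^+ k * mnrm k)%:E)%E.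
Proof.
move=> amu; have mu0 : 0 < mu by exact: le_lt_trans (cabs_ge0 _) amu.
have mua : 0 < mu - cabs a by rewrite subr_gt0.
(* From this radius on [|a| |z| + |b| <= mu |z|]; the added 1 keeps it positive when [b = 0]. *)
pose rho := cabs b / (mu - cabs a) + 1.
have rho0 : 0 < rho by rewrite ltr_wpDl// divr_ge0 ?cabs_ge0// ltW.
have brho : cabs b <= (mu - cabs a) * rho.
  by rewrite mulrDr mulr1 mulrCA divff ?lt0r_neq0// mulr1 lerDl ltW.
have [d d0 Hd] := mnrm_ge cphi gphi p1 rho0.
have m0 n : 0 < mnrm n by exact: mnrm_gt0.
exists (1 + mnrm 0 / d); first by rewrite ltr_wpDr// divr_ge0// ltW.
move=> k; have mf := measurableC_taylor (has_taylor_affine_pow a b k).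
have r0 : 0 <= mu ^+ k * rho ^+ k by rewrite mulr_ge0// exprn_ge0// ltW.
apply: le_trans (Fnorm_le_two_monomials cphi gphi p1 (j := k) (k := 0) mf (exprn_ge0 k (ltW mu0)) r0 _) _.
  move=> z; rewrite cabsX expr0 mulr1.
  have [rz|zr] := leP rho (cabs z).
    apply: ler_wpDr => //; rewrite -exprMn; apply: lerXn2r.
    - by rewrite nnegrE cabs_ge0.
    - by rewrite nnegrE mulr_ge0 ?cabs_ge0// ltW.
    apply: (le_trans (cabsD _ _)); rewrite cabsM.
    rewrite -[leRHS](subrK (cabs a * cabs z)) -mulrBl addrC lerD2r.
    by apply: (le_trans brho); apply: ler_wpM2l => //; exact: ltW.
  apply: ler_wpDl; first by rewrite mulr_ge0 ?exprn_ge0 ?cabs_ge0// ltW.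
  rewrite -exprMn; apply: lerXn2r.
  - by rewrite nnegrE cabs_ge0.
  - by rewrite nnegrE mulr_ge0// ltW.
  apply: (le_trans (cabsD _ _)); rewrite cabsM.
  rewrite -[leRHS](subrK (cabs a * rho)) -mulrBl addrC lerD//.
  by apply: ler_wpM2l; [exact: cabs_ge0|exact: ltW].
rewrite lee_fin; set t := mu ^+ k.
have t0 : 0 < t by exact: exprn_gt0.
have -> : t * mnrm k + t * rho ^+ k * mnrm 0 = t * (mnrm k + rho ^+ k * mnrm 0) by ring.
have -> : (1 + mnrm 0 / d) * t * mnrm k = t * (mnrm k + mnrm 0 * mnrm k / d) by ring.
apply: ler_wpM2l; first exact: ltW.
rewrite lerD2l ler_pdivlMr// mulrAC mulrC.
by apply: ler_wpM2l; [exact: ltW|rewrite mulrC; exact: Hd].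
Qed.

(* Only the composition with the Taylor partial sums is estimated; Fatou's lemma
   passes to the limit. *)
Lemma Fnorm_affine_comp a b mu M f c K : 0 <= mu < 1 -> 0 <= M ->
  (forall k, (Fnorm phi p (fun z => (a * z + b) ^+ k)%R <= (M * mu ^+ k * mnrm k)%:E)%E) ->
  Fock phi p f -> has_taylor f c ->
  (Fnorm phi p (fun z => f (a * z + b)%R) <=
    (\sum_(k < K) cabs (c k) * (M * mu ^+ k * mnrm k) + nrm f * M * mu ^+ K / (1 - mu))%:E)%E.
Proof.
move=> mu01 M0 HM Ff fc; have /andP[mu0 mu1] := mu01.
have mf k : measurableC (fun z => (a * z + b) ^+ k) := measurableC_taylor (has_taylor_affine_pow a b k).
have mcf k : measurableC (fun z => c k * (a * z + b) ^+ k) := measurableCM (measurableC_cst (c k)) (mf k).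
have f0 : 0 <= nrm f by exact: nrm_ge0.
have term0 k : 0 <= cabs (c k) * (M * mu ^+ k * mnrm k).
  by rewrite !mulr_ge0 ?cabs_ge0 ?exprn_ge0//; exact: nrm_ge0.
have termE k : (Fnorm phi p (fun z => c k * (a * z + b) ^+ k)%R <=
    (cabs (c k) * (M * mu ^+ k * mnrm k))%:E)%E.
  have -> := FnormZ cphi (c k) p0 (mf k); rewrite EFinM.
  by apply: lee_wpmul2l; [rewrite lee_fin cabs_ge0|exact: HM].
have tail k : cabs (c k) * (M * mu ^+ k * mnrm k) <= nrm f * M * mu ^+ k.
  rewrite (_ : _ * _ = cabs (c k) * mnrm k * (M * mu ^+ k)); last by ring.
  rewrite -(mulrA (nrm f)); apply: ler_wpM2r; first by rewrite mulr_ge0 ?exprn_ge0.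
  exact: (nrm_coef cphi gphi p1 k Ff fc).
apply: (Fnorm_le_lim cphi (F := fun n z => taylor_sum c (a * z + b) n) p0).
- apply: addr_ge0; first by apply: sumr_ge0.
  by rewrite divr_ge0 ?mulr_ge0 ?exprn_ge0// subr_ge0 ltW.
- by move=> n; exact: (Fnorm_sum cphi n p1 mcf).1.
- by move=> z; exact: fc.2.
exists K => // n /= Kn.
apply: (le_trans (Fnorm_sum cphi n p1 mcf).2).
apply: (@le_trans _ _ (\sum_(i < n) (cabs (c i) * (M * mu ^+ i * mnrm i))%:E)%E).
  by apply: lee_sum => i _; exact: termE.
rewrite sumEFin lee_fin -(big_mkord xpredT (fun k => cabs (c k) * (M * mu ^+ k * mnrm k))).
rewrite (big_cat_nat (n := K))//= big_mkord lerD2l.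
apply: le_trans (geometric_sum_le _ mu01 Kn); last by rewrite mulr_ge0.
by apply: ler_sum => i _; exact: tail.
Qed.

(** Phrased with coefficients instead of the norm because, in the completeness proof, it is applied
    before the limit is known to have finite norm. *)
Lemma Fock_eval z : exists2 E, 0 < E & forall f c e, has_taylor f c ->
  (forall k, cabs (c k) * mnrm k <= e) -> cabs (f z) <= e * E.
Proof.
have r0 : 0 < 2 * (cabs z + 1) by rewrite mulr_gt0// ltr_wpDl ?cabs_ge0.
have [d d0 Hd] := mnrm_ge cphi gphi p1 r0.
exists (2 / d); first by rewrite divr_gt0.
move=> f c e fc ce.
have q01 : 0 <= (2^-1 : R) < 1 by apply/andP; split; lra.
have e0 : 0 <= e by apply: le_trans (ce 0%N); rewrite mulr_ge0 ?cabs_ge0//; exact: nrm_ge0.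
have [|l [ul tl]] := @geometric_series_cvg _ (fun k => c k * z ^+ k) (e / d) 2^-1 q01.
  move=> k; rewrite cabsM cabsX exprVn ler_pdivlMr ?exprn_gt0// ler_pdivlMr//.
  apply: le_trans (ce k); rewrite -!mulrA; apply: ler_wpM2l; first exact: cabs_ge0.
  apply: le_trans (Hd k); rewrite mulrA mulrC -exprMn; apply: ler_wpM2l; first exact: ltW.
  apply: lerXn2r; rewrite ?nnegrE.
  - by rewrite mulr_ge0// cabs_ge0.
  - exact: ltW.
  by rewrite mulrC; apply: ler_wpM2l => //; rewrite lerDl.
have -> : f z = l by apply: cvg_complex_unique (fc.2 z) _; exact: ul.
have := tl 0%N; rewrite big_ord0 subr0 expr0 mulr1 => /le_trans; apply.
rewrite le_eqVlt; apply/orP; left; apply/eqP; field.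
by rewrite lt0r_neq0.
Qed.

(* The limit is built from the limits of the Taylor coefficients. *)
Lemma Fock_complete (u : nat -> (R[i] -> C R)) : (forall n, Fock phi p (u n)) ->
  (forall e, 0 < e -> exists n0, forall m n, (n0 <= m)%N -> (n0 <= n)%N ->
    nrm (u m - u n) <= e) ->
  exists2 g, Fock phi p g & forall e, 0 < e -> exists n0, forall n, (n0 <= n)%N ->
    nrm (u n - g) <= e.
Proof.
move=> Fu uC.
have [c uc] := choice (fun n => Fock_taylor (Fu n)).
have m0 n : 0 < mnrm n by exact: mnrm_gt0.
have dc m n k : cabs (c m k - c n k) * mnrm k <= nrm (u m - u n).
  have H : has_taylor (u m - u n) (fun k => -1 * c n k + c m k).
    have -> : u m - u n = (-1) *: u n + u m by rewrite scaleN1r addrC.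
    exact (has_taylor_lin (-1) (uc n) (uc m)).
  have := nrm_coef cphi gphi p1 k (FockB cphi p1 (Fu m) (Fu n)) H.
  by rewrite mulN1r addrC.
have lim k : exists l, forall e, 0 < e -> exists n0, forall n, (n0 <= n)%N ->
    cabs (c n k - l) <= e.
  apply: cauchy_complex => e e0.
  have [n0 H] := uC (e * mnrm k) (mulr_gt0 e0 (m0 k)).
  exists n0 => m n mm nn; rewrite -(ler_pM2r (m0 k)); exact: le_trans (dc m n k) (H m n mm nn).
have [l lP] := choice lim.
have dl e n0 : 0 < e -> (forall m n, (n0 <= m)%N -> (n0 <= n)%N -> nrm (u m - u n) <= e) ->
    forall n k, (n0 <= n)%N -> cabs (c n k - l k) * mnrm k <= e.
  move=> e0 H n k nn; apply/ler_addgt0Pl => t t0.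
  have [n1 H1] := lP k (t / mnrm k) (divr_gt0 t0 (m0 k)).
  rewrite (_ : c n k - l k = (c (maxn n0 n1) k - l k) + (c n k - c (maxn n0 n1) k)); last by ring.
  apply: (@le_trans _ _ ((t / mnrm k + cabs (c n k - c (maxn n0 n1) k)) * mnrm k)).
    apply: ler_wpM2r; first exact: ltW.
    by apply: (le_trans (cabsD _ _)); rewrite lerD2r H1// leq_maxr.
  rewrite mulrDl divfK ?lt0r_neq0// lerD2l.
  by apply: (le_trans (dc _ _ _)); rewrite H// leq_maxl.
have [n1 H1] := uC 1 ltr01.
have cl : entire_coef l.
  move=> r r0; have [d d0 Hd] := mnrm_ge cphi gphi p1 r0.
  have [B HB] := (uc n1).1 r r0.
  exists (B + d^-1) => k.
  rewrite (_ : l k = c n1 k + - (c n1 k - l k)); last by ring.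
  apply: (@le_trans _ _ ((cabs (c n1 k) + cabs (c n1 k - l k)) * r ^+ k)).
    apply: ler_wpM2r; first by rewrite exprn_ge0// ltW.
    by apply: (le_trans (cabsD _ _)); rewrite cabsN.
  rewrite mulrDl lerD// -[leRHS]mul1r ler_pdivlMr//.
  apply: le_trans (dl 1 n1 ltr01 H1 n1 k (leqnn _)); rewrite -mulrA.
  by apply: ler_wpM2l; [exact: cabs_ge0|rewrite mulrC; exact: Hd].
have [g gl] := entire_coef_has_taylor cl.
have pt z : (u ^~ z : nat -> C R) @ \oo --> g z.
  have [E E0 HE] := Fock_eval z; apply/cvg_cabsP => e e0.
  have eE : 0 < e / E by rewrite divr_gt0.
  have [n0 H] := uC _ eE; exists n0 => // n /= nn.
  have T : has_taylor (u n - g) (fun k => -1 * l k + c n k).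
    have -> : u n - g = (-1) *: g + u n by rewrite scaleN1r addrC.
    exact (has_taylor_lin (-1) gl (uc n)).
  have B k : cabs (-1 * l k + c n k) * mnrm k <= e / E.
    by rewrite mulN1r addrC; exact: (dl _ n0 eE H n k nn).
  have := HE _ _ _ T B; rewrite divfK ?lt0r_neq0//.
have mg := measurableC_taylor gl.
have mu n : measurableC (u n) := measurableC_taylor (uc n).
(* With [n] fixed, Fatou in [m] turns the Cauchy condition into a bound on the distance to [g]. *)
have dist e n0 : 0 < e -> (forall m n, (n0 <= m)%N -> (n0 <= n)%N -> nrm (u m - u n) <= e) ->
    forall n, (n0 <= n)%N -> (Fnorm phi p (u n - g)%R <= e%:E)%E.
  move=> e0 H n nn.
  apply: (Fnorm_le_lim cphi (F := fun m z => u n z + (-1) * u m z) p0 (ltW e0)).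
  - by move=> m; exact (measurableCD (mu n) (measurableCM (measurableC_cst (-1)) (mu m))).
  - move=> z; have -> : (u n - g) z = u n z - g z by [].
    apply/cvg_cabsP => t t0; have /cvg_cabsP := pt z => /(_ t t0).
    apply: filterS => m; rewrite mulN1r -[X in cabs X <= _ -> _]opprB cabsN => h.
    by rewrite (_ : _ - _ = g z - u m z)//; ring.
  - exists n0 => // m /= mm.
    have -> : (fun z => u n z + (-1) * u m z) = u n - u m.
      by apply/funext => z; rewrite mulN1r.
    by rewrite (nrmE (FockB cphi p1 (Fu n) (Fu m))) lee_fin; exact: H.
have Fg : Fock phi p g.
  split; first exact: has_taylor_entire gl.
  have D := dist 1 n1 ltr01 H1 n1 (leqnn _).
  have mng : measurableC (u n1 - g).
    have -> : u n1 - g = (fun z => u n1 z + (-1) * g z) by apply/funext => z; rewrite mulN1r.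
    exact (measurableCD (mu n1) (measurableCM (measurableC_cst (-1)) mg)).
  have Fd : Fock phi p (u n1 - g).
    split; last exact: le_lt_trans D (ltry _).
    have -> : u n1 - g = (-1) *: g + u n1 by rewrite scaleN1r addrC.
    exact (has_taylor_entire (has_taylor_lin (-1) gl (uc n1))).
  have -> : g = u n1 - (u n1 - g) by apply/funext => z; rewrite /= opprB addrC subrK.
  exact (FockB cphi p1 (Fu n1) Fd).2.
exists g; first exact Fg.
move=> e e0; have [n0 H] := uC e e0; exists n0 => n nn.
have := dist e n0 e0 H n nn.
by rewrite (nrmE (FockB cphi p1 (Fu n) Fg)) lee_fin.
Qed.

End Composition.

(** * Compact contractions and essential norms of isometries *)

Section EssentialNorm.
Variables (R : realType) (phi : R -> R) (p : R).
Hypotheses (cphi : continuous_weight phi) (gphi : quadratic_growth phi) (p1 : 1 <= p).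
Implicit Types (f g psi : R[i] -> C R) (a b u z w : R[i]) (c d : nat -> R[i]) (mu : R).

Let p0 : 0 < p. Proof. exact: lt_le_trans p1. Qed.
Local Notation nrm := (nrm phi p).
Local Notation mnrm := (mnrm phi p).
Local Notation Fock := (Fock phi p).

Lemma Fnorm_cvg0 (v : nat -> (R[i] -> C R)) : (forall n, Fock (v n)) ->
  (forall e, 0 < e -> exists n0, forall n, (n0 <= n)%N -> nrm (v n) <= e) <->
  Fnorm phi p (v n) @[n --> \oo] --> 0%E.
Proof.
move=> Fv; have E : (fun n => Fnorm phi p (v n)) = EFin \o (fun n => nrm (v n)).
  by apply/funext => n; rewrite /= (nrmE (Fv n)).
rewrite E; split => [H|/fine_cvgP[_ /cvgrPdistC_le H] e e0].
  apply/fine_cvgP; split; first by apply: nearW.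
  apply/cvgrPdistC_le => e e0; have [n0 Hn] := H e e0; exists n0 => // n /= nn.
  by rewrite subr0 ger0_norm ?nrm_ge0// Hn.
have [n0 _ Hn] := H e e0; exists n0 => n nn.
by have := Hn n nn; rewrite /= subr0 ger0_norm ?nrm_ge0.
Qed.

Lemma geometric_eventually_le (A mu e : R) : 0 <= A -> 0 <= mu < 1 -> 0 < e ->
  exists K, A * mu ^+ K <= e.
Proof.
move=> A0 mu01 e0; apply: contrapT => H.
have : e = 0; last by move/eqP; rewrite gt_eqF.
apply: (geometric_small_eq0 (A := A) mu01 (ltW e0)) => n.
by rewrite leNgt; apply/negP => h; apply: H; exists n.+1; exact: ltW.
Qed.

(** Splitting after [K] coefficients serves twice: a small head and a small tail give compactness,
    and a vanishing head gives the decay of the singular values. *)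
Lemma contraction_bound psi a b : (forall z, psi z = a * z + b) -> cabs a < 1 ->
  exists M mu, [/\ 0 < M, 0 < mu, mu < 1 & forall f c K, Fock f -> Fock (Cop psi f) ->
    has_taylor f c -> nrm (Cop psi f) <=
      \sum_(k < K) cabs (c k) * (M * mu ^+ k * mnrm k) + nrm f * M * mu ^+ K / (1 - mu)].
Proof.
move=> psiE a1; pose mu := (cabs a + 1) / 2.
have a0 := cabs_ge0 a.
have amu : cabs a < mu by rewrite /mu; lra.
have mu0 : 0 < mu by rewrite /mu; lra.
have mu1 : mu < 1 by rewrite /mu; lra.
have [M M0 HM] := affine_pow_norm cphi gphi p1 b amu.
exists M, mu; split => // f c K Ff Fpf fc.
have mu01 : 0 <= mu < 1 by rewrite ltW.
have := Fnorm_affine_comp cphi gphi p1 K mu01 (ltW M0) HM Ff fc.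
have -> : (fun z => f (a * z + b)) = Cop psi f.
  by apply/funext => z; rewrite /Cop /= psiE.
by rewrite (nrmE Fpf) lee_fin.
Qed.

(** Each coefficient is bounded along a bounded sequence, so a diagonal subsequence makes all of
    them Cauchy. [K] is fixed by the tail [mu ^+ K], after which finitely many coefficients control
    the head. *)
Lemma contraction_compact psi a b : linear_op phi p (Cop psi) ->
  (forall z, psi z = a * z + b) -> cabs a < 1 -> compact_op phi p (Cop psi).
Proof.
move=> lT psiE a1; split; first exact lT.
move=> u Fu [B0 HB].
pose B := `|B0|.
have uB n : nrm (u n) <= B.
  by have := HB n; rewrite (nrmE (Fu n)) lee_fin => /le_trans; apply; exact: ler_norm.
have [M [mu [M0 mu0 mu1 HT]]] := contraction_bound psiE a1.
have [c uc] := choice (fun n => Fock_taylor (Fu n)).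
have m0 n : 0 < mnrm n by exact: mnrm_gt0.
have cB n k : cabs (c n k) <= B / mnrm k.
  by rewrite ler_pdivlMr//; apply: le_trans (nrm_coef cphi gphi p1 k (Fu n) (uc n)) (uB n).
have [kappa [kmono kC]] := diagonal_subsequence (M := fun k => B / mnrm k) cB.
have TF := lT.1.
have Fd m n : Fock (u m - u n) := FockB cphi p1 (Fu m) (Fu n).
have TB m n : Cop psi (u m) - Cop psi (u n) = Cop psi (u m - u n).
  by rewrite (linear_opB lT (Fu m) (Fu n)).
have B0' : 0 <= B by exact: normr_ge0.
have uBB m n : nrm (u m - u n) <= 2 * B.
  apply: (le_trans (nrmB cphi p1 (Fu m) (Fu n))).
  by rewrite mulr2n mulrDl mul1r lerD.
have TC e : 0 < e -> exists n0, forall m n, (n0 <= m)%N -> (n0 <= n)%N ->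
    nrm (Cop psi (u (kappa m)) - Cop psi (u (kappa n))) <= e.
  move=> e0; have e2 : 0 < e / 2 by rewrite divr_gt0.
  have A0 : 0 <= 2 * B * M / (1 - mu) by rewrite divr_ge0 ?mulr_ge0// ?subr_ge0 ltW.
  have mu01 : 0 <= mu < 1 by rewrite ltW.
  have [K HK] := geometric_eventually_le A0 mu01 e2.
  (* The added 1 keeps [S] positive, also when [K = 0]. *)
  pose S := \sum_(k < K) M * mu ^+ k * mnrm k + 1.
  have S0 : 0 < S.
    rewrite ltr_wpDl// sumr_ge0// => i _.
    by rewrite !mulr_ge0 ?exprn_ge0// ltW.
  have [N HN] := choice (fun k => kC k (e / 2 / S) (divr_gt0 e2 S0)).
  exists (\max_(k < K) N k) => m n mm nn; rewrite TB.
  have H : has_taylor (u (kappa m) - u (kappa n)) (fun k => -1 * c (kappa n) k + c (kappa m) k).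
    have -> : u (kappa m) - u (kappa n) = (-1) *: u (kappa n) + u (kappa m).
      by rewrite scaleN1r addrC.
    exact (has_taylor_lin (-1) (uc _) (uc _)).
  apply: (le_trans (HT _ _ K (Fd _ _) (TF _ (Fd _ _)) H)).
  rewrite (splitr e); apply: lerD.
    apply: (@le_trans _ _ (\sum_(k < K) e / 2 / S * (M * mu ^+ k * mnrm k))).
      apply: ler_sum => k _; apply: ler_wpM2r.
        by rewrite !mulr_ge0 ?exprn_ge0// ltW.
      rewrite mulN1r addrC; have Nk : (N k <= \max_(k < K) N k)%N by exact: leq_bigmax.
      by apply: HN; [exact: leq_trans mm|exact: leq_trans nn].
    rewrite -mulr_sumr mulrAC ler_pdivrMr//; apply: ler_wpM2l; first exact: ltW.
    by rewrite lerDl.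
  apply: le_trans HK; rewrite mulrAC; apply: ler_wpM2r; first by rewrite exprn_ge0// ltW.
  apply: ler_wpM2r; first by rewrite invr_ge0 subr_ge0 ltW.
  by apply: ler_wpM2r; [exact: ltW|exact: uBB].
have [g Fg Hg] := Fock_complete cphi gphi p1 (fun n => TF _ (Fu (kappa n))) TC.
exists kappa, g; split; [exact kmono|exact Fg|].
have Fv n : Fock (Cop psi (u (kappa n)) - g) := FockB cphi p1 (TF _ (Fu (kappa n))) Fg.
exact ((Fnorm_cvg0 Fv).1 Hg).
Qed.

Lemma opnorm_isometry T : linear_op phi p T -> (forall f, Fock f -> nrm (T f) = nrm f) ->
  opnorm phi p T = 1%E.
Proof.
move=> lT iT; apply/eqP; rewrite eq_le; apply/andP; split.
  apply: ge_ereal_sup => _ [f [Ff f1] <-].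
  by rewrite (nrmE (lT.1 _ Ff)) (iT _ Ff) -(nrmE Ff).
have F1 := Fock_monomial cphi gphi p1 0.
have m0 : 0 < nrm (monomial R 0) by exact: mnrm_gt0.
have := opnorm_bound cphi p1 (fun a g => linear_opZ cphi p1 a lT) F1 (lT.1 _ F1) m0.
by rewrite (iT _ F1) divff// lt0r_neq0.
Qed.

Lemma dist_lower_bound (x y e : R) : 1 <= x -> 0 <= e -> x - 2 * e <= y -> 1 - 2 * e <= y / x.
Proof. by move=> x1 e0 H; rewrite ler_pdivlMr; [nra|lra]. Qed.

(* A compact operator nearly identifies two distinct normalized monomials, whose
   difference an isometry keeps of norm at least 1. *)
Lemma isometry_sub_compact T K : linear_op phi p T ->
  (forall f, Fock f -> nrm (T f) = nrm f) -> compact_op phi p K ->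
  (1 <= opnorm phi p (fun f => T f - K f)%R)%E.
Proof.
move=> lT iT [lK cK].
have m0 n : 0 < mnrm n by exact: mnrm_gt0.
have Fm n := Fock_monomial cphi gphi p1 n.
pose u n : R[i] -> C R := ((mnrm n)^-1)%:C *: monomial R n.
have ca n : cabs (((mnrm n)^-1)%:C) = (mnrm n)^-1.
  by rewrite cabs_real ger0_norm// invr_ge0 ltW.
have Fu n : Fock (u n) := FockZ cphi p1 _ (Fm n).
have u1 n : nrm (u n) = 1.
  by rewrite /u (nrmZ cphi p1 _ (Fm n)) ca mulVf// lt0r_neq0.
have [|kappa [g [kmono Fg /(Fnorm_cvg0 _).2 Kg]]] := cK u Fu.
  by exists 1 => n; rewrite (nrmE (Fu n)) u1.
have {}Kg := Kg (fun n => FockB cphi p1 (lK.1 _ (Fu (kappa n))) Fg).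
have lS a f : Fock f -> T (a *: f) - K (a *: f) = a *: (T f - K f).
  move=> Ff; rewrite (linear_opZ cphi p1 a lT Ff) (linear_opZ cphi p1 a lK Ff).
  by rewrite (scalerBr a).
suff H e : 0 < e -> ((1 - 2 * e)%:E <= opnorm phi p (fun f => T f - K f)%R)%E.
  apply/lee_addgt0Pr => e e0; rewrite -leeBlDr// -EFinB.
  by have := H (e / 2) (divr_gt0 e0 (ltr0Sn _ 1)); rewrite mulrCA divff// mulr1.
move=> e0; have [n0 Hn] := Kg e e0.
pose i := kappa n0; pose j := kappa n0.+1.
have ij : (i < j)%N by exact: kmono.
have Fh : Fock (u i - u j) := FockB cphi p1 (Fu i) (Fu j).
have Kh : nrm (K (u i - u j)) <= 2 * e.
  rewrite (linear_opB lK (Fu i) (Fu j)).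
  have -> : K (u i) - K (u j) = (K (u i) - g) - (K (u j) - g).
    by rewrite opprB addrA subrK.
  have Gi := FockB cphi p1 (lK.1 _ (Fu i)) Fg; have Gj := FockB cphi p1 (lK.1 _ (Fu j)) Fg.
  apply: (le_trans (nrmB cphi p1 Gi Gj)); rewrite mulr2n mulrDl mul1r.
  by apply: lerD; apply: Hn.
(* The coefficient of order [i] in the difference is [1 / mnrm i], so the coefficient bound gives
   1. *)
have h1 : 1 <= nrm (u i - u j).
  have H : has_taylor (u i - u j)
      (fun k => (- ((mnrm j)^-1)%:C) * (k == j)%:R + (((mnrm i)^-1)%:C * (k == i)%:R + 0)).
    have -> : u i - u j = (- ((mnrm j)^-1)%:C) *: monomial R j + (((mnrm i)^-1)%:C *: monomial R i + 0).
      by rewrite addr0 scaleNr addrC.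
    apply: has_taylor_lin; first exact: has_taylor_monomial.
    apply: has_taylor_lin; first exact: has_taylor_monomial.
    exact (has_taylor0 R).
  have := nrm_coef cphi gphi p1 i Fh H.
  by rewrite eqxx (ltn_eqF ij) mulr0 add0r addr0 mulr1 ca mulVf// lt0r_neq0.
have FTh := lT.1 _ Fh; have FKh := lK.1 _ Fh.
have FSh := FockB cphi p1 FTh FKh.
have := opnorm_bound cphi p1 lS Fh FSh (lt_le_trans ltr01 h1).
apply: le_trans; rewrite lee_fin; apply: dist_lower_bound h1 (ltW e0) _.
have := nrmD cphi p1 FSh FKh; rewrite subrK (iT _ Fh) => /(fun x => le_trans x) H.
by rewrite lerBlDr; apply: H; rewrite lerD2l.
Qed.

(** Otherwise [T] could itself be subtracted, and [T - T] has norm 0. *)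
Lemma isometry_not_compact T : linear_op phi p T ->
  (forall f, Fock f -> nrm (T f) = nrm f) -> ~ compact_op phi p T.
Proof.
move=> lT iT cT; have := isometry_sub_compact lT iT cT.
apply/negP; rewrite -ltNge; apply: (@le_lt_trans _ _ 0%E); last exact: lte01.
apply: ge_ereal_sup => _ [f [Ff f1] <-].
by rewrite subrr (nrmE (Fock0 cphi p1)) (nrm0 cphi p1).
Qed.

Lemma compact_zero : compact_op phi p (fun=> 0).
Proof.
have F0 := Fock0 cphi p1.
split.
  split => [f _|a f g _ _]; first exact F0.
  by rewrite scaler0 addr0.
move=> u Fu _; exists id, 0; split; [by []|exact F0|].
rewrite subrr (nrmE F0) (nrm0 cphi p1); exact: cvg_cst.
Qed.

Lemma essnorm_isometry T : linear_op phi p T ->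
  (forall f, Fock f -> nrm (T f) = nrm f) -> essnorm phi p T = 1%E.
Proof.
move=> lT iT; apply/eqP; rewrite eq_le; apply/andP; split.
  rewrite -(opnorm_isometry lT iT); apply: ereal_inf_lbound.
  exists (fun=> 0); first exact compact_zero.
  by apply: (congr1 (opnorm phi p)); apply/funext => f; rewrite subr0.
apply: le_ereal_inf_tmp => _ [K cK <-]; exact: isometry_sub_compact.
Qed.

Lemma rotation_isometry psi a : cabs a = 1 -> (forall z, psi z = a * z) ->
  forall f, Fock f -> nrm (Cop psi f) = nrm f.
Proof.
move=> a1 psiE f Ff; rewrite !nrm_fine.
have -> : Cop psi f = (fun z => f (a * z)) by apply/funext => z; rewrite /Cop /= psiE.
by have -> := Fnorm_rotation cphi p a1 (Fock_measurable Ff).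
Qed.

Lemma symbol_dichotomy psi : bounded_symbol phi p psi ->
  (exists a b, [/\ a != 0, cabs a < 1 & forall z, psi z = a * z + b]) \/
  (forall f, Fock f -> nrm (Cop psi f) = nrm f).
Proof.
move=> bpsi; have [a [b [a0 a1 psiE]]] := symbol_affine cphi gphi p1 bpsi.
move: a1; rewrite le_eqVlt => /predU1P[a1|a1]; [right|by left; exists a, b].
apply: (rotation_isometry a1) => z.
by rewrite psiE (symbol_rotation cphi gphi p1 bpsi psiE a1) addr0.
Qed.

End EssentialNorm.

(** * Singular values *)

(** For unit vectors, [X = n (x + y)] and [Y = n (x - y) ^+ 2]: by the parallelogram law, a sum of
    length nearly 2 leaves a small difference. *)
Lemma near_antipodal (R : realFieldType) (X Y E : R) : 0 <= X -> 0 <= E ->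
  2 - 3 * (E / 12) <= X -> X ^+ 2 + Y = 2 * 1 ^+ 2 + 2 * 1 ^+ 2 -> Y <= E.
Proof.
move=> X0 E0 EX; rewrite expr1n => P.
have [h|h] := leP 0 (2 - 3 * (E / 12)); last by have := sqr_ge0 X; lra.
have : (2 - 3 * (E / 12)) ^+ 2 <= X ^+ 2 by apply: lerXn2r.
by rewrite sqrrB !exprMn; have := sqr_ge0 (E / 12); rewrite expr_div_n; lra.
Qed.

Lemma near_double (R : realFieldType) (x y z s d : R) :
  2 * x <= z + y -> y <= d -> s - d <= x -> 2 * (s - d) - d <= z.
Proof. by move=> ? ? ?; lra. Qed.

(** The variational condition at a maximizer, with [l] the maximum, [x] the modulus of the inner
    product of two images and [y] the norm of the second image: the gain [2 l^-2 x^2] exceeds the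
    cost [l^-2 x^2] of renormalizing unless [x = 0]. *)
Lemma variation_eq0 (R : realFieldType) (l x y : R) : 0 < l ->
  l ^+ 2 + (l ^- 2 * x * y) ^+ 2 + 2 * (l ^- 2 * x ^+ 2) <=
    l ^+ 2 * (1 + (l ^- 2 * x) ^+ 2) -> x = 0.
Proof.
move=> l0; have i0 : 0 < l ^- 2 by rewrite invr_gt0 exprn_gt0.
have -> : l ^+ 2 * (1 + (l ^- 2 * x) ^+ 2) = l ^+ 2 + l ^- 2 * x ^+ 2.
  by field; rewrite gt_eqF.
have := sqr_ge0 (l ^- 2 * x * y) => h1 h2.
have : l ^- 2 * x ^+ 2 <= 0 by lra.
by rewrite pmulr_rle0// => h; apply/eqP; rewrite -(sqrf_eq0 x) eq_le h sqr_ge0.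
Qed.

(** * Singular vectors of an injective compact operator on a Hilbert subspace [H] of [V] *)

Section SingularValues.
Variables (R : realType) (V : lmodType R[i]) (H : V -> Prop).
Variables (ip : V -> V -> R[i]) (n : V -> R).
Implicit Types (x y z : V) (a t : R[i]) (L : seq V).
Hypotheses (H0 : H 0) (HZD : forall a x y, H x -> H y -> H (a *: x + y)).
Hypotheses (ipZD : forall a x y z, H x -> H y -> H z ->
    ip (a *: x + y) z = a * ip x z + ip y z)
  (ipC : forall x y, H x -> H y -> ip y x = (ip x y)^*)
  (ipn : forall x, H x -> ip x x = (n x ^+ 2)%:C).
Hypotheses (n_ge0 : forall x, 0 <= n x) (n_eq0 : forall x, H x -> n x = 0 -> x = 0)
  (nD : forall x y, H x -> H y -> n (x + y) <= n x + n y)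
  (nZ : forall a x, H x -> n (a *: x) = cabs a * n x).

Lemma subspaceD x y : H x -> H y -> H (x + y).
Proof. by move=> Hx Hy; rewrite -[x]scale1r; exact: HZD. Qed.

Lemma subspaceZ a x : H x -> H (a *: x).
Proof. by move=> Hx; rewrite -[_ *: _]addr0; exact: HZD. Qed.

Lemma subspaceB x y : H x -> H y -> H (x - y).
Proof. by move=> Hx Hy; rewrite addrC -scaleN1r; exact: HZD. Qed.

Lemma subspace_sum m (t : nat -> R[i]) (b : nat -> V) : (forall i, (i < m)%N -> H (b i)) ->
  H (\sum_(i < m) t i *: b i).
Proof.
elim: m => [|m IH] Hb; first by rewrite big_ord0.
by rewrite big_ord_recr /= addrC; apply: HZD; [exact: Hb|apply: IH => i im; exact/Hb/ltnW].
Qed.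

Definition linear_on (W : lmodType R[i]) (F : V -> W) :=
  forall a x y, H x -> H y -> F (a *: x + y) = a *: F x + F y.

Lemma linear_on0 (W : lmodType R[i]) (F : V -> W) : linear_on F -> F 0 = 0.
Proof.
move=> lF; have := lF 1 0 0 H0 H0; rewrite scale1r addr0 scale1r => /eqP.
by rewrite -subr_eq0 opprD addrA subrr add0r oppr_eq0 => /eqP.
Qed.

Lemma linear_on_sum (W : lmodType R[i]) (F : V -> W) m (t : nat -> R[i]) (b : nat -> V) : linear_on F ->
  (forall i, (i < m)%N -> H (b i)) ->
  F (\sum_(i < m) t i *: b i) = \sum_(i < m) t i *: F (b i).
Proof.
move=> lF; elim: m => [|m IH] Hb; first by rewrite !big_ord0 linear_on0.
rewrite !big_ord_recr /= addrC lF; [|exact: Hb|by apply: subspace_sum => i im; exact/Hb/ltnW].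
by rewrite IH 1?addrC// => i im; exact/Hb/ltnW.
Qed.

Lemma linear_onB (W : lmodType R[i]) (F : V -> W) x y : linear_on F -> H x -> H y -> F (x - y) = F x - F y.
Proof. by move=> lF Hx Hy; rewrite addrC -scaleN1r lF// scaleN1r addrC. Qed.

Lemma ip_linear z : H z -> linear_on (fun x => ip x z : R[i]^o).
Proof. by move=> Hz a x y Hx Hy; exact: ipZD. Qed.

Lemma ip0l z : H z -> ip 0 z = 0.
Proof. by move=> Hz; exact: (linear_on0 (ip_linear Hz)). Qed.

Lemma ipDl x y z : H x -> H y -> H z -> ip (x + y) z = ip x z + ip y z.
Proof. by move=> Hx Hy Hz; rewrite -[x]scale1r ipZD// mul1r scale1r. Qed.

Lemma ipZl a x z : H x -> H z -> ip (a *: x) z = a * ip x z.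
Proof. by move=> Hx Hz; rewrite -[_ *: _]addr0 ipZD// ip0l// addr0. Qed.

Lemma ipZr a x z : H x -> H z -> ip x (a *: z) = a^* * ip x z.
Proof.
move=> Hx Hz; rewrite (ipC (subspaceZ a Hz) Hx) ipZl// (ipC Hz Hx); exact: rmorphM.
Qed.

Lemma ipDr x y z : H x -> H y -> H z -> ip x (y + z) = ip x y + ip x z.
Proof.
move=> Hx Hy Hz; rewrite (ipC (subspaceD Hy Hz) Hx) ipDl// (ipC Hy Hx) (ipC Hz Hx).
exact: rmorphD.
Qed.

Lemma norm_subspace0 : n 0 = 0.
Proof. by rewrite -(scale0r (0 : V)) nZ// cabs0 mul0r. Qed.

Lemma norm_subspace_distC x y : H x -> H y -> n (x - y) = n (y - x).
Proof.
move=> Hx Hy; rewrite -(opprB y x) -(scaleN1r (y - x)) nZ; last exact: subspaceB.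
by rewrite cabsN cabs1 mul1r.
Qed.

Lemma norm_le_dist x y : H x -> H y -> n x <= n y + n (x - y).
Proof.
move=> Hx Hy; rewrite -{1}(subrK y x) (addrC _ y).
by apply: nD => //; exact: subspaceB.
Qed.

Lemma norm_subspaceD_sq x y : H x -> H y ->
  n (x + y) ^+ 2 = n x ^+ 2 + n y ^+ 2 + 2 * complex.Re (ip x y).
Proof.
move=> Hx Hy; have Hxy := subspaceD Hx Hy.
have : ip (x + y) (x + y) = (ip x x + ip x y) + ((ip x y)^* + ip y y).
  by rewrite ipDl// !ipDr// (ipC Hx Hy).
rewrite !ipn// => /(congr1 (@complex.Re R)) /=.
by case: (ip x y) => u v /= ->; ring.
Qed.

Lemma cabs_sqr a : cabs a ^+ 2 = complex.Re (a * a^*).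
Proof.
case: a => u v; rewrite /cabs /= sqr_sqrtr ?addr_ge0 ?sqr_ge0//; ring.
Qed.

Lemma parallelogram x y : H x -> H y ->
  n (x + y) ^+ 2 + n (x - y) ^+ 2 = 2 * n x ^+ 2 + 2 * n y ^+ 2.
Proof.
move=> Hx Hy; rewrite -scaleN1r !norm_subspaceD_sq ?nZ ?ipZr//; last exact: subspaceZ.
by rewrite cabsN cabs1 mul1r rmorphN rmorph1 mulN1r raddfN /=; ring.
Qed.

Lemma residual_sq x e : H x -> H e -> n e = 1 ->
  n (x - ip x e *: e) ^+ 2 = n x ^+ 2 - cabs (ip x e) ^+ 2.
Proof.
move=> Hx He e1; rewrite -scaleNr norm_subspaceD_sq ?nZ ?ipZr//; last exact: subspaceZ.
rewrite e1 mulr1 cabsN rmorphN mulNr raddfN /= cabs_sqr [_^* * _]mulrC.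
by ring.
Qed.

Lemma cabs_ip_unit x e : H x -> H e -> n e = 1 -> cabs (ip x e) <= n x.
Proof.
move=> Hx He e1; rewrite -(@ler_pXn2r _ 2) ?nnegrE ?n_ge0 ?cabs_ge0//.
by rewrite -subr_ge0 -residual_sq// sqr_ge0.
Qed.

Lemma pythagoras m (t : nat -> R[i]) (b : nat -> V) : (forall i, (i < m)%N -> H (b i)) ->
  (forall i j, (i < j)%N -> (j < m)%N -> ip (b i) (b j) = 0) ->
  n (\sum_(i < m) t i *: b i) ^+ 2 = \sum_(i < m) cabs (t i) ^+ 2 * n (b i) ^+ 2.
Proof.
elim: m => [|m IH] Hb ob; first by rewrite !big_ord0 norm_subspace0 expr0n.
have Hb' i : (i < m)%N -> H (b i) by move=> im; exact/Hb/ltnW.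
rewrite !big_ord_recr /= norm_subspaceD_sq; [|exact: subspace_sum|by apply: subspaceZ; exact: Hb].
rewrite ipZr; [|exact: subspace_sum|exact: Hb].
have -> : ip (\sum_(i < m) t i *: b i) (b m) = 0.
  rewrite (linear_on_sum t (ip_linear (Hb m (ltnSn m))) Hb') big1// => i _.
  by have -> := ob i m (ltn_ord i) (ltnSn m); exact: mulr0.
rewrite mulr0 raddf0 mulr0 addr0 IH//; last by move=> i j ij jm; exact/ob/ltnW.
by rewrite nZ ?exprMn//; exact: Hb.
Qed.

(** More unknowns than equations. It provides vectors orthogonal to a finite list, and later a
    combination of singular vectors whose first coefficients vanish. *)
Lemma kernel_vector m (A : nat -> nat -> R[i]) : exists t : nat -> R[i],
  (exists2 k, (k < m.+1)%N & t k != 0) /\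
  forall j, (j < m)%N -> \sum_(k < m.+1) t k * A k j = 0.
Proof.
pose M : 'M[R[i]]_(m.+1, m) := \matrix_(k, j) A k j.
have : kermx M != 0.
  rewrite -mxrank_eq0 mxrank_ker subn_eq0 -ltnNge ltnS; exact: rank_leq_col.
case/rowV0Pn => v /sub_kermxP vM v0.
exists (fun k => v 0 (inord k)); split.
  have /existsP[k vk] : [exists k, v 0 k != 0].
    apply: contraNT v0 => /existsPn h; apply/eqP/rowP => k; rewrite mxE.
    by have := h k; rewrite negbK => /eqP.
  by exists k => //; rewrite inord_val.
move=> j jm; have /rowP/(_ (Ordinal jm)) := vM; rewrite !mxE; apply: etrans.
by apply: eq_bigr => k _; rewrite inord_val mxE.
Qed.

Hypothesis complete : forall u : nat -> V, (forall k, H (u k)) ->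
  (forall e : R, 0 < e -> exists n0, forall j k, (n0 <= j)%N -> (n0 <= k)%N ->
    n (u j - u k) <= e) ->
  exists2 g, H g & forall e : R, 0 < e -> exists n0, forall k, (n0 <= k)%N -> n (u k - g) <= e.

Variables (T : V -> V) (B : R).
Hypotheses (HT : forall x, H x -> H (T x)) (Tlin : linear_on T)
  (TB : forall x, H x -> n (T x) <= B * n x)
  (Tinj : forall x, H x -> T x = 0 -> x = 0)
  (Tcpt : forall u : nat -> V, (forall k, H (u k)) -> (forall k, n (u k) <= 1) ->
    exists kappa : nat -> nat, {homo kappa : i j / (i < j)%N} /\
      forall e : R, 0 < e -> exists n0, forall j k, (n0 <= j)%N -> (n0 <= k)%N ->
        n (T (u (kappa j)) - T (u (kappa k))) <= e).
Variables (b : nat -> V) (c : nat -> V -> R[i]).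
Hypotheses (Hb : forall k, H (b k)) (clin : forall k, linear_on (c k : V -> R[i]^o))
  (cb : forall j k, c j (b k) = (j == k)%:R).

Definition orthogonal_to L x := forall i, (i < size L)%N -> ip x (nth 0 L i) = 0.
Definition unit_seq L := forall i, (i < size L)%N -> H (nth 0 L i) /\ n (nth 0 L i) = 1.
Definition maximizer L x := [/\ H x, n x = 1, orthogonal_to L x &
  forall y, H y -> orthogonal_to L y -> n (T y) <= n (T x) * n y].

(** Some nontrivial combination of [size L + 1] of the vectors [b k] is orthogonal to [L]; the
    functionals dual to the [b k] show that it is nonzero. *)
Lemma orthogonal_unit L : unit_seq L -> exists x, [/\ H x, n x = 1 & orthogonal_to L x].
Proof.
move=> uL; have [t [[k km tk] tA]] := kernel_vector (size L) (fun k j => ip (b k) (nth 0 L j)).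
pose x := \sum_(k < (size L).+1) t k *: b k.
have Hx : H x by exact: subspace_sum.
have cx : c k x = t k.
  rewrite /x (linear_on_sum _ (clin k))// (bigD1 (Ordinal km))//= cb eqxx big1 ?addr0.
    exact: mulr1.
  move=> i /eqP ik; rewrite cb; case: eqP => [ki|_]; last exact: mulr0.
  by case: ik; apply: val_inj.
have x0 : n x != 0.
  apply: contra_neq tk => x0; rewrite -cx (n_eq0 Hx x0); exact (linear_on0 (clin k)).
exists ((n x)^-1%:C *: x); split; first exact: subspaceZ.
  by rewrite nZ// cabs_real ger0_norm ?invr_ge0// mulVf.
move=> i iL; have [Hi _] := uL i iL; rewrite ipZl// /x (linear_on_sum _ (ip_linear Hi))//.
by have -> := tA i iL; rewrite mulr0.
Qed.

Lemma orthogonal_ZD L a x y : unit_seq L -> H x -> H y ->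
  orthogonal_to L x -> orthogonal_to L y -> orthogonal_to L (a *: x + y).
Proof.
move=> uL Hx Hy ox oy i iL; have [Hi _] := uL i iL.
by rewrite ipZD// ox// oy// mulr0 addr0.
Qed.

(* A maximizing sequence for the norm of [T] on the unit sphere is Cauchy along a
   subsequence, by the parallelogram law. *)
Lemma maximizer_exists L : unit_seq L -> exists x, maximizer L x.
Proof.
move=> uL; pose D x := [/\ H x, n x = 1 & orthogonal_to L x].
have [x0 Dx0] := orthogonal_unit uL.
pose S : set R := [set n (T x) | x in D].
have Sub : has_ubound S.
  by exists B => _ [x [Hx x1 _] <-]; have := TB Hx; rewrite x1 mulr1.
have S0 : S !=set0 by exists (n (T x0)), x0.
pose s := sup S.
have sup x : D x -> n (T x) <= s by move=> Dx; apply: ub_le_sup => //; exists x.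
(* Injectivity of [T] enters here. *)
have s0 : 0 < s.
  apply: lt_le_trans (sup _ Dx0); have [Hx x1 _] := Dx0.
  rewrite lt_def n_ge0 andbT; apply/eqP => /(n_eq0 (HT Hx))/(Tinj Hx) xx.
  by move: x1; rewrite xx norm_subspace0 => /eqP; rewrite eq_sym oner_eq0.
have scale y : H y -> orthogonal_to L y -> n (T y) <= s * n y.
  move=> Hy oy; have [y0|y0] := eqVneq (n y) 0.
    by rewrite (n_eq0 Hy y0) (linear_on0 Tlin) norm_subspace0 mulr0.
  have Dy : D ((n y)^-1%:C *: y).
    split; first exact: subspaceZ.
      by rewrite nZ// cabs_real ger0_norm ?invr_ge0// mulVf.
    rewrite -[_ *: _]addr0; apply: orthogonal_ZD => // i iL.
    by rewrite ip0l//; exact: (uL i iL).1.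
  have := sup _ Dy; rewrite -[_ *: _]addr0 Tlin// (linear_on0 Tlin) addr0 nZ; last exact: HT.
  rewrite cabs_real ger0_norm ?invr_ge0// ler_pdivrMl 1?mulrC//.
  by rewrite lt_def y0 n_ge0.
have seq k : exists x, D x /\ s - k.+1%:R^-1 < n (T x).
  have k0 : 0 < k.+1%:R^-1 :> R by rewrite invr_gt0.
  have [_ [x Dx <-] h] := sup_adherent k0 (conj S0 Sub).
  by exists x.
have [u uP] := choice seq.
have Hu k : H (u k) by have [[]] := uP k.
have u1 k : n (u k) = 1 by have [[]] := uP k.
have ou k : orthogonal_to L (u k) by have [[]] := uP k.
have [kappa [kmono kC]] := Tcpt Hu (fun k => eq_ind_r (fun r => r <= 1) (lexx 1) (u1 k)).
have kge k : (k <= kappa k)%N.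
  by elim: k => // k IH; apply: leq_ltn_trans IH _; exact: kmono.
have near e : 0 < e -> exists n0, forall k, (n0 <= k)%N -> s - e <= n (T (u (kappa k))).
  move=> e0; exists (Num.bound e^-1) => k kk; apply: le_trans (ltW (uP _).2).
  rewrite lerD2l lerN2 -[leRHS]invrK lef_pV2 ?posrE ?invr_gt0//.
  apply: ltW; apply: lt_le_trans (archi_boundP _) _; first by rewrite invr_ge0 ltW.
  by rewrite ler_nat (leq_trans kk)// (leq_trans (kge k)).
have uC e : 0 < e -> exists n0, forall j k, (n0 <= j)%N -> (n0 <= k)%N ->
    n (u (kappa j) - u (kappa k)) <= e.
  (* Then [2 s - 3 d <= n (T (x + y)) <= s * n (x + y)] yields [n (x + y) >= 2 - e^2 / 4], the form
     that [near_antipodal] expects. *)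
  move=> e0; pose d := s * e ^+ 2 / 12.
  have d0 : 0 < d by rewrite divr_gt0// mulr_gt0// exprn_gt0.
  have [n1 Hn1] := kC d d0; have [n2 Hn2] := near d d0.
  exists (maxn n1 n2) => j k; rewrite !geq_max => /andP[j1 j2] /andP[k1 k2].
  set x := u (kappa j); set y := u (kappa k).
  have Hx : H x := Hu _; have Hy : H y := Hu _.
  have P := parallelogram Hx Hy; rewrite !u1 in P.
  have oxy : orthogonal_to L (x + y).
    by rewrite -(scale1r x); exact (orthogonal_ZD 1 uL Hx Hy (ou _) (ou _)).
  have Txy := scale _ (subspaceD Hx Hy) oxy.
  have low : 2 * (s - d) - d <= n (T (x + y)).
    have Txx : T (x + y) = T x + T y by rewrite -{1}(scale1r x) Tlin// scale1r.
    have TTx : 2%:R *: T x = (T x + T y) + (T x - T y).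
      by rewrite addrACA subrr addr0 scaler_nat mulr2n.
    have := nD (subspaceD (HT Hx) (HT Hy)) (subspaceB (HT Hx) (HT Hy)).
    rewrite -TTx nZ; last exact: HT.
    rewrite cabs_nat -Txx => h; exact: near_double h (Hn1 _ _ j1 k1) (Hn2 _ j2).
  have N : 2 - 3 * (e ^+ 2 / 12) <= n (x + y).
    rewrite -(ler_pM2l s0); apply: le_trans Txy; apply: le_trans low.
    by rewrite /d le_eqVlt; apply/orP; left; apply/eqP; field.
  rewrite -(@ler_pXn2r _ 2) ?nnegrE ?n_ge0 ?(ltW e0)//.
  exact: near_antipodal (n_ge0 _) (sqr_ge0 e) N P.
have [g Hg gP] := complete (fun k => Hu (kappa k)) uC.
have D0 e : 0 < e -> exists y, [/\ D y, n (y - g) <= e & s - e <= n (T y)].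
  move=> e0; have [n1 Hn1] := gP e e0; have [n2 Hn2] := near e e0.
  exists (u (kappa (maxn n1 n2))); split; first by split.
    by apply: Hn1; rewrite leq_maxl.
  by apply: Hn2; rewrite leq_maxr.
have g1 : n g = 1.
  apply/eqP; rewrite eq_le; apply/andP; split; apply/ler_addgt0Pr => e e0.
    have [y [[Hy y1 _] yg _]] := D0 e e0; rewrite -y1.
    by apply: le_trans (norm_le_dist Hg Hy) _; rewrite lerD2l norm_subspace_distC.
  have [y [[Hy y1 _] yg _]] := D0 e e0; rewrite -y1.
  by apply: le_trans (norm_le_dist Hy Hg) _; rewrite lerD2l.
have og : orthogonal_to L g.
  move=> i iL; have [Hi i1] := uL i iL; apply/eqP; rewrite -cabs_eq0 eq_le cabs_ge0 andbT.
  apply/ler_addgt0Pr => e e0; rewrite add0r; have [y [[Hy y1 oy] yg _]] := D0 e e0.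
  apply: le_trans yg; rewrite norm_subspace_distC//; apply: le_trans (cabs_ip_unit (subspaceB Hg Hy) Hi i1).
  by rewrite (linear_onB (ip_linear Hi))// oy// subr0.
have B0 : 0 <= B.
  by have [Hx x1 _] := Dx0; have := TB Hx; rewrite x1 mulr1; apply: le_trans.
have Tg : s <= n (T g).
  apply/ler_addgt0Pr => e e0; have B1 : 0 < B + 1 by rewrite ltr_wpDl.
  have [y [[Hy _ _] yg Ty]] := D0 (e / (B + 1)) (divr_gt0 e0 B1).
  have := norm_le_dist (HT Hy) (HT Hg); rewrite -(linear_onB Tlin)// => h.
  rewrite -lerBlDr; have := TB (subspaceB Hy Hg) => h2.
  have h3 : B * n (y - g) <= B * (e / (B + 1)) by exact: ler_wpM2l.
  have eE : e = B * (e / (B + 1)) + e / (B + 1) by field; rewrite gt_eqF.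
  by move: h h2 h3 Ty eE; lra.
exists g; split => // y Hy oy; apply: le_trans (scale y Hy oy) _.
by apply: ler_wpM2r.
Qed.

Lemma maximizer_sequence : exists v : nat -> V, forall k, maximizer (mkseq v k) (v k).
Proof.
pose next L := xget 0 [set x | maximizer L x].
have nextP L : unit_seq L -> maximizer L (next L).
  move=> /maximizer_exists mL; exact: (xgetPex 0 mL).
pose Ls := fix Ls k := if k is j.+1 then rcons (Ls j) (next (Ls j)) else [::].
have uLs k : unit_seq (Ls k).
  elim: k => [|k IH] i //=; rewrite size_rcons ltnS nth_rcons leq_eqVlt.
  case/predU1P => [->|iL]; last by rewrite iL; exact: IH.
  by rewrite ltnn eqxx; have [] := nextP _ IH.
have LsE k : Ls k = mkseq (fun j => next (Ls j)) k.
  by elim: k => // k IH; rewrite mkseqS -IH.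
by exists (fun k => next (Ls k)) => k; rewrite -LsE; exact: nextP.
Qed.

Variable A : nat -> R.
Hypothesis TA : forall N x, H x -> (forall j, (j < N)%N -> c j x = 0) -> n (T x) <= A N * n x.

Theorem singular_values : exists v : nat -> V,
  [/\ forall k, H (v k), forall i j, ip (v i) (v j) = (i == j)%:R,
      forall i j, i != j -> ip (T (v i)) (T (v j)) = 0,
      forall k, 0 < n (T (v k)) <= A k &
      forall x N, H x ->
        n (T x - \sum_(k < N) ip x (v k) *: T (v k)) <= n (T (v N)) * n x].
Proof.
have [v vP] := maximizer_sequence.
have Hv k : H (v k) by have [] := vP k.
have v1 k : n (v k) = 1 by have [] := vP k.
have orthE k x : (forall i, (i < k)%N -> ip x (v i) = 0) <-> orthogonal_to (mkseq v k) x.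
  rewrite /orthogonal_to size_mkseq.
  by split=> h i ik; have := h i ik; rewrite nth_mkseq.
have vmax k y : H y -> (forall i, (i < k)%N -> ip y (v i) = 0) -> n (T y) <= n (T (v k)) * n y.
  by move=> Hy /orthE oy; have [_ _ _] := vP k; apply.
have vlt i j : (i < j)%N -> ip (v j) (v i) = 0.
  by move=> ij; have [_ _ /orthE o _] := vP j; exact: o.
have vgt i j : (i < j)%N -> ip (v i) (v j) = 0.
  by move=> ij; rewrite (ipC (Hv j) (Hv i)) vlt//; exact: rmorph0.
have vv i j : ip (v i) (v j) = (i == j)%:R.
  have [ij|ij|->] := ltngtP i j; [exact: vgt|exact: vlt|].
  by rewrite ipn// v1 expr1n.
have T0 k : 0 < n (T (v k)).
  rewrite lt_def n_ge0 andbT; apply/eqP => /(n_eq0 (HT (Hv k)))/(Tinj (Hv k)) xx.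
  by have := v1 k; rewrite xx norm_subspace0 => /eqP; rewrite eq_sym oner_eq0.
have Tlt i j : (i < j)%N -> ip (T (v i)) (T (v j)) = 0.
  move=> ij; set w := ip _ _; set l := n (T (v i)).
  have l0 : 0 < l := T0 i.
  (* Perturbing [v i] by [t *: v j] keeps it orthogonal to the earlier vectors, so maximality
     applies; the phase of [w] makes the cross term positive, and the scale [l ^- 2] makes it
     outweigh the growth of the vector. *)
  pose t : R[i] := (l ^- 2)%:C * w.
  have Hy : H (t *: v j + v i) := HZD _ (Hv j) (Hv i).
  have oy k : (k < i)%N -> ip (t *: v j + v i) (v k) = 0.
    by move=> ki; rewrite ipZD// !vlt ?mulr0 ?addr0//; exact: ltn_trans ij.
  have := vmax i _ Hy oy; rewrite -(@ler_pXn2r _ 2) ?nnegrE ?n_ge0 ?mulr_ge0//.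
  have -> : n (T (t *: v j + v i)) ^+ 2 =
      l ^+ 2 + (cabs t * n (T (v j))) ^+ 2 + 2 * complex.Re (t^* * w).
    rewrite Tlin// [_ *: _ + _]addrC norm_subspaceD_sq; [|exact: HT|by apply: subspaceZ; exact: HT].
    by rewrite ipZr ?nZ//; exact: HT.
  have -> : (l * n (t *: v j + v i)) ^+ 2 = l ^+ 2 * (1 + cabs t ^+ 2).
    rewrite exprMn [_ *: _ + _]addrC norm_subspaceD_sq ?ipZr ?nZ//; last exact: subspaceZ.
    by rewrite vgt// !v1 mulr0 raddf0 mulr0 addr0 expr1n mulr1.
  have -> : complex.Re (t^* * w) = l ^- 2 * cabs w ^+ 2.
    by rewrite cabs_sqr /t; case: (w) => p q /=; ring.
  have -> : cabs t = l ^- 2 * cabs w.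
    by rewrite /t cabsM cabs_real ger0_norm// invr_ge0 exprn_ge0// ltW.
  move=> h; apply/eqP; rewrite -cabs_eq0; apply/eqP; exact: variation_eq0 l0 h.
have vT i j : i != j -> ip (T (v i)) (T (v j)) = 0.
  rewrite neq_ltn => /orP[|] ij; first exact: Tlt.
  by rewrite (ipC (HT (Hv j)) (HT (Hv i))) Tlt//; exact: rmorph0.
have Tanti i j : (i <= j)%N -> n (T (v j)) <= n (T (v i)).
  move=> ij; have := vmax i (v j) (Hv j); rewrite v1 mulr1; apply.
  by move=> k ki; apply: vlt; exact: leq_trans ij.
exists v; split => //.
  move=> k; rewrite T0 /=.
  have [t [[m mk tm] tA]] := kernel_vector k (fun i j => c j (v i)).
  pose x := \sum_(i < k.+1) t i *: v i.
  have Hx : H x by exact: subspace_sum.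
  have cx j : (j < k)%N -> c j x = 0.
    by move=> jk; rewrite /x (linear_on_sum _ (clin j))//; exact: tA.
  have nx : n x ^+ 2 = \sum_(i < k.+1) cabs (t i) ^+ 2.
    rewrite /x pythagoras//; last by move=> i j ij _; exact: vgt.
    by apply: eq_bigr => i _; rewrite v1 expr1n mulr1.
  have x0 : 0 < n x.
    rewrite lt_def n_ge0 andbT -sqrf_eq0 nx psumr_eq0 => [|i _]; last exact: sqr_ge0.
    by apply/allPn; exists (Ordinal mk); rewrite ?mem_index_enum//= sqrf_eq0 cabs_eq0.
  rewrite -(ler_pM2r x0); apply: le_trans (TA Hx cx).
  rewrite -(@ler_pXn2r _ 2) ?nnegrE ?n_ge0 ?mulr_ge0// exprMn nx.
  (* The images are orthogonal with nonincreasing norms, so [n (T x)] is at least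
     [n (T (v k)) * n x]. *)
  rewrite /x (linear_on_sum _ Tlin)// (pythagoras t (b := fun i => T (v i))).
  - rewrite mulr_sumr; apply: ler_sum => i _; rewrite mulrC.
    apply: ler_wpM2l; first exact: sqr_ge0.
    by apply: lerXn2r; rewrite ?nnegrE ?n_ge0//; apply: Tanti; rewrite -ltnS.
  - by move=> i _; exact: HT.
  - by move=> i j ij _; apply: vT; rewrite neq_ltn ij.
move=> x N Hx.
(* The projection of [x] on the complement of the first [N] vectors: maximality of [v N] applies to
   it, and its norm is at most that of [x]. *)
pose r := x - \sum_(k < N) ip x (v k) *: v k.
have HS m : H (\sum_(k < m) ip x (v k) *: v k).
  exact: (subspace_sum (fun k => ip x (v k))).
have -> : T x - \sum_(k < N) ip x (v k) *: T (v k) = T r.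
  by rewrite /r (linear_onB Tlin)// (linear_on_sum (fun k => ip x (v k)) Tlin).
have or : forall i, (i < N)%N -> ip r (v i) = 0.
  move=> i iN; rewrite /r (linear_onB (ip_linear (Hv i)))//.
  rewrite (linear_on_sum (fun k => ip x (v k)) (ip_linear (Hv i)))//.
  rewrite (bigD1 (Ordinal iN))//= vv eqxx big1 ?addr0.
    by rewrite -[X in _ - X]/(ip x (v i) * 1) mulr1 subrr.
  move=> k /eqP ki; rewrite vv; case: eqP => [ik|_]; last exact: mulr0.
  by case: ki; apply: val_inj.
apply: le_trans (vmax N r (subspaceB Hx (HS N)) or) _.
apply: ler_wpM2l => //; rewrite -(@ler_pXn2r _ 2) ?nnegrE ?n_ge0//.
have Hr : H r := subspaceB Hx (HS N).
have -> : n x ^+ 2 = n r ^+ 2 + n (\sum_(k < N) ip x (v k) *: v k) ^+ 2 +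
    2 * complex.Re (ip r (\sum_(k < N) ip x (v k) *: v k)).
  by rewrite -norm_subspaceD_sq ?subrK.
have -> : ip r (\sum_(k < N) ip x (v k) *: v k) = 0.
  rewrite (ipC (HS N) Hr) (linear_on_sum (fun k => ip x (v k)) (ip_linear Hr))//.
  rewrite big1 ?rmorph0// => k _; rewrite (ipC Hr (Hv k)) or//.
  by rewrite -[LHS]/(_ * _) rmorph0 mulr0.
by rewrite raddf0 mulr0 addr0 lerDl sqr_ge0.
Qed.

(** Injectivity keeps every singular value positive, so normalizing the images [T (v k)] gives an
    infinite orthonormal sequence. *)
Corollary schmidt_exists : exists (lambda : nat -> R) (e sigma : nat -> V),
  [/\ forall k, H (e k) /\ H (sigma k), forall i j, ip (e i) (e j) = (i == j)%:R,
      forall i j, ip (sigma i) (sigma j) = (i == j)%:R,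
      forall k, 0 <= lambda k <= A k &
      forall x N, H x ->
        n (T x - \sum_(0 <= k < N) ((lambda k)%:C * ip x (e k)) *: sigma k) <=
          lambda N * n x].
Proof.
have [v [Hv vv vT lA res]] := singular_values.
pose l k := n (T (v k)); have l0 k : 0 < l k by have /andP[] := lA k.
have HTv k : H (T (v k)) := HT (Hv k).
exists l, v, (fun k => (l k)^-1%:C *: T (v k)); split => //.
- by move=> k; split; [exact: Hv|exact: subspaceZ].
- move=> i j; rewrite ipZl ?ipZr//; last exact: subspaceZ.
  have [<-|ij] := eqVneq i j; last by rewrite vT// !mulr0.
  rewrite ipn// -/(l i) -[true%:R]/(1%:C : R[i]); have li := lt0r_neq0 (l0 i).
  apply/eqP; rewrite eq_complex; apply/andP; split; rewrite /=; apply/eqP.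
    by field.
  by ring.
- move=> k; have /andP[lk0 lk1] := lA k; rewrite lk1 andbT; exact: ltW.
move=> x N Hx; have := res x N Hx; rewrite -(big_mkord xpredT (fun k => ip x (v k) *: T (v k))).
rewrite (_ : \sum_(0 <= k < N) ((l k)%:C * ip x (v k)) *: _ =
  \sum_(0 <= k < N) ip x (v k) *: T (v k))//.
apply: eq_bigr => k _; rewrite scalerA mulrAC -rmorphM divff ?mul1r//.
exact: lt0r_neq0.
Qed.

End SingularValues.

(** * The inner product for exponent 2 *)

Section InnerProduct.
Variables (R : realType) (phi : R -> R).
Hypotheses (cphi : continuous_weight phi) (gphi : quadratic_growth phi).
Implicit Types (f g h : R[i] -> C R) (a z : R[i]).
Local Notation nrm := (nrm phi 2).
Local Notation Fock := (Fock phi 2).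
Local Notation wabsp := (wabs phi).
Local Notation nu := (@lebesgue_measure R \x @lebesgue_measure R)%E.

Let two1 : 1 <= 2 :> R. Proof. by rewrite ler1n. Qed.
Let two0 : 0 < 2 :> R. Proof. by []. Qed.

Definition integrableT (u : R * R -> R) := nu.-integrable [set: R * R] (EFin \o u).

Lemma Rintegral_lin (s t : R) (u v w : R * R -> R) :
  integrableT u -> integrableT v -> integrableT w ->
  (\int[nu]_q (s * u q + t * v q + w q) =
   s * \int[nu]_q u q + t * \int[nu]_q v q + \int[nu]_q w q)%R.
Proof.
move=> iu iv iw.
have isu : integrableT (fun q => s * u q) := integrableZl measurableT s iu.
have itv : integrableT (fun q => t * v q) := integrableZl measurableT t iv.
have isum : integrableT (fun q => s * u q + t * v q) := integrableD measurableT isu itv.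
rewrite (RintegralD measurableT isum iw) (RintegralD measurableT isu itv).
by rewrite (RintegralZl s measurableT iu) (RintegralZl t measurableT iv).
Qed.

Lemma wabs_integral f : Fock f ->
  (\int[nu]_q (wabsp f q ^+ 2)%:E = (nrm f ^+ 2)%:E)%E.
Proof.
move=> Ff; have := Fnorm_integral phi f two0.
rewrite (nrmE Ff) poweR_EFin (powR_mulrn 2 (nrm_ge0 _ _ _)) => ->.
by apply: eq_integral => q _; rewrite (powR_mulrn 2 (wabs_ge0 _ _ _)).
Qed.

Lemma wabs_integrable f : Fock f -> integrableT (fun q => wabsp f q ^+ 2).
Proof.
move=> Ff; apply/integrableP; split.
  apply/measurable_EFinP; apply: measurable_funX.
  exact (measurable_wabs cphi (Fock_measurable Ff)).
have -> : (\int[nu]_q `|(EFin \o (fun q => wabsp f q ^+ 2)%R) q| = \int[nu]_q (wabsp f q ^+ 2)%:E)%E.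
  by apply: eq_integral => q _; rewrite /= ger0_norm ?sqr_ge0.
by rewrite wabs_integral// ltry.
Qed.

Definition iprod f g z : C R := f z * (g z)^* * (expR (- (2 * radial_extension phi z)))%:C.

Lemma innerE f g : inner phi f g =
  (\int[nu]_q complex.Re (iprod f g (plane q)))%R +i*
  (\int[nu]_q complex.Im (iprod f g (plane q)))%R.
Proof. by []. Qed.

Lemma cabs_iprod f g q : cabs (iprod f g (plane q)) = wabsp f q * wabsp g q.
Proof.
rewrite /iprod /wabs !cabsM cabs_real ger0_norm ?expR_ge0//.
have -> : cabs ((g (plane q))^*) = cabs (g (plane q)).
  by rewrite /cabs; case: (g _) => x y /=; rewrite sqrrN.
have -> : expR (- (2 * radial_extension phi (plane q))) =
    expR (- phi (cabs (plane q))) * expR (- phi (cabs (plane q))).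
  by rewrite -expRD /radial_extension; congr expR; ring.
by ring.
Qed.

Lemma measurable_iprod f g : Fock f -> Fock g -> measurableC (iprod f g).
Proof.
move=> Ff Fg; have [mg1 mg2] := Fock_measurable Fg.
have mgc : measurableC (fun z => (g z)^*).
  apply: (measurableC_ReIm mg1 (measurable_funN mg2)) => q.
  by rewrite /=; case: (g (plane q)).
have mw : measurable_fun [set: R * R]
    (fun q : R * R => expR (- (2 * phi (cabs (plane q))))).
  apply: measurableT_comp; first exact: measurable_expR.
  apply: measurableT_comp; first exact: oppr_measurable.
  by apply: measurable_funM => //; exact: measurable_weight.
have mwC : measurableC (fun z => (expR (- (2 * radial_extension phi z)))%:C).
  by apply: (measurableC_ReIm mw (@measurable_cst _ _ _ _ _ (0 : R))).
exact (measurableCM (measurableCM (Fock_measurable Ff) mgc) mwC).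
Qed.

(** The modulus of the integrand is a product [x * y] of weighted moduli, dominated by the
    integrable [x^2 + y^2]. *)
Lemma iprod_integrable f g : Fock f -> Fock g ->
  integrableT (fun q => complex.Re (iprod f g (plane q))) /\
  integrableT (fun q => complex.Im (iprod f g (plane q))).
Proof.
move=> Ff Fg; have [m1 m2] := measurable_iprod Ff Fg.
have isum : integrableT (fun q => wabsp f q ^+ 2 + wabsp g q ^+ 2) :=
  integrableD measurableT (wabs_integrable Ff) (wabs_integrable Fg).
have bound q : cabs (iprod f g (plane q)) <= `|wabsp f q ^+ 2 + wabsp g q ^+ 2|.
  rewrite cabs_iprod; apply: le_trans (ler_norm _).
  have := wabs_ge0 phi f q; have := wabs_ge0 phi g q.
  move: (wabsp f q) (wabsp g q) => x y y0 x0.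
  by have := sqr_ge0 (x - y); rewrite sqrrB; have := mulr_ge0 x0 y0; lra.
have le (u : R * R -> R) : measurable_fun [set: R * R] u ->
    (forall q, `|u q| <= `|wabsp f q ^+ 2 + wabsp g q ^+ 2|) -> integrableT u.
  move=> mu ub; have mE : measurable_fun [set: R * R] (EFin \o u) by apply/measurable_EFinP.
  have ubE q : [set: R * R] q ->
      (`|(EFin \o u) q| <= `|(EFin \o (fun q => wabsp f q ^+ 2 + wabsp g q ^+ 2)%R) q|)%E.
    by move=> _; rewrite /= lee_fin.
  exact (le_integrable (mu := nu) measurableT mE ubE isum).
split; apply: le; [exact m1| |exact m2|] => q; apply: le_trans (bound q).
- exact: normr_Re.
- exact: normr_Im.
Qed.

Lemma innerZD a f g h : Fock f -> Fock g -> Fock h ->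
  inner phi (a *: f + g) h = a * inner phi f h + inner phi g h.
Proof.
move=> Ff Fg Fh; rewrite !innerE.
have [f1 f2] := iprod_integrable Ff Fh; have [g1 g2] := iprod_integrable Fg Fh.
have E q : iprod (a *: f + g) h (plane q) =
    a * iprod f h (plane q) + iprod g h (plane q).
  have -> : iprod (a *: f + g) h (plane q) = (a * f (plane q) + g (plane q)) *
    (h (plane q))^* * (expR (- (2 * radial_extension phi (plane q))))%:C by [].
  by rewrite /iprod; ring.
have ReE q : complex.Re (iprod (a *: f + g) h (plane q)) =
    complex.Re a * complex.Re (iprod f h (plane q)) +
    (- complex.Im a) * complex.Im (iprod f h (plane q)) + complex.Re (iprod g h (plane q)).
  by rewrite E; case: (a) (iprod f h _) (iprod g h _) => ? ? [? ?] [? ?] /=; ring.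
have ImE q : complex.Im (iprod (a *: f + g) h (plane q)) =
    complex.Re a * complex.Im (iprod f h (plane q)) +
    complex.Im a * complex.Re (iprod f h (plane q)) + complex.Im (iprod g h (plane q)).
  by rewrite E; case: (a) (iprod f h _) (iprod g h _) => ? ? [? ?] [? ?] /=; ring.
have -> := eq_Rintegral nu (D := setT) (fun q _ => ReE q); have -> := eq_Rintegral nu (D := setT) (fun q _ => ImE q).
have -> := Rintegral_lin (complex.Re a) (- complex.Im a) f1 f2 g1.
have -> := Rintegral_lin (complex.Re a) (complex.Im a) f2 f1 g2.
move: (Rintegral _ _ _) (Rintegral _ _ _) (Rintegral _ _ _) (Rintegral _ _ _) => r1 r2 r3 r4.
by case: (a) => x y; apply/eqP; rewrite eq_complex /=; apply/andP; split; apply/eqP; ring.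
Qed.

Lemma innerC f g : Fock f -> Fock g -> inner phi g f = (inner phi f g)^*.
Proof.
move=> Ff Fg; rewrite !innerE.
have E q : iprod g f (plane q) = (iprod f g (plane q))^*.
  rewrite /iprod; case: (f _) (g _) => ? ? [? ?].
  by apply/eqP; rewrite eq_complex /=; apply/andP; split; apply/eqP; ring.
have [f1 f2] := iprod_integrable Ff Fg.
have ReE q : complex.Re (iprod g f (plane q)) = complex.Re (iprod f g (plane q)).
  by rewrite E; case: (iprod f g _).
have ImE q : complex.Im (iprod g f (plane q)) = (-1) * complex.Im (iprod f g (plane q)).
  by rewrite E; case: (iprod f g _) => x y /=; rewrite mulN1r.
have -> := eq_Rintegral nu (D := setT) (fun q _ => ReE q); have -> := eq_Rintegral nu (D := setT) (fun q _ => ImE q).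
by have -> := RintegralZl (-1) measurableT f2; rewrite mulN1r.
Qed.

Lemma inner_nrm f : Fock f -> inner phi f f = (nrm f ^+ 2)%:C.
Proof.
move=> Ff; rewrite !innerE.
have E q : iprod f f (plane q) = (wabsp f q ^+ 2)%:C.
  have := cabs_iprod f f q; rewrite /iprod -expr2 => H; rewrite -H.
  case: (f _) => x y; set w := expR _; have w0 : 0 <= w by exact: expR_ge0.
  have -> : (x +i* y) * (x +i* y)^* * w%:C = ((x ^+ 2 + y ^+ 2) * w)%:C.
    by apply/eqP; rewrite eq_complex /=; apply/andP; split; apply/eqP; ring.
  by rewrite cabs_real ger0_norm// mulr_ge0 ?addr_ge0 ?sqr_ge0.
have ReE q : complex.Re (iprod f f (plane q)) = wabsp f q ^+ 2 by rewrite E.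
have ImE q : complex.Im (iprod f f (plane q)) = 0 by rewrite E.
have -> := eq_Rintegral nu (D := setT) (fun q _ => ReE q); have -> := eq_Rintegral nu (D := setT) (fun q _ => ImE q).
have -> : (\int[nu]_q (wabsp f q ^+ 2))%R = nrm f ^+ 2.
  by rewrite /Rintegral wabs_integral.
have -> : (\int[nu]_q (0 : R))%R = 0 by rewrite /Rintegral integral0.
by [].
Qed.

End InnerProduct.

(** * Schmidt decomposition of a contraction and summability *)

Section Schatten.
Variables (R : realType) (phi : R -> R).
Hypotheses (cphi : continuous_weight phi) (gphi : quadratic_growth phi).
Implicit Types (f g psi : R[i] -> C R) (a b z : R[i]) (c d : nat -> R[i]).
Local Notation nrm := (nrm phi 2).
Local Notation Fock := (Fock phi 2).

Let two1 : 1 <= 2 :> R. Proof. by rewrite ler1n. Qed.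

Definition taylor_coef f : nat -> R[i] := xget (fun=> 0) [set c | has_taylor f c].

Lemma taylor_coef_has_taylor f : Fock f -> has_taylor f (taylor_coef f).
Proof. by move=> /Fock_taylor fc; exact: (xgetPex (fun=> 0) fc). Qed.

Lemma taylor_coefE f c : has_taylor f c -> taylor_coef f = c.
Proof.
move=> fc; have h : has_taylor f (taylor_coef f).
  by apply: (xgetPex (fun=> 0)); exists c.
exact: has_taylor_unique h fc.
Qed.

Lemma contraction_schmidt psi a b : bounded_symbol phi 2 psi -> a != 0 -> cabs a < 1 ->
  (forall z, psi z = a * z + b) ->
  exists A mu lambda e sigma, [/\ 0 < A, 0 < mu < 1, 
    schmidt_decomposition phi (Cop psi) lambda e sigma &
    forall k, 0 <= lambda k <= A * mu ^+ k].
Proof.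
move=> bpsi a0 a1 psiE; have [_ _ bT] := bpsi; have lT := bT.1.
have cT := contraction_compact cphi gphi two1 lT psiE a1.
have [B B0 HB] := bounded_op_bound cphi gphi two1 bT.
have [M [mu [M0 mu0 mu1 HM]]] := contraction_bound cphi gphi two1 psiE a1.
pose A := M / (1 - mu).
have A0 : 0 < A by rewrite divr_gt0// subr_gt0.
(* As [a] is nonzero, [psi] is onto. *)
have Tinj f : Fock f -> Cop psi f = 0 -> f = 0.
  move=> _ Tf; apply/funext => z.
  have -> : f z = Cop psi f ((z - b) / a).
    by rewrite /Cop /= psiE mulrC divfK// subrK.
  by rewrite Tf.
have Tcpt (u : nat -> (R[i] -> C R)) : (forall k, Fock (u k)) -> (forall k, nrm (u k) <= 1) ->
    exists kappa : nat -> nat, {homo kappa : i j / (i < j)%N} /\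
      forall e : R, 0 < e -> exists n0, forall j k, (n0 <= j)%N -> (n0 <= k)%N ->
        nrm (Cop psi (u (kappa j)) - Cop psi (u (kappa k))) <= e.
  move=> Fu u1; have [|kappa [g [kmono Fg Kg]]] := cT.2 u Fu.
    by exists 1 => n; rewrite (nrmE (Fu n)) lee_fin.
  have FT n : Fock (Cop psi (u (kappa n))) := lT.1 _ (Fu (kappa n)).
  have {}Kg := (Fnorm_cvg0 (fun n => FockB cphi two1 (FT n) Fg)).2 Kg.
  exists kappa; split; first exact kmono.
  move=> e e0; have [n0 Hn] := Kg (e / 2) (divr_gt0 e0 (ltr0Sn _ 1)).
  exists n0 => j k jn kn.
  have -> : Cop psi (u (kappa j)) - Cop psi (u (kappa k)) =
      (Cop psi (u (kappa j)) - g) - (Cop psi (u (kappa k)) - g).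
    by rewrite opprB addrA subrK.
  apply: (le_trans (nrmB cphi two1 (FockB cphi two1 (FT j) Fg) (FockB cphi two1 (FT k) Fg))).
  by rewrite (splitr e); apply: lerD; apply: Hn.
have clin k : linear_on Fock (fun f => taylor_coef f k : R[i]^o).
  move=> t f g Ff Fg.
  by have -> := taylor_coefE (has_taylor_lin t (taylor_coef_has_taylor Ff) (taylor_coef_has_taylor Fg)).
have cb j k : taylor_coef (monomial R k) j = (j == k)%:R.
  by have -> := taylor_coefE (@has_taylor_monomial R k).
(* The head of [contraction_bound] vanishes, and its tail is exactly [A * mu ^+ N * nrm f]. *)
have TA N f : Fock f -> (forall j, (j < N)%N -> taylor_coef f j = 0) ->
    nrm (Cop psi f) <= A * mu ^+ N * nrm f.
  move=> Ff f0; apply: le_trans (HM f _ N Ff (lT.1 _ Ff) (taylor_coef_has_taylor Ff)) _.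
  rewrite big1 => [|k _]; last by rewrite f0// cabs0 mul0r.
  by rewrite add0r /A le_eqVlt; apply/orP; left; apply/eqP; ring.
have [lambda [e [sigma [Fes ee ss lA res]]]] := schmidt_exists
  (V := R[i] -> C R) (H := Fock) (ip := inner phi) (n := nrm)
  (Fock0 cphi two1) (fun t f g => FockZD cphi two1 t (f := f) (g := g))
  (fun t f g h => innerZD cphi t (f := f) (g := g) (h := h))
  (fun f g => innerC cphi (f := f) (g := g))
  (fun f => inner_nrm (f := f))
  (nrm_ge0 phi 2) (fun f => nrm_eq0 cphi gphi two1 (f := f))
  (fun f g => nrmD cphi two1 (f := f) (g := g))
  (fun t f => nrmZ cphi two1 t (f := f))
  (Fock_complete cphi gphi two1)
  lT.1 lT.2 HB Tinj Tcpt (Fock_monomial cphi gphi two1) clin cb TA.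
have mu01 : 0 <= mu < 1 by rewrite ltW.
have mono K n : (K <= n)%N -> mu ^+ n <= mu ^+ K.
  by move=> Kn; apply: ler_wiXn2l => //; exact: ltW.
exists A, mu, lambda, e, sigma; split; [exact A0|by rewrite mu0| |exact lA].
split.
- split; split => [k|]; [exact (Fes k).1|exact ee|exact (Fes k).2|exact ss].
- by move=> k; have /andP[] := lA k.
- apply/cvgrPdistC_le => t t0; have [K HK] := geometric_eventually_le (ltW A0) mu01 t0.
  exists K => // n /= Kn; have /andP[l0 l1] := lA n.
  rewrite subr0 ger0_norm//; apply: le_trans l1 _; apply: le_trans HK.
  by apply: ler_wpM2l; [exact: ltW|exact: mono].
move=> f Ff.
have FS N : Fock (\sum_(0 <= n < N) ((lambda n)%:C * inner phi f (e n)) *: sigma n).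
  rewrite (big_mkord xpredT (fun n => ((lambda n)%:C * inner phi f (e n)) *: sigma n)).
  exact (subspace_sum (Fock0 cphi two1) (fun t f g => FockZD cphi two1 t (f := f) (g := g))
    (fun n => (lambda n)%:C * inner phi f (e n)) (fun i _ => (Fes i).2)).
apply: (Fnorm_cvg0 (fun N => FockB cphi two1 (lT.1 _ Ff) (FS N))).1 => t t0.
have Af : 0 <= A * nrm f by rewrite mulr_ge0 ?nrm_ge0// ltW.
have [K HK] := geometric_eventually_le Af mu01 t0.
exists K => n Kn; apply: le_trans (res f n Ff) _; apply: le_trans HK.
have /andP[l0 l1] := lA n; rewrite mulrAC; apply: ler_wpM2r; first exact: nrm_ge0.
by apply: le_trans l1 _; apply: ler_wpM2l; [exact: ltW|exact: mono].
Qed.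

Lemma geometric_powR_summable (A mu s : R) (lambda : nat -> R) : 0 < A -> 0 < mu < 1 -> 0 < s ->
  (forall k, 0 <= lambda k <= A * mu ^+ k) ->
  (\sum_(0 <= k <oo) (lambda k `^ s)%:E < +oo)%E.
Proof.
move=> A0 /andP[mu0 mu1] s0 lA; pose q := mu `^ s.
have q0 : 0 <= q by exact: powR_ge0.
have q1 : q < 1.
  have : mu `^ s < 1 `^ s by apply: gt0_ltr_powR; rewrite ?nnegrE// ltW.
  by rewrite powR1.
have le k : lambda k `^ s <= A `^ s * q ^+ k.
  have /andP[l0 l1] := lA k.
  have -> : A `^ s * q ^+ k = (A * mu ^+ k) `^ s.
    rewrite powRM ?exprn_ge0 ?ltW//; congr (_ * _).
    by rewrite -(powR_mulrn k (ltW mu0)) -powRrM mulrC powRrM powR_mulrn.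
  by apply: ge0_ler_powR; rewrite ?nnegrE ?(ltW s0)// mulr_ge0 ?exprn_ge0 ?ltW.
apply: (@le_lt_trans _ _ (A `^ s * q ^+ 0 / (1 - q))%:E); last exact: ltry.
apply: lime_le.
  by apply: is_cvg_nneseries => k _ _; rewrite lee_fin powR_ge0.
apply: nearW => n; rewrite sumEFin lee_fin.
apply: le_trans (geometric_sum_le _ _ (leq0n n)); [|exact: powR_ge0|by rewrite q0].
by apply: ler_sum => k _; exact: le.
Qed.

End Schatten.

Theorem theorem2p2 (R : realType) (phi : R -> R)
    (hphi : admissible_weight phi) (p : R) (hp : 0 < p) :
  let noncompact_symbol :=
    [set psi | bounded_symbol phi p psi /\ ~ compact_op phi p (Cop psi)] in
  [/\ 1 <= p ->
        (forall psi, noncompact_symbol psi ->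
           (essnorm phi p (Cop psi) <= 1)%E) /\
        comparable_on noncompact_symbol
          (fun psi => essnorm phi p (Cop psi))
          (fun psi => opnorm phi p (Cop psi)),
      p = 2 ->
        forall psi, noncompact_symbol psi ->
          essnorm phi p (Cop psi) = opnorm phi p (Cop psi) /\
          opnorm phi p (Cop psi) = 1%E &
      p = 2 ->
        forall psi, bounded_symbol phi p psi -> compact_op phi p (Cop psi) ->
          forall s : R, 0 < s -> schatten phi s (Cop psi)].
Proof.
have cphi : continuous_weight phi by case: hphi => _ /C2_continuous_weight.
have gphi := admissible_quadratic_growth hphi.
have norms : 1 <= p -> forall psi, bounded_symbol phi p psi ->
    ~ compact_op phi p (Cop psi) ->
    essnorm phi p (Cop psi) = 1%E /\ opnorm phi p (Cop psi) = 1%E.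
  move=> p1 psi bpsi ncT; have [_ _ [lT _]] := bpsi.
  have [[a [b [_ a1 psiE]]]|iT] := symbol_dichotomy cphi gphi p1 bpsi.
    by case: ncT; exact (contraction_compact cphi gphi p1 lT psiE a1).
  by split; [exact (essnorm_isometry cphi gphi p1 lT iT)|exact (opnorm_isometry cphi gphi p1 lT iT)].
split.
- move=> p1; split=> [psi [bpsi ncT]|]; first by have [-> _] := norms p1 psi bpsi ncT.
  (* Both norms equal 1 for every such symbol, so the constant 1 is uniform. *)
  exists 1 => // psi [bpsi ncT]; have [-> ->] := norms p1 psi bpsi ncT.
  by rewrite mul1e.
- move=> p2 psi [bpsi ncT]; have p1 : 1 <= p by rewrite p2 ler1n.
  by have [-> ->] := norms p1 psi bpsi ncT.
move=> p2; subst p => psi bpsi cT s s0; split; first exact cT.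
have p1 : 1 <= 2 :> R by rewrite ler1n.
have [_ _ [lT _]] := bpsi.
have [[a [b [a0 a1 psiE]]]|iT] := symbol_dichotomy cphi gphi p1 bpsi; last first.
  by case: (isometry_not_compact cphi gphi p1 lT iT cT).
have [A [mu [lambda [e [sigma [A0 mu01 sch lA]]]]]] := contraction_schmidt cphi gphi bpsi a0 a1 psiE.
exists lambda, e, sigma; split; [exact sch|exact (geometric_powR_summable A0 mu01 s0 lA)].
Qed.
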